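(* Let $n$ be a positive integer. There exists a constant $c_0>0$ (depending only on the dimension $n$) such that for every bounded, smooth domain $\Omega\subset\mathbb{R}^n$ with Lebesgue measure $|\Omega|=1$, the limit exists and $$\lim_{m\to\infty} l_m^1(\Omega)=c_0 .$$ In particular, $c_0$ is independent of $\Omega$.
   Context: For an open set $A\subset\mathbb{R}^n$ of finite measure, $\lambda_1(A)$ denotes the first eigenvalue of $-\Delta$ on $A$ with zero Dirichlet boundary condition on $\partial A$. An $l^1$-minimal $m$-partition of $\Omega$ is a partition of $\Omega$ into $m$ mutually disjoint subsets $\Omega_1,\dots,\Omega_m$ (with $\Omega=\bigcup_{j=1}^m\Omega_j$, understood up to the interfaces) that minimizes $\sum_{j=1}^m\lambda_1(\Omega_j)$ among all such partitions, and $$l_m^1(\Omega)=\frac{\sum_{j=1}^m\lambda_1(\Omega_j)}{m^{1+2/n}},$$ where $\{\Omega_j\}_{j=1}^m$ is an $l^1$-minimal $m$-partition of $\Omega$. The minimal value $\sum_j\lambda_1(\Omega_j)$ is made precise by the following equivalent formulation. Let $\Sigma^m=\{y\in\mathbb{R}^m:\ \sum_{k\neq l}y_k^2y_l^2=0\}$ (vectors with at most one nonzero coordinate), and let $H_0^1(\Omega,\Sigma^m)$ be the set of $u=(u_1,\dots,u_m)$ with each $u_j\in H_0^1(\Omega)$ and $u(x)\in\Sigma^m$ for a.e. $x\in\Omega$. Then the minimal value of $\sum_{j=1}^m\lambda_1(\Omega_j)$ is $$\min\Big\{\int_\Omega|\nabla u|^2\,dx:\ u\in H_0^1(\Omega,\Sigma^m),\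 \int_\Omega u_j^2\,dx=1\ \text{for all } j=1,\dots,m\Big\},\qquad |\nabla u|^2=\sum_{j=1}^m|\nabla u_j|^2 ,$$ so $l_m^1(\Omega)$ equals this minimum divided by $m^{1+2/n}$. *)

(* Defs.v *)
From HB Require Import structures.
From mathcomp Require Import all_boot all_order all_algebra.
From mathcomp Require Import all_classical all_reals all_analysis.
Import Order.TTheory GRing.Theory Num.Theory.
Import numFieldNormedType.Exports.

Set Implicit Arguments.
Unset Strict Implicit.
Unset Printing Implicit Defensive.

Local Open Scope classical_set_scope.
Local Open Scope ring_scope.

(* The product sigma-algebra on row vectors, as for [n.-tuple T]. *)
Definition measure_row_display : measure_display -> measure_display.
Proof. exact. Qed.

Section measurable_row.
Context {d} {T : measurableType d}.
Variable n : nat.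

Let coors : 'I_n -> 'rV[T]_n -> T := fun i x => x ord0 i.

Let row_set0 : g_sigma_preimage coors set0.
Proof. exact: sigma_algebra0. Qed.

Let row_setC A : g_sigma_preimage coors A -> g_sigma_preimage coors (~` A).
Proof. exact: sigma_algebraC. Qed.

Let row_bigcup (F : (set 'rV[T]_n)^nat) :
  (forall i, g_sigma_preimage coors (F i)) ->
  g_sigma_preimage coors (\bigcup_i (F i)).
Proof. exact: sigma_algebra_bigcup. Qed.

HB.instance Definition _ := @isMeasurable.Build (measure_row_display d)
  'rV[T]_n (g_sigma_preimage coors) row_set0 row_setC row_bigcup.

End measurable_row.

Lemma measurable_coord d (T : measurableType d) n (i : 'I_n) :
  measurable_fun [set: 'rV[T]_n] (fun x : 'rV[T]_n => x ord0 i).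
Proof.
move=> _ Y mY; rewrite setTI; apply: sub_sigma_algebra => /=.
rewrite -bigcup_seq/=; exists i => /=; first by rewrite mem_index_enum.
by exists Y => //; rewrite setTI.
Qed.

Lemma measurable_fun_rowP d1 d2 (T1 : measurableType d1)
    (T2 : measurableType d2) n (f : T1 -> 'rV[T2]_n) :
  (forall i, measurable_fun [set: T1] (fun x => f x ord0 i)) ->
  measurable_fun [set: T1] f.
Proof.
move=> mf.
suff H : g_sigma_preimage (fun i x => f x ord0 i) `<=` measurable.
  move=> _ A mA; rewrite setTI; apply: H.
  rewrite (@g_sigma_preimage_comp _ _ _ _
    (fun i (x : 'rV[T2]_n) => x ord0 i) _ f).
  by exists A => //; rewrite setTI.
apply: smallest_sub; first exact: sigma_algebra_measurable.
case: n => [|n] in f mf *; first by rewrite big_ord0.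
rewrite -bigcup_mkord_ord; apply: bigcup_sub => i Ii.
by move=> A [B mB <-]; exact: mf.
Qed.

Section lebesgue_row.
Context {R : realType}.

(* [row_mx x%:M y : 'rV_(1 + n)], and [1 + n] is convertible to [n.+1]. *)
Definition row_cons n (p : R * 'rV[R]_n) : 'rV[R]_n.+1 :=
  row_mx (p.1%:M : 'rV[R]_1) p.2.

Lemma row_cons0 n (p : R * 'rV[R]_n) : row_cons p ord0 ord0 = p.1.
Proof.
have := row_mxEl (p.1%:M : 'rV[R]_1) p.2 ord0 ord0.
rewrite [RHS]mxE eqxx mulr1n => <-; congr (row_mx _ _ _ _).
exact: val_inj.
Qed.

Lemma row_consS n (p : R * 'rV[R]_n) i :
  row_cons p ord0 (lift ord0 i) = p.2 ord0 i.
Proof.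
rewrite -(row_mxEr (p.1%:M : 'rV[R]_1) p.2); congr (row_mx _ _ _ _).
exact: val_inj.
Qed.

Definition row_uncons n (x : 'rV[R]_n.+1) : R * 'rV[R]_n :=
  (x ord0 ord0, \row_j x ord0 (lift ord0 j)).

Lemma row_consK n : cancel (@row_cons n) (@row_uncons n).
Proof.
move=> [a y]; rewrite /row_uncons row_cons0; congr pair.
by apply/rowP => j; rewrite mxE row_consS.
Qed.

Lemma measurable_row_cons n : measurable_fun setT (@row_cons n).
Proof.
apply: measurable_fun_rowP => i; case: (unliftP ord0 i) => [j|] ->.
  under eq_fun do rewrite row_consS.
  apply: (measurableT_comp (f := fun y : 'rV[R]_n => y ord0 j)) => //.
  exact: measurable_coord.
under eq_fun do rewrite row_cons0.
exact: measurable_fst.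
Qed.

Lemma measurable_row_uncons n : measurable_fun setT (@row_uncons n).
Proof.
apply: measurable_fun_pair => /=; first exact: measurable_coord.
apply: measurable_fun_rowP => i.
by under eq_fun do rewrite mxE; exact: measurable_coord.
Qed.

Section step.
Variables (n : nat) (mu : {sigma_finite_measure set 'rV[R]_n -> \bar R}).

Local Notation prod := (@lebesgue_measure R \x mu)%E.

Definition lebesgue_rowS : set 'rV[R]_n.+1 -> \bar R :=
  pushforward prod (@row_cons n).

Let rowS0 : lebesgue_rowS set0 = 0%E.
Proof. by rewrite /lebesgue_rowS /pushforward preimage_set0 measure0. Qed.

Let rowS_ge0 A : (0 <= lebesgue_rowS A)%E.
Proof. by rewrite /lebesgue_rowS /pushforward; exact: integral_ge0. Qed.

Let rowS_sigma_additive : semi_sigma_additive lebesgue_rowS.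
Proof.
move=> F mF tF mUF; rewrite /lebesgue_rowS /pushforward preimage_bigcup.
apply: measure_semi_sigma_additive.
- by move=> k; rewrite -[X in measurable X]setTI; exact: measurable_row_cons.
- apply/trivIsetP => /= i j _ _ ij; rewrite -preimage_setI.
  by move/trivIsetP : tF => /(_ _ _ _ _ ij) ->//; rewrite preimage_set0.
- rewrite -preimage_bigcup -[X in measurable X]setTI.
  exact: measurable_row_cons.
Qed.

HB.instance Definition _ := isMeasure.Build _ _ _ lebesgue_rowS
  rowS0 rowS_ge0 rowS_sigma_additive.

Let rowS_sigma_finite : sigma_finite setT lebesgue_rowS.
Proof.
have /sigma_finiteP[F [TF ndF Foo]] := sigma_finiteT (@lebesgue_measure R).
have /sigma_finiteP[G [TG ndG Goo]] := sigma_finiteT mu.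
exists (fun k => @row_uncons n @^-1` (F k `*` G k)).
  rewrite -preimage_bigcup (_ : \bigcup_k _ = setT) ?preimage_setT//.
  rewrite -setXTT TF TG predeqE => -[x y]; split.
    by move=> [k _ []/= ? ?]; split; exists k.
  move=> [/= [k _ Fkx] [l _ Gly]]; exists (maxn k l) => //; split.
  - by move: x Fkx; exact/subsetPset/ndF/leq_maxl.
  - by move: y Gly; exact/subsetPset/ndG/leq_maxr.
move=> k; have [? ?] := Foo k; have [? ?] := Goo k; split.
  rewrite -[X in measurable X]setTI; apply: measurable_row_uncons => //.
  exact: measurableX.
rewrite /lebesgue_rowS /pushforward -comp_preimage.
rewrite (_ : _ \o _ = id); last by apply/funext => p; exact: row_consK.
by rewrite preimage_id product_measure1E// lte_mul_pinfty// ge0_fin_numE.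
Qed.

HB.instance Definition _ := Measure_isSigmaFinite.Build _ _ _ lebesgue_rowS
  rowS_sigma_finite.

End step.

(* n-dimensional Lebesgue measure, as an iterated product measure. *)
Fixpoint lebesgue_row n : {sigma_finite_measure set 'rV[R]_n -> \bar R} :=
  if n is k.+1 then lebesgue_rowS (lebesgue_row k) else dirac (0 : 'rV[R]_0).

Lemma lebesgue_row_box n (A : 'I_n -> set R) : (forall i, measurable (A i)) ->
  lebesgue_row n [set x | forall i, A i (x ord0 i)] =
  (\prod_(i < n) lebesgue_measure (A i))%E.
Proof.
elim: n A => [|n IH] A mA.
  by rewrite big_ord0 /= diracE mem_set// => -[].
pose B := [set y : 'rV[R]_n | forall i, A (lift ord0 i) (y ord0 i)].
rewrite big_ord_recl -(IH (fun i => A (lift ord0 i)))// -/B.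
transitivity ((@lebesgue_measure R \x lebesgue_row n)%E (A ord0 `*` B)).
  congr (_ (_ : set (R * 'rV[R]_n))).
  apply/seteqP; split=> -[a y] /= Ay.
    split=> [|i] /=; first by have := Ay ord0; rewrite row_cons0.
    by have := Ay (lift ord0 i); rewrite row_consS.
  move=> i; case: (unliftP ord0 i) => [j|] ->.
    by rewrite row_consS; exact: Ay.2.
  by rewrite row_cons0; exact: Ay.1.
rewrite product_measure1E//; first exact: mA.
have -> : B = \bigcap_(i in [set: 'I_n])
    ((fun y : 'rV[R]_n => y ord0 i) @^-1` A (lift ord0 i)).
  by apply/seteqP; split=> y /= By i; [move=> _; exact: By|exact: By].
apply: fin_bigcap_measurable => // i _.
by rewrite -[X in measurable X]setTI; exact: measurable_coord.
Qed.

End lebesgue_row.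

Section partition.
Context {R : realType}.

Definition partial n (i : 'I_n) (f : 'rV[R]_n -> R) : 'rV[R]_n -> R :=
  fun x => 'D_(delta_mx ord0 i) f x.

(* C^oo on the whole space. Since 'D_v f is total, derivability has to be
   required at every stage of the iteration. *)
Definition smooth n (f : 'rV[R]_n -> R) : Prop :=
  forall s : seq 'I_n, let g := foldr (@partial n) f s in
    continuous g /\ forall i x, derivable g x (delta_mx ord0 i).

Definition boundary n (A : set 'rV[R]_n) := closure A `\` interior A.

(* Near each boundary point, and up to relabelling and reorienting one
   coordinate axis, A is the region strictly above the graph of a smooth
   function of the n - 1 remaining coordinates [col' i x]. Balls are those of
   the sup norm of 'rV, which makes no difference here. *)
Definition smooth_boundary n (A : set 'rV[R]_n) : Prop :=
  forall x0, boundary A x0 ->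
    exists (r : R) (i : 'I_n) (b : bool) (gamma : 'rV[R]_n.-1 -> R),
      [/\ 0 < r, smooth gamma &
        A `&` ball x0 r =
        [set x | gamma (col' i x) < (-1) ^+ b * x ord0 i] `&` ball x0 r].

Definition smooth_bounded_domain n (A : set 'rV[R]_n) : Prop :=
  [/\ open A, connected A, A !=set0, bounded_set A & smooth_boundary A].

Section sobolev.
Variables (n : nat) (Omega : set 'rV[R]_n).
Local Notation mu := (lebesgue_row n).

Definition test_function (phi : 'rV[R]_n -> R) : Prop :=
  let supp := closure [set x | phi x != 0] in
  [/\ smooth phi, compact supp & supp `<=` Omega].

Definition square_integrable (f : 'rV[R]_n -> R) : Prop :=
  measurable_fun Omega f /\ (\int[mu]_(x in Omega) ((f x) ^+ 2)%:E < +oo)%E.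

(* G is the weak gradient of u on Omega, with components in L^2(Omega). *)
Definition weak_gradient (u : 'rV[R]_n -> R) (G : 'I_n -> 'rV[R]_n -> R) :=
  forall i, square_integrable (G i) /\
    forall phi, test_function phi ->
      \int[mu]_(x in Omega) (u x * partial i phi x) =
      - \int[mu]_(x in Omega) (G i x * phi x).

(* H^1_0(Omega): the elements of H^1(Omega) that are limits, in the H^1 norm,
   of test functions. *)
Definition H10 (u : 'rV[R]_n -> R) : Prop :=
  square_integrable u /\
  exists2 G, weak_gradient u G &
    exists2 phi : nat -> 'rV[R]_n -> R, forall k, test_function (phi k) &
      (\int[mu]_(x in Omega)
         ((u x - phi k x) ^+ 2 +
          \sum_(i < n) (G i x - partial i (phi k) x) ^+ 2)%:E)%E
      @[k --> \oo] --> 0%E.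

(* Vectors with at most one nonzero coordinate. *)
Definition Sigma m : set ('I_m -> R) :=
  [set y | \sum_(k < m) \sum_(l < m | k != l) y k ^+ 2 * y l ^+ 2 = 0].

Definition H10_Sigma m (u : 'I_m -> 'rV[R]_n -> R) : Prop :=
  (forall j, H10 (u j)) /\
  {ae mu, forall x, Omega x -> Sigma (fun j => u j x)}.

Definition energies m : set \bar R :=
  [set E | exists (u : 'I_m -> 'rV[R]_n -> R)
                  (G : 'I_m -> 'I_n -> 'rV[R]_n -> R),
    [/\ H10_Sigma u,
        forall j, weak_gradient (u j) (G j),
        forall j, (\int[mu]_(x in Omega) ((u j x) ^+ 2)%:E = 1)%E &
        E = (\int[mu]_(x in Omega)
               (\sum_(j < m) \sum_(i < n) (G j i x) ^+ 2)%:E)%E]].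

(* The minimal energy is the infimum in \bar R, so that no attainment hypothesis
   is needed; it is the minimum since the latter is attained when Omega is
   bounded and nonempty. *)
Definition l1_energy m : \bar R :=
  (ereal_inf (energies m) * ((m%:R `^ (1 + 2 / n%:R))^-1)%:E)%E.

End sobolev.
End partition.

(* Main.v *)
From HB Require Import structures.
Require Import Defs.
From mathcomp Require Import all_boot all_order all_algebra.
From mathcomp Require Import all_classical all_reals all_analysis.
From mathcomp Require Import measurable_realfun ring lra.
Import Order.TTheory GRing.Theory Num.Theory.
Import numFieldNormedType.Exports.

Set Implicit Arguments.
Unset Strict Implicit.
Unset Printing Implicit Defensive.

Local Open Scope classical_set_scope.
Local Open Scope ring_scope.

(* Let E(A, m) be the minimal energy of m normalized functions of H^1_0(A) with
   disjoint supports. It decreases when A grows, is subadditive over disjoint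
   open sets, and scales like length^-2. Put
   c0 = inf_m E(Q, m) / m^(1 + 2/n), where Q is the unit cube.

   Upper bound. Fill up most of a bounded open set A with equal cubes, and put
   in each of them a scaled copy of a q x ... x q array of copies of an almost
   optimal family for Q; as q grows, this gives
   limsup E(A, m) / m^(1 + 2/n) <= c0 |A|^(-2/n).

   Lower bound. Put Omega in a box W of integer volume V, with complement
   B = W \ closure(Omega) of measure V - 1, since the boundary of Omega is
   negligible. By definition of c0 and by scaling, the energy of Vm pieces in W
   is at least c0 V m^(1 + 2/n), whereas it is at most
   E(Omega, m) + E(B, (V - 1) m), and the upper bound applies to the last term.

   Positivity of c0. For u in an orthonormal admissible family, the square of
   the difference of u and its averages over cubes of side s integrates to at
   most C s^2 int |grad u|^2, and by Bessel's inequality the averages contribute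
   at most |Q| s^-n in total; hence m <= C s^2 E + 2 s^-n, and one takes s^-n of
   the order of m. *)

(** * Affine changes of variables for Lebesgue measure *)

(** The exponent 1 + 2/n is the one for which a ratio survives subdivision: cutting the cube into
    q^n cells multiplies the number of functions by q^n and the energy by q^(n+2). The ratio of a
    single good family thus propagates to arbitrarily many functions, so the infimum over m already
    acts as a limit.

    Being an infimum over families in the cube, [c0] bounds energies from below only in cubes.
    Filling the rest of a cube around Omega with a nearly optimal family forces Omega to pay its
    full share. The two volumes must add up exactly for this accounting, which is where the
    regularity of the boundary enters.

    Positivity needs an estimate that is uniform in m although the pieces may be arbitrarily
    irregular. Functions are therefore extended by 0 to the whole space and approximated there by
    test functions, and the averages are taken over moving cubes x + [0, s]^n, so that everything
    rests on L^2 bounds for translations. *)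

Definition pushforward_mfun d1 d2 (T1 : measurableType d1)
    (T2 : measurableType d2) (R : realType)
    (m : {measure set T1 -> \bar R}) (f : {mfun T1 >-> T2}) :=
  pushforward m f.

Section pushforward_mfun.
Context d1 d2 (T1 : measurableType d1) (T2 : measurableType d2) (R : realType).
Variables (m : {measure set T1 -> \bar R}) (f : {mfun T1 >-> T2}).

Let pf0 : pushforward_mfun m f set0 = 0%E.
Proof. exact: measure0. Qed.

Let pf_ge0 A : (0 <= pushforward_mfun m f A)%E.
Proof. exact: measure_ge0. Qed.

Let pf_sigma_additive : semi_sigma_additive (pushforward_mfun m f).
Proof. exact: measure_semi_sigma_additive. Qed.

HB.instance Definition _ := isMeasure.Build _ _ _ (pushforward_mfun m f)
  pf0 pf_ge0 pf_sigma_additive.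

End pushforward_mfun.

Section lebesgue_affine1.
Context {R : realType}.
Implicit Types (s a : R).

Definition aff1 s a : measurableTypeR R -> measurableTypeR R :=
  fun x => s * x + a.

Lemma measurable_aff1 s a : measurable_fun [set: measurableTypeR R] (aff1 s a).
Proof. by apply: measurable_funD => //; exact: measurable_funM. Qed.

HB.instance Definition _ s a := isMeasurableFun.Build _ _ _ _ _
  (measurable_aff1 s a).

(** [s] times the pushforward is a measure with the right value on half-open intervals, and these
    determine Lebesgue measure. *)
Lemma lebesgue_measure_aff1 s a (s0 : 0 < s) (A : set R) : measurable A ->
  (s%:E * lebesgue_measure [set x | A (s * x + a)%R] = lebesgue_measure A)%E.
Proof.
move=> mA; apply/esym.
pose m := mscale (NngNum (ltW s0)) (pushforward_mfun (@lebesgue_measure R) (aff1 s a)).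
apply: (@lebesgue_measure_unique R m _ A mA) => _ [[x y]] _ <- /=.
rewrite /m /mscale /pushforward_mfun /pushforward /=.
have -> : aff1 s a @^-1` `]x, y]%classic = `](x - a) / s, (y - a) / s]%classic.
  apply/seteqP; split => z /=; rewrite !in_itv /= /aff1 => /andP[h1 h2].
    by rewrite ltr_pdivrMr// ler_pdivlMr// mulrC ltrBlDr lerBrDr h1.
  by move: h1 h2; rewrite ltr_pdivrMr// ler_pdivlMr// mulrC ltrBlDr lerBrDr => -> ->.
rewrite !lebesgue_measure_itv/= !lte_fin ltr_pM2r ?invr_gt0// ltrD2r.
case: ifP => _; last by rewrite mule0.
by rewrite -EFinD -EFinB -EFinM; congr EFin; field; rewrite gt_eqF.
Qed.

End lebesgue_affine1.

Section lebesgue_row_unique.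
Context {R : realType} (n : nat).
Implicit Types (A : 'I_n -> set R).

Definition box A : set 'rV[R]_n := [set x | forall i, A i (x ord0 i)].

Lemma measurable_box A : (forall i, measurable (A i)) -> measurable (box A).
Proof.
move=> mA; have -> : box A = \bigcap_(i in [set: 'I_n])
    ((fun y : 'rV[R]_n => y ord0 i) @^-1` A i).
  by apply/seteqP; split=> y /= By i; [move=> _; exact: By|exact: By].
apply: fin_bigcap_measurable => // i _.
by rewrite -[X in measurable X]setTI; exact: measurable_coord.
Qed.

Lemma lebesgue_row_boxE A : (forall i, measurable (A i)) ->
  lebesgue_row n (box A) = (\prod_(i < n) lebesgue_measure (A i))%E.
Proof. exact: lebesgue_row_box. Qed.

Lemma measurable_row_boxE :
  @measurable _ 'rV[R]_n = <<s [set box A | A in [set A | forall i, measurable (A i)]] >>.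
Proof.
apply/seteqP; split; last first.
  apply: smallest_sub; first exact: sigma_algebra_measurable.
  by move=> _ [A mA <-]; exact: measurable_box.
apply: smallest_sub; first exact: smallest_sigma_algebra.
rewrite -bigcup_seq /=.
move=> X [i _ [B mB <-]].
apply: sub_sigma_algebra; exists (fun j => if j == i then B else setT).
  by move=> j; case: ifP.
rewrite setTI; apply/seteqP; split => x /= h.
  by have := h i; rewrite eqxx.
by move=> j; case: eqP => // ->.
Qed.

(** Boxes are stable under intersection and generate the product sigma-algebra, and the cubes ]-k,
    k]^n exhaust the space with finite measure. *)
Lemma lebesgue_row_unique (m : {measure set 'rV[R]_n -> \bar R}) :
  (forall A, (forall i, measurable (A i)) ->
    lebesgue_row n (box A) = m (box A)) ->
  forall X, measurable X -> lebesgue_row n X = m X.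
Proof.
move=> mE; apply: (measure_unique
  [set box A | A in [set A | forall i, measurable (A i)]]
  (fun k => box (fun=> `]- k%:R, k%:R]%classic))).
- exact: measurable_row_boxE.
- move=> _ _ [A mA <-] [B mB <-]; exists (fun i => A i `&` B i).
    by move=> i; apply: measurableI; [exact: mA|exact: mB].
  apply/seteqP; split => x /=; first by move=> h; split => i; case: (h i).
  by move=> [hA hB] i; split; [exact: hA|exact: hB].
- by move=> k; exists (fun=> `]- k%:R, k%:R]%classic).
- apply/seteqP; split => // x _.
  have [k hk] : exists k : nat, forall i, `|x ord0 i| < k%:R.
    exists (\max_(i < n) (Num.bound (x ord0 i)))%N => i.
    apply: lt_le_trans (archi_boundP _) _ => //.
    have -> : Num.bound `|x ord0 i| = Num.bound (x ord0 i).
      by rewrite /Num.bound normr_id.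
    by rewrite ler_nat; apply: leq_bigmax.
  exists k => // i; have := hk i; rewrite ltr_norml /= in_itv /= => /andP[-> /ltW ->].
  by [].
- by move=> _ [A mA <-]; exact: mE.
- move=> k.
  rewrite [X in (X < _)%E](_ : _ = (\prod_(i < n) lebesgue_measure (`](- k%:R)%R, k%:R%R]%classic : set R))%E); last first.
    by apply: lebesgue_row_boxE.
  under eq_bigr do rewrite lebesgue_measure_itv/=.
  set P := (X in (X < _)%E); suff /andP[] : (0 <= P < +oo)%E by [].
  rewrite /P; apply: (@big_ind _ (fun x : \bar R => (0 <= x < +oo)%E)) => //.
  - by rewrite lee01 ltry.
  - move=> u v /andP[u0 u1] /andP[v0 v1].
    by rewrite mule_ge0//= lte_mul_pinfty// ge0_fin_numE.
  - move=> i _; case: ifP; last by rewrite ltry lexx.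
    by move=> /ltW h; rewrite -EFinD ltry andbT lee_fin subr_ge0 -lee_fin.
Qed.

End lebesgue_row_unique.

Section lebesgue_row_affine.
Context {R : realType} (n : nat).
Local Notation mu := (@lebesgue_row R n).
Implicit Types (s : R) (a x : 'rV[R]_n).

Definition aff s a x : 'rV[R]_n := s *: x + a.

Lemma measurable_aff s a : measurable_fun setT (aff s a).
Proof.
apply: measurable_fun_rowP => i.
under eq_fun do rewrite !mxE.
by apply: measurable_funD => //; apply: measurable_funM => //; exact: measurable_coord.
Qed.

HB.instance Definition _ s a := isMeasurableFun.Build _ _ _ _ _
  (measurable_aff s a).

Lemma lebesgue_row_aff s a (s0 : 0 < s) (A : set 'rV[R]_n) : measurable A ->
  mu A = ((s ^+ n)%:E * mu (aff s a @^-1` A))%E.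
Proof.
move=> mA.
have sn0 : 0 < s ^+ n by rewrite exprn_gt0.
pose m := mscale (NngNum (ltW sn0)) (pushforward_mfun mu (aff s a)).
apply: (@lebesgue_row_unique _ _ m) mA => B mB.
transitivity ((s ^+ n)%:E * mu (aff s a @^-1` box B))%E; last by [].
have -> : aff s a @^-1` box B = box (fun i => [set x | B i (s * x + a ord0 i)%R]).
  by apply/seteqP; split => x /= h i; have := h i; rewrite /aff !mxE.
rewrite lebesgue_row_boxE// lebesgue_row_boxE; last first.
  move=> i; have := @measurable_aff1 R s (a ord0 i) measurableT _ (mB i).
  by rewrite setTI.
under eq_bigr => i _ do rewrite -(lebesgue_measure_aff1 (a ord0 i) s0 (mB i)).
rewrite big_split /=; congr (_ * _)%E.
by rewrite prodEFin prodr_const card_ord.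
Qed.

Lemma ge0_integral_aff s a (f : 'rV[R]_n -> \bar R) : 0 < s ->
  measurable_fun setT f -> (forall x, 0 <= f x)%E ->
  (\int[mu]_x f (s *: x + a)%R = ((s ^+ n)^-1)%:E * \int[mu]_x f x)%E.
Proof.
move=> s0 mf f0.
have sn0 : 0 < s ^+ n by rewrite exprn_gt0.
have := @ge0_integral_pushforward _ _ _ _ R _ (measurable_aff s a) mu setT f
  measurableT mf (fun x _ => f0 x).
rewrite preimage_setT => <-.
have -> : (\int[mu]_x f x = \int[mscale (NngNum (ltW sn0)) (pushforward_mfun mu (aff s a))]_x f x)%E.
  apply: eq_measure_integral => A mA _.
  exact: lebesgue_row_aff.
rewrite ge0_integral_mscale//= muleA -EFinM mulVf ?mul1e//.
by rewrite gt_eqF.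
Qed.

End lebesgue_row_affine.

(** * Square integrable functions *)

Section square_integrable.
Context d (T : measurableType d) (R : realType).
Variable mu : {measure set T -> \bar R}.
Implicit Types (f g : T -> R) (c t : R).

(** A real-valued integral is [fine] of the extended one, hence 0 when the latter is infinite;
    integrability has to accompany the computations with such integrals. *)
Definition integrableR f := mu.-integrable setT (EFin \o f).

Definition L2 f := measurable_fun setT f /\ integrableR (fun x => f x ^+ 2).

Definition dot f g : R := \int[mu]_x (f x * g x).

Definition sqnorm f : R := \int[mu]_x (f x ^+ 2).

Lemma integrableRD f g : integrableR f -> integrableR g -> integrableR (fun x => f x + g x).
Proof. by move=> hf hg; have := integrableD measurableT hf hg. Qed.

Lemma integrableRZ c f : integrableR f -> integrableR (fun x => c * f x).
Proof. by move=> hf; have := integrableZl measurableT c hf. Qed.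

Lemma integrableRN f : integrableR f -> integrableR (fun x => - f x).
Proof. by move=> /(integrableRZ (-1)); under eq_fun do rewrite mulN1r. Qed.

Lemma integrableRB f g : integrableR f -> integrableR g -> integrableR (fun x => f x - g x).
Proof. by move=> hf hg; apply: integrableRD => //; exact: integrableRN. Qed.

Lemma integrableR_sum (I : Type) (s : seq I) (P : pred I) (F : I -> T -> R) :
  (forall i, integrableR (F i)) -> integrableR (fun x => \sum_(i <- s | P i) F i x).
Proof.
move=> hF; have := @integrable_sum _ _ _ mu setT measurableT I s P
  (fun i => EFin \o F i) (fun i _ => hF i).
by rewrite /integrableR; congr (_.-integrable); apply/funext => x /=; rewrite sumEFin.
Qed.

Lemma integrableR_le f g : measurable_fun setT f -> integrableR g ->
  (forall x, `|f x| <= g x) -> integrableR f.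
Proof.
move=> mf ig fg; apply: (le_integrable measurableT _ _ ig).
  exact/measurable_EFinP.
by move=> x _ /=; rewrite lee_fin (le_trans (fg x))// ler_norm.
Qed.

Lemma integrableR_measurable f : integrableR f -> measurable_fun setT f.
Proof. by move=> /integrableP[/measurable_EFinP]. Qed.

Lemma integrableR_ge0P f : measurable_fun setT f -> (forall x, 0 <= f x) ->
  integrableR f <-> (\int[mu]_x (f x)%:E < +oo)%E.
Proof.
move=> mf f0; split => [/integrableP[_]|h].
  by under eq_integral do rewrite abse_EFin ger0_norm//.
apply/integrableP; split; first exact/measurable_EFinP.
by under eq_integral do rewrite abse_EFin ger0_norm//.
Qed.

Lemma integrableR_indic (A : set T) : measurable A -> (mu A < +oo)%E -> integrableR (\1_A : T -> R).
Proof.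
move=> mA fA; apply/integrableR_ge0P => //.
by rewrite integral_indic// setIT.
Qed.

Lemma EFin_Rintegral f : integrableR f -> (\int[mu]_x f x)%:E = (\int[mu]_x (f x)%:E)%E.
Proof. by move=> hf; rewrite fineK//; exact: integrable_fin_num. Qed.

Lemma Rintegral_sum (I : Type) (s : seq I) (F : I -> T -> R) :
  (forall i, integrableR (F i)) ->
  \int[mu]_x (\sum_(i <- s) F i x) = \sum_(i <- s) \int[mu]_x F i x.
Proof.
move=> hF; elim: s => [|a s IH].
  rewrite big_nil; under eq_Rintegral do rewrite big_nil.
  by rewrite Rintegral_cst// mul0r.
rewrite big_cons -IH -RintegralD//; [|exact: hF|exact: integrableR_sum].
by apply: eq_Rintegral => x _; rewrite big_cons.
Qed.

Lemma le_Rintegral_setT f g : integrableR f -> integrableR g -> (forall x, f x <= g x) ->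
  \int[mu]_x f x <= \int[mu]_x g x.
Proof. by move=> hf hg h; apply: le_Rintegral. Qed.

Lemma ae_eq_Rintegral f g : measurable_fun setT f -> measurable_fun setT g ->
  {ae mu, forall x, f x = g x} -> \int[mu]_x f x = \int[mu]_x g x.
Proof.
move=> mf mg fg; congr fine; apply: ae_eq_integral => //.
- exact/measurable_EFinP.
- exact/measurable_EFinP.
- by apply: filterS fg => x /= -> _.
Qed.

(** Replacing [g] by [max f g], almost everywhere equal to it, makes the inequality hold
    everywhere. *)
Lemma ae_le_Rintegral f g : integrableR f -> integrableR g ->
  {ae mu, forall x, f x <= g x} -> \int[mu]_x f x <= \int[mu]_x g x.
Proof.
move=> hf hg fg.
have mf := integrableR_measurable hf; have mg := integrableR_measurable hg.
have mm : measurable_fun setT (fun x => Num.max (f x) (g x)).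
  exact: measurable_maxr.
have im : integrableR (fun x => Num.max (f x) (g x)).
  apply: (@integrableR_le _ (fun x => `|f x| + `|g x|)) => //.
    by apply: integrableRD; [exact: integrable_abse hf|exact: integrable_abse hg].
  by move=> x; case: (leP (f x) (g x)) => _; rewrite ?lerDl ?lerDr.
rewrite (@ae_eq_Rintegral g (fun x => Num.max (f x) (g x)))//.
  by apply: le_Rintegral_setT => // x; rewrite le_max lexx.
by apply: filterS fg => x /= h; rewrite max_r.
Qed.

Lemma L2_mul f g : L2 f -> L2 g -> integrableR (fun x => f x * g x).
Proof.
move=> [mf hf] [mg hg].
apply: (@integrableR_le _ (fun x => f x ^+ 2 + g x ^+ 2)).
- exact: measurable_funM.
- exact: integrableRD.
- move=> x; rewrite normrM -(real_normK (num_real (f x))) -(real_normK (num_real (g x))).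
  have := sqr_ge0 (`|f x| - `|g x|).
  have := normr_ge0 (f x); have := normr_ge0 (g x); nra.
Qed.

Lemma L2D f g : L2 f -> L2 g -> L2 (fun x => f x + g x).
Proof.
move=> hf hg; split; first by apply: measurable_funD; [case: hf|case: hg].
have -> : (fun x => (f x + g x) ^+ 2) = (fun x => f x ^+ 2 + (2 * (f x * g x) + g x ^+ 2)).
  by apply/funext => x; ring.
apply: integrableRD; first by case: hf.
by apply: integrableRD; [apply: integrableRZ; exact: L2_mul|case: hg].
Qed.

Lemma L2Z c f : L2 f -> L2 (fun x => c * f x).
Proof.
move=> [mf hf]; split; first by apply: measurable_funM.
by under eq_fun do rewrite exprMn; exact: integrableRZ.
Qed.

Lemma L2B f g : L2 f -> L2 g -> L2 (fun x => f x - g x).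
Proof.
move=> hf hg; have -> : (fun x => f x - g x) = (fun x => f x + (-1) * g x).
  by apply/funext => x; ring.
by apply: L2D => //; exact: L2Z.
Qed.

Lemma sqnorm_ge0 f : 0 <= sqnorm f.
Proof. by apply: Rintegral_ge0 => x _; exact: sqr_ge0. Qed.

Lemma dotC f g : dot f g = dot g f.
Proof. by apply: eq_Rintegral => x _; rewrite mulrC. Qed.

Lemma sqnormZ c f : L2 f -> sqnorm (fun x => c * f x) = c ^+ 2 * sqnorm f.
Proof.
move=> [_ hf]; rewrite /sqnorm; under eq_Rintegral do rewrite exprMn.
by rewrite RintegralZl.
Qed.

Lemma dotBl f g h : L2 f -> L2 g -> L2 h ->
  dot (fun x => f x - g x) h = dot f h - dot g h.
Proof.
move=> hf hg hh; rewrite /dot -RintegralB//; try exact: L2_mul.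
by apply: eq_Rintegral => x _; rewrite mulrBl.
Qed.

Lemma sqnormB f g : L2 f -> L2 g ->
  sqnorm (fun x => f x - g x) = sqnorm f - 2 * dot f g + sqnorm g.
Proof.
move=> hf hg; have fg := L2_mul hf hg; case: hf => mf hf; case: hg => mg hg.
rewrite /sqnorm /dot -RintegralZl// -RintegralB//; last exact: integrableRZ.
rewrite -RintegralD//; last by apply: integrableRB => //; exact: integrableRZ.
by apply: eq_Rintegral => x _; ring.
Qed.

(** The squared distances from [f] and from [g] to [h] have the same cross term, so they differ by
    [sqnorm g - sqnorm f]; the first is nonnegative and the second at most [e]. *)
Lemma sqnorm_le_of_dot f g h (e : R) : L2 f -> L2 g -> L2 h -> dot f h = dot g h ->
  sqnorm (fun x => g x - h x) <= e -> sqnorm g <= sqnorm f + e.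
Proof.
move=> hf hg hh fgh; rewrite sqnormB//.
have := sqnorm_ge0 (fun x => f x - h x); rewrite sqnormB// fgh; lra.
Qed.

Lemma sqnormD_le f g : L2 f -> L2 g ->
  sqnorm (fun x => f x + g x) <= 2 * sqnorm f + 2 * sqnorm g.
Proof.
move=> hf hg; have [_ hfg] := L2D hf hg; case: hf => mf hf; case: hg => mg hg.
rewrite /sqnorm -!RintegralZl// -RintegralD//; try exact: integrableRZ.
apply: le_Rintegral_setT => //; first by apply: integrableRD; exact: integrableRZ.
by move=> x; have := sqr_ge0 (f x - g x); nra.
Qed.

(** Integrated form of 0 <= t^-1 (t |f| - |g|)^2. The free weight [t] makes the right-hand side
    small as soon as one factor is small and the other bounded. *)
Lemma dot_le t f g : 0 < t -> L2 f -> L2 g ->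
  `|dot f g| <= t * sqnorm f + t^-1 * sqnorm g.
Proof.
move=> t0 hf hg; have fg := L2_mul hf hg; case: hf => mf hf; case: hg => mg hg.
apply: le_trans (le_normr_Rintegral measurableT fg) _.
rewrite /sqnorm -!RintegralZl// -RintegralD//; try exact: integrableRZ.
apply: le_Rintegral_setT => //; first exact: integrable_abse fg.
  by apply: integrableRD; exact: integrableRZ.
move=> x; rewrite normrM -(real_normK (num_real (f x))) -(real_normK (num_real (g x))).
have := normr_ge0 (f x); have := normr_ge0 (g x).
move: `|f x| `|g x| => a b a0 b0.
have : 0 <= t^-1 * (t * a - b) ^+ 2 by rewrite mulr_ge0 ?sqr_ge0// invr_ge0 ltW.
have -> : t^-1 * (t * a - b) ^+ 2 = t * a ^+ 2 + t^-1 * b ^+ 2 - 2 * (a * b).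
  by field; rewrite gt_eqF.
have := mulr_ge0 b0 a0; lra.
Qed.

(** Integrate 0 <= (chi - sum_j c_j v_j)^2 with c_j = <chi, v_j>. Since the supports are disjoint
    almost everywhere, the square of the sum is pointwise the sum of the squares. *)
Lemma bessel (I : finType) (v : I -> T -> R) (chi : T -> R) : L2 chi ->
  (forall j, L2 (v j)) -> (forall j, sqnorm (v j) = 1) ->
  (forall j l, j != l -> {ae mu, forall x, v j x * v l x = 0}) ->
  \sum_j dot chi (v j) ^+ 2 <= sqnorm chi.
Proof.
move=> hchi hv nv dv; pose c j := dot chi (v j).
have hcv j : L2 (fun x => c j * v j x) by exact: L2Z.
have il : integrableR (fun x => 2 * \sum_j c j * (chi x * v j x)).
  by apply/integrableRZ/integrableR_sum => j; apply: integrableRZ; exact: L2_mul.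
have ir : integrableR (fun x => chi x ^+ 2 + \sum_j c j ^+ 2 * v j x ^+ 2).
  by apply: integrableRD; [case: hchi|apply: integrableR_sum => j; apply: integrableRZ; case: (hv j)].
have : \int[mu]_x (2 * \sum_j c j * (chi x * v j x)) <=
    \int[mu]_x (chi x ^+ 2 + \sum_j c j ^+ 2 * v j x ^+ 2).
  apply: ae_le_Rintegral => //.
  have : {ae mu, forall x, forall p : I * I, p.1 != p.2 -> v p.1 x * v p.2 x = 0}.
    apply: filter_forall => -[j l]; have [<-|jl] := eqVneq j l.
      by apply: nearW => x.
    by apply: filterS (dv j l jl) => x.
  apply: filterS => x hx.
  have -> : \sum_j c j ^+ 2 * v j x ^+ 2 = (\sum_j c j * v j x) ^+ 2.
    rewrite expr2 big_distrl /=; apply: eq_bigr => j _.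
    rewrite big_distrr /= (bigD1 j)//= big1 ?addr0; first by ring.
    move=> l lj; have /= := hx (j, l); rewrite eq_sym => /(_ lj) h.
    by rewrite mulrACA h mulr0.
  have -> : \sum_j c j * (chi x * v j x) = chi x * \sum_j c j * v j x.
    by rewrite mulr_sumr; apply: eq_bigr => j _; ring.
  have := sqr_ge0 (chi x - \sum_j c j * v j x); nra.
rewrite RintegralZl//; last by apply: integrableR_sum => j; apply: integrableRZ; exact: L2_mul.
rewrite RintegralD//; [|by case: hchi|by apply: integrableR_sum => j; apply: integrableRZ; case: (hv j)].
rewrite !Rintegral_sum; [|by move=> j; apply: integrableRZ; case: (hv j)|by move=> j; apply: integrableRZ; exact: L2_mul].
have e1 j : \int[mu]_x (c j * (chi x * v j x)) = c j ^+ 2.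
  by rewrite RintegralZl//; last exact: L2_mul.
have e2 j : \int[mu]_x (c j ^+ 2 * v j x ^+ 2) = c j ^+ 2.
  rewrite RintegralZl//; last by case: (hv j).
  by rewrite -/(sqnorm (v j)) nv mulr1.
rewrite (eq_bigr _ (fun j _ => e1 j)) (eq_bigr _ (fun j _ => e2 j)) -/(sqnorm chi).
lra.
Qed.

End square_integrable.

(** * Topology and measurability of row vectors *)

Section row_topology.
Context {R : realType} (n : nat).
Implicit Types (x y : 'rV[R]_n) (e : R).

Lemma ball_rowP x e y : 0 < e ->
  ball x e y <-> forall i, `|x ord0 i - y ord0 i| < e.
Proof.
move=> e0; split => [[_ h] i|h]; first exact: h.
by split => // i j; rewrite (ord1 i); exact: h.
Qed.

Lemma open_rowP (U : set 'rV[R]_n) : open U <->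
  forall x, U x -> exists2 e : R, 0 < e &
    forall y, (forall i, `|x ord0 i - y ord0 i| < e) -> U y.
Proof.
rewrite openE; split => [oU x /oU|h x /h[e e0 he]].
  rewrite /interior => /nbhs_ballP[e /= e0 he]; exists e => // y hy.
  by apply: he; apply/ball_rowP.
by apply/nbhs_ballP; exists e => //= y /(ball_rowP _ _ e0); exact: he.
Qed.

Lemma bounded_rowP (A : set 'rV[R]_n) : bounded_set A <->
  exists L : R, forall x, A x -> forall i, `|x ord0 i| <= L.
Proof.
split.
  move=> [M [Mr hM]]; exists (M + 1) => x Ax i.
  apply: le_trans (hM (M + 1) _ x Ax); last by rewrite ltrDl.
  rewrite [leRHS]/Num.norm/= mx_normrE.
  exact: (le_bigmax 0 (fun ij : 'I_1 * 'I_n => `|x ij.1 ij.2|) (ord0, i)).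
move=> [L hL]; exists (Num.max 0 L); split; first exact: num_real.
move=> M; rewrite gt_max => /andP[M0 LM] x Ax /=.
rewrite [leLHS]/Num.norm/= mx_normrE; apply: bigmax_le; first exact: ltW.
move=> [i j] _ /=; rewrite (ord1 i); apply: le_trans (hL _ Ax _) (ltW LM).
Qed.

Lemma measurable_cell (a : 'I_n -> R) e :
  measurable (box (fun i => `]a i - e, a i + e[%classic : set R)).
Proof. by apply: measurable_box => i. Qed.

(** The sigma-algebra is the product one, so openness has to be reduced to boxes: an open set is the
    union of the countably many cubes with rational centre and radius 1/(k+1) that it contains. *)
Lemma open_measurable_row (U : set 'rV[R]_n) : open U -> measurable U.
Proof.
move=> /open_rowP oU.
pose B (p : {ffun 'I_n -> rat} * nat) : set 'rV[R]_n :=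
  box (fun i => `](ratr (p.1 i) - p.2.+1%:R^-1), (ratr (p.1 i) + p.2.+1%:R^-1)[%classic : set R).
have -> : U = \bigcup_(p in [set p | B p `<=` U]) B p.
  apply/seteqP; split => [x Ux|x [p /= hp]]; last exact: hp.
  have [e e0 he] := oU _ Ux.
  have [k hk] : exists k : nat, k.+1%:R^-1 < e / 2.
    have e20 : 0 < e / 2 by rewrite divr_gt0.
    exists (Num.truncn (e / 2)^-1).
    rewrite invf_plt ?posrE//.
    by have /andP[] := truncn_itv (ltW (eqbRL (invr_gt0 _) e20)).
  have hq i : exists q : rat, `|x ord0 i - ratr q| < k.+1%:R^-1.
    have ne : `](x ord0 i - k.+1%:R^-1), (x ord0 i + k.+1%:R^-1)[%classic !=set0.
      by exists (x ord0 i); rewrite /= in_itv /= ltrBlDr !ltrDl invr_gt0 ltr0n.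
    have op : open (`](x ord0 i - k.+1%:R^-1), (x ord0 i + k.+1%:R^-1)[%classic : set R).
      exact: interval_open.
    have [y [/= h [q _ qE]]] := @dense_rat R _ ne op.
    by exists q; rewrite qE ltr_distlC; move: h; rewrite in_itv.
  exists ([ffun i => projT1 (cid (hq i))], k) => /=.
    move=> y hy; apply: he => i; have := hy i; rewrite /= ffunE.
    case: cid => q /= hqi; rewrite in_itv /= -ltr_distlC => h1.
    apply: le_lt_trans (ler_distD (ratr q) _ _) _; rewrite (splitr e).
    by apply: ltrD; [exact: lt_trans hk|exact: lt_trans hk].
  move=> i /=; rewrite ffunE; case: cid => q /=.
  by rewrite distrC ltr_distlC in_itv.
rewrite bigcup_mkcond; apply: countable_bigcupT_measurable.
  exact: countableP.
by move=> p; case: ifP => // _; exact: measurable_cell.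
Qed.

Lemma closed_measurable_row (U : set 'rV[R]_n) : closed U -> measurable U.
Proof.
by move=> cU; rewrite -(setCK U); apply: measurableC; apply: open_measurable_row; rewrite openC.
Qed.

Lemma continuous_measurable_row (f : 'rV[R]_n -> R) :
  continuous f -> measurable_fun setT f.
Proof.
move=> cf; apply: (measurability _ (RGenOInfty.measurableE R)) => //=.
move=> _ [_ [a ->] <-]; rewrite setTI; apply: open_measurable_row.
apply: open_comp; first by move=> x _; exact: cf.
exact: interval_open.
Qed.

Lemma continuous_aff (s : R) (a : 'rV[R]_n) : continuous (aff s a).
Proof.
move=> x; apply: continuousD; last exact: cst_continuous.
exact: scaler_continuous.
Qed.

Lemma lebesgue_row_cube (a : 'I_n -> R) (l : R) (b1 b2 : bool) : 0 <= l ->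
  lebesgue_row n (box (fun i => [set` Interval (BSide b1 (a i)) (BSide b2 (a i + l))] : set R)) = (l ^+ n)%:E.
Proof.
move=> l0; rewrite lebesgue_row_boxE//.
under eq_bigr do rewrite lebesgue_measure_itv/=.
rewrite (eq_bigr (fun=> l%:E)) => [|i _]; first by rewrite prodEFin prodr_const card_ord.
rewrite lte_fin ltrDl; case: ltP => l0'; first by rewrite -EFinB; congr EFin; ring.
by congr EFin; apply/eqP; rewrite eq_le l0 l0'.
Qed.

Lemma bounded_lebesgue_row_fin (A : set 'rV[R]_n) : measurable A ->
  bounded_set A -> (lebesgue_row n A < +oo)%E.
Proof.
move=> mA /bounded_rowP[L hL].
have L0 : 0 <= Num.max L 0 by rewrite le_max lexx orbT.
apply: (@le_lt_trans _ _ (((Num.max L 0 + Num.max L 0) ^+ n)%:E)); last exact: ltry.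
rewrite -(@lebesgue_row_cube (fun=> - Num.max L 0) _ true false) ?addr_ge0//.
apply: le_measure; rewrite ?inE//; first by apply: measurable_box.
move=> x Ax i /=; rewrite in_itv /= addrA addNr add0r.
have := hL _ Ax i; rewrite ler_norml => /andP[h1 h2].
by rewrite lerNl !le_max lerNl h1 h2.
Qed.

End row_topology.

(** * Smooth functions and test functions *)

Section line_derivative.
Context {R : realType} (n : nat).
Implicit Types (x v : 'rV[R]_n) (f : 'rV[R]_n -> R) (t : R).

(** Reduces directional derivatives to one variable, where the chain rule and the mean value theorem
    apply. *)
Lemma is_derive_line f x v t d :
  is_derive (t *: v + x) v f d <-> is_derive t 1 (fun s : R => f (s *: v + x)) d.
Proof.
have E : (fun h : R => h^-1 *: ((f \o shift (t *: v + x)) (h *: v) - f (t *: v + x))) =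
  (fun h : R => h^-1 *: (((fun s : R => f (s *: v + x)) \o shift t) (h *: 1) - f (t *: v + x))).
  apply/funext => h /=; congr (_ *: (f _ - _)).
  by rewrite scalerDl /GRing.scale /= mulr1 addrA.
split => -[h1 h2]; split.
- by move: h1; rewrite /derivable E.
- by move: h2; rewrite /derive E.
- by move: h1; rewrite /derivable -E.
- by move: h2; rewrite /derive -E.
Qed.

Lemma is_derive_aff f x v (s : R) (a : 'rV[R]_n) (c d : R) :
  is_derive (aff s a x) v f d ->
  is_derive x v (fun y => c * f (aff s a y)) (c * (s * d)).
Proof.
move=> h.
have -> : x = 0 *: v + x by rewrite scale0r add0r.
apply/is_derive_line.
have -> : (fun t : R => c * f (aff s a (t *: v + x))) =
   (fun t : R => c *: ((fun u : R => f (u *: v + aff s a x)) \o (fun t : R => s *: t)) t).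
  apply/funext => t; congr (_ * f _).
  by rewrite /aff scalerDr addrA scalerA.
apply: is_deriveZ.
have h2 : is_derive (s *: (0:R)) 1 (fun u : R => f (u *: v + aff s a x)) d.
  by apply/is_derive_line; rewrite scaler0 scale0r add0r.
have h3 : is_derive (0:R) 1 (fun t : R => s *: t) s.
  have := @is_deriveZ R R R id s 0 1 1 (is_derive_id _ _).
  by rewrite /GRing.scale /= mulr1.
have := @is_derive1_comp R (fun u : R => f (u *: v + aff s a x)) (fun t : R => s *: t) 0 _ _ h2 h3.
by rewrite mulrC.
Qed.

End line_derivative.

Section smooth.
Context {R : realType} (n : nat).
Implicit Types (x : 'rV[R]_n) (f : 'rV[R]_n -> R).
Local Notation e_ i := (delta_mx ord0 i : 'rV[R]_n).

Lemma smooth_continuous f : smooth f -> continuous f.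
Proof. by move=> /(_ [::])[]. Qed.

Lemma smooth_derive f i x : smooth f -> is_derive x (e_ i) f (partial i f x).
Proof. by move=> /(_ [::])[_ /(_ i x) h]; split. Qed.

Lemma smooth_partial f i : smooth f -> smooth (partial i f).
Proof.
by move=> sf s; have := sf (rcons s i); rewrite foldr_rcons.
Qed.

Lemma partial_aff f (s : R) (a : 'rV[R]_n) c i : smooth f ->
  partial i (fun x => c * f (aff s a x)) =
  (fun x => c * s * partial i f (aff s a x)).
Proof.
move=> sf; apply/funext => x.
have [_ h] := is_derive_aff c (smooth_derive i (aff s a x) sf).
by rewrite /partial h mulrA.
Qed.

Lemma smooth_aff f (s : R) (a : 'rV[R]_n) c : smooth f ->
  smooth (fun x => c * f (aff s a x)).
Proof.
move=> sf l.
(* Invariant of the iteration: each derivative keeps the form c' * g(aff s a x), with [g] an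
   iterated partial derivative of [f] and a factor [s] absorbed in c'. *)
have E : exists g c', smooth g /\ foldr (@partial R n) (fun x => c * f (aff s a x)) l
    = (fun x => c' * g (aff s a x)).
  elim: l => [|i l [g [c' [sg Eg]]]] /=; first by exists f, c.
  exists (partial i g), (c' * s); split; first exact: smooth_partial.
  by rewrite Eg partial_aff.
have [g [c' [sg ->]]] := E.
split => /= [x|i x].
  apply: continuousM; first exact: cst_continuous.
  apply: continuous_comp; first exact: continuous_aff.
  exact: smooth_continuous.
by have [] := is_derive_aff c' (smooth_derive i (aff s a x) sg).
Qed.

(** A coinduction principle: membership in a class of continuous functions stable under partial
    derivation settles all iterated derivatives at once. *)
Lemma smoothE f : (exists2 S : set ('rV[R]_n -> R), S f &
    forall g, S g -> continuous g /\ forall i, exists2 g', S g' &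
      forall x, is_derive x (e_ i) g (g' x)) -> smooth f.
Proof.
move=> [S Sf hS] s.
have : S (foldr (@partial R n) f s).
  elim: s => //= i s /hS [_ /(_ i)[g' Sg' h]].
  suff -> : partial i (foldr (@partial R n) f s) = g' by [].
  by apply/funext => x; have [_] := h x.
move=> /hS[cg hg]; split => // i x.
by have [g' _ /(_ x)[]] := hg i.
Qed.

End smooth.

Section test_function.
Context {R : realType} (n : nat).
Implicit Types (x : 'rV[R]_n) (f phi : 'rV[R]_n -> R) (A B : set 'rV[R]_n).

Lemma test_function_sub A B phi : A `<=` B -> test_function A phi -> test_function B phi.
Proof. by move=> AB [h1 h2 h3]; split => //; exact: subset_trans AB. Qed.

Lemma test_function_out A phi x : test_function A phi -> ~ A x -> phi x = 0.
Proof.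
move=> [_ _ h] nAx; apply/eqP; apply: contrapT => /negP px; apply: nAx.
by apply: h; apply: subset_closure.
Qed.

(** Off its closed support [phi] vanishes on a neighbourhood, hence so does its derivative: the
    support can only shrink. *)
Lemma test_function_partial A phi i : test_function A phi -> test_function A (partial i phi).
Proof.
move=> [sp cp hp].
have sub : closure [set x | partial i phi x != 0] `<=` closure [set x | phi x != 0].
  apply: subset_trans (@closed_closure _ _).
  apply: closure_subset => x /= px; apply: contrapT => nx; move/eqP: px; apply.
  have : nbhs x (~` closure [set x | phi x != 0]).
    by apply: open_nbhs_nbhs; split => //; rewrite openC; exact: closed_closure.
  move=> hx.
  have [_ h] : is_derive x (delta_mx ord0 i) phi 0.
    have h0 : \forall y \near x, (fun=> 0 : R) y = phi y.
      near=> y; apply/esym/eqP; apply: contrapT => /negP py.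
      have : (~` closure [set x | phi x != 0]) y by near: y.
      by apply; exact: subset_closure.
    exact: near_eq_is_derive h0 (is_derive_cst _ _ _).
  by rewrite /partial h.
split; first exact: smooth_partial.
  by apply: subclosed_compact cp sub; exact: closed_closure.
exact: subset_trans sub hp.
Unshelve. all: by end_near. Qed.

Lemma test_function_aff A phi (s : R) (a : 'rV[R]_n) c : s != 0 ->
  test_function A phi ->
  test_function (aff s a @^-1` A) (fun x => c * phi (aff s a x)).
Proof.
move=> s0 [sp cp hp].
have sub : closure [set x | c * phi (aff s a x) != 0] `<=` aff s a @^-1` closure [set x | phi x != 0].
  have cl : closed (aff s a @^-1` closure [set x | phi x != 0]).
    by apply: closed_comp => [x _|]; [exact: continuous_aff|exact: closed_closure].
  rewrite [X in _ `<=` X](closure_id _).1//; apply: closure_subset => x /=.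
  by rewrite mulf_eq0 negb_or => /andP[_ h]; exact: subset_closure.
split; first exact: smooth_aff.
  apply: (@subclosed_compact _ _ (aff s^-1 (- (s^-1 *: a)) @` closure [set x | phi x != 0])).
  - exact: closed_closure.
  - by apply: continuous_compact => //; apply: continuous_subspaceT; exact: continuous_aff.
  - move=> x /sub hx; exists (aff s a x) => //.
    by rewrite /aff scalerDr scalerA mulVf// scale1r addrK.
by apply: subset_trans sub _ => x /hp.
Qed.

Lemma test_function_bounded A phi : test_function A phi ->
  exists L M : R, [/\ 0 <= L, 0 <= M, forall x, `|phi x| <= M &
    forall x, phi x != 0 -> forall i, `|x ord0 i| <= L].
Proof.
move=> [sp cp hp].
have [L hL] := (bounded_rowP _).1 (compact_bounded cp).
have cpi : compact (phi @` closure [set x | phi x != 0]).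
  by apply: continuous_compact => //; apply: continuous_subspaceT; exact: smooth_continuous.
have [M [_ hM]] := compact_bounded cpi.
exists (Num.max 0 L), (Num.max 0 (M + 1)); split.
- by rewrite le_max lexx.
- by rewrite le_max lexx.
- move=> x; have [->|px] := eqVneq (phi x) 0; first by rewrite normr0 le_max lexx.
  rewrite le_max; apply/orP; right; apply: (hM (M + 1)); first by rewrite ltrDl.
  by exists x => //; exact: subset_closure.
- move=> x px i; rewrite le_max; apply/orP; right; apply: hL.
  exact: subset_closure.
Qed.

End test_function.

(** * Difference quotients and translations *)

Section affine_change.
Context {R : realType} (n : nat).
Local Notation mu := (@lebesgue_row R n).
Implicit Types (f : 'rV[R]_n -> R) (s : R) (a : 'rV[R]_n).

Lemma measurable_comp_aff f s a : measurable_fun setT f ->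
  measurable_fun setT (fun x => f (aff s a x)).
Proof. by move=> mf; apply: measurableT_comp mf _; exact: measurable_aff. Qed.

Lemma integrableR_aff_ge0 f s a : 0 < s -> (forall x, 0 <= f x) -> integrableR mu f ->
  integrableR mu (fun x => f (aff s a x)) /\
  \int[mu]_x f (aff s a x) = (s ^+ n)^-1 * \int[mu]_x f x.
Proof.
move=> s0 f0 hf; have mf := integrableR_measurable hf.
have E : (\int[mu]_x (f (aff s a x))%:E = ((s ^+ n)^-1)%:E * \int[mu]_x (f x)%:E)%E.
  apply: (@ge0_integral_aff R n s a (EFin \o f)) => //.
    exact/measurable_EFinP.
have hi : integrableR mu (fun x => f (aff s a x)).
  apply/integrableR_ge0P => //; first exact: measurable_comp_aff.
  by rewrite E -(EFin_Rintegral hf) -EFinM ltry.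
split => //; apply: EFin_inj.
by rewrite EFinM !EFin_Rintegral.
Qed.

Lemma integrableR_aff f s a : 0 < s -> integrableR mu f ->
  integrableR mu (fun x => f (aff s a x)) /\
  \int[mu]_x f (aff s a x) = (s ^+ n)^-1 * \int[mu]_x f x.
Proof.
move=> s0 hf.
have habs : integrableR mu (fun x => `|f x|) by exact: integrable_abse hf.
have hsum : integrableR mu (fun x => f x + `|f x|) by exact: integrableRD.
have [i1 e1] := integrableR_aff_ge0 a s0 (fun x => normr_ge0 (f x)) habs.
have sge0 x : 0 <= f x + `|f x|.
  by have := ler_norm (- f x); rewrite normrN; lra.
have [i2 e2] := integrableR_aff_ge0 a s0 sge0 hsum.
have E (g : 'rV[R]_n -> 'rV[R]_n) :
    (fun x => f (g x)) = (fun x => (f (g x) + `|f (g x)|) - `|f (g x)|).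
  by apply/funext => x; rewrite addrK.
split; first by rewrite (E (aff s a)); exact: integrableRB.
rewrite (_ : \int[mu]_x f (aff s a x) =
  \int[mu]_x ((f (aff s a x) + `|f (aff s a x)|) - `|f (aff s a x)|)); last first.
  by apply: eq_Rintegral => x _; rewrite addrK.
rewrite RintegralB// e1 e2 -mulrBr; congr (_ * _).
by rewrite -RintegralB//; apply: eq_Rintegral => x _; rewrite addrK.
Qed.

Lemma L2_aff f s a : 0 < s -> L2 mu f -> L2 mu (fun x => f (aff s a x)).
Proof.
by move=> s0 [mf hf]; split; [exact: measurable_comp_aff|exact: (integrableR_aff a s0 hf).1].
Qed.

Lemma sqnorm_aff f s a : 0 < s -> L2 mu f ->
  sqnorm mu (fun x => f (aff s a x)) = (s ^+ n)^-1 * sqnorm mu f.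
Proof. by move=> s0 [mf hf]; exact: (integrableR_aff a s0 hf).2. Qed.

Lemma aff1E a x : aff 1 a x = a + x.
Proof. by rewrite /aff scale1r addrC. Qed.

Lemma integrableR_shift f a : integrableR mu f -> integrableR mu (fun x => f (a + x)) /\
  \int[mu]_x f (a + x) = \int[mu]_x f x.
Proof.
move=> hf; have := integrableR_aff a ltr01 hf.
by rewrite expr1n invr1 mul1r; under eq_fun do rewrite aff1E.
Qed.

Lemma L2_shift f a : L2 mu f -> L2 mu (fun x => f (a + x)).
Proof. by move=> /(L2_aff a ltr01); under eq_fun do rewrite aff1E. Qed.

Lemma sqnorm_shift f a : L2 mu f -> sqnorm mu (fun x => f (a + x)) = sqnorm mu f.
Proof. by move=> [_ hf]; exact: (integrableR_shift a hf).2. Qed.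

Lemma integrableR_bounded (A : set 'rV[R]_n) f (M : R) : measurable A ->
  (mu A < +oo)%E -> measurable_fun setT f -> (forall x, `|f x| <= M) ->
  (forall x, ~ A x -> f x = 0) -> integrableR mu f.
Proof.
move=> mA fA mf fM f0.
apply: (@integrableR_le _ _ _ _ f (fun x => M * \1_A x)) => //.
  apply: integrableRZ; exact: integrableR_indic.
move=> x; rewrite indicE; have [xA|xA] := boolP (x \in A); first by rewrite mulr1.
rewrite f0 ?normr0 ?mulr0// => Ax.
by move/negP: xA; apply; rewrite inE.
Qed.

End affine_change.

(** Expand the nonnegative sum of the squares (N a_j - S)^2, where S is the sum of the a_j. *)
Lemma sqr_sum_le (R : realType) (N : nat) (a : nat -> R) :
  (\sum_(j < N) a j) ^+ 2 <= N%:R * \sum_(j < N) a j ^+ 2.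
Proof.
case: N => [|N]; first by rewrite !big_ord0 expr0n mulr0.
set S := \sum_(j < N.+1) a j; set Q := \sum_(j < N.+1) _.
have N0 : 0 < N.+1%:R :> R by rewrite ltr0n.
have : 0 <= \sum_(j < N.+1) (N.+1%:R * a j - S) ^+ 2 by apply: sumr_ge0 => j _; exact: sqr_ge0.
have -> : \sum_(j < N.+1) (N.+1%:R * a j - S) ^+ 2 = N.+1%:R * (N.+1%:R * Q - S ^+ 2).
  rewrite (eq_bigr (fun j : 'I_N.+1 => N.+1%:R ^+ 2 * a j ^+ 2 + (- (2 * N.+1%:R * S) * a j + S ^+ 2))).
    rewrite !big_split /= -!mulr_sumr -/S -/Q sumr_const card_ord -[_ *+ N.+1]mulr_natl; ring.
  by move=> j _; ring.
by rewrite pmulr_rge0// subr_ge0.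
Qed.

Section difference_quotient.
Context {R : realType} (n : nat).
Local Notation mu := (@lebesgue_row R n).
Variables (i : 'I_n) (f g : 'rV[R]_n -> R) (L M : R).
Local Notation v := (delta_mx ord0 i : 'rV[R]_n).
Hypothesis fg : forall x, is_derive x v f (g x).
Hypothesis cf : continuous f.
Hypothesis cg : continuous g.
Hypothesis gM : forall x, `|g x| <= M.
Hypothesis fL : forall x, f x != 0 -> forall j, `|x ord0 j| <= L.

Let dq (t : R) x := t^-1 * (f (t *: v + x) - f x).

(** The mean value theorem on the segment from x to x + tv; for negative [t] the segment is run from
    its other end. *)
Let dq_le t x : t != 0 -> `|dq t x| <= M.
Proof.
move=> t0.
have mvt (a : R) (y : 'rV[R]_n) : 0 <= a -> `|f (a *: v + y) - f y| <= a * M.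
  move=> a0.
  have h (z : R) : is_derive z 1 (fun s : R => f (s *: v + y)) (g (z *: v + y)).
    by apply/is_derive_line.
  have [|c _] := @MVT_segment R _ _ 0 a a0 (fun z _ => h z).
    by apply: derivable_within_continuous => z _; case: (h z).
  rewrite scale0r add0r subr0 => ->.
  by rewrite normrM (ger0_norm a0) mulrC ler_wpM2l.
rewrite /dq normrM normfV ler_pdivrMl ?normr_gt0//.
have [t1|t1] := leP 0 t; first by rewrite (ger0_norm t1) mvt.
have := mvt (- t) (t *: v + x).
by rewrite addrA -scalerDl addNr scale0r add0r distrC (ltr0_norm t1) oppr_ge0 ltW//; apply.
Qed.

Let dq_out t0 t x : `|t| <= t0 -> ~ box (fun=> `[- (L + t0), L + t0]%classic : set R) x -> dq t x = 0.
Proof.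
move=> tt0 nx.
have [j hj] : exists j, L + t0 < `|x ord0 j|.
  apply: contrapT => h; apply: nx => j /=; rewrite in_itv /= -ler_norml leNgt.
  by apply/negP => hj; apply: h; exists j.
have t00 : 0 <= t0 by apply: le_trans tt0.
have f0 : f x = 0.
  apply/eqP/negPn/negP => /fL /(_ j) h; move: hj; rewrite ltNge => /negP; apply.
  by apply: le_trans h _; rewrite lerDl.
have f1 : f (t *: v + x) = 0.
  apply/eqP/negPn/negP => /fL /(_ j); rewrite !mxE => h.
  move: hj; rewrite ltNge => /negP; apply.
  have -> : x ord0 j = (t * ((ord0 == ord0 :> 'I_1) && (j == i))%:R + x ord0 j) - t * ((ord0 == ord0 :> 'I_1) && (j == i))%:R by rewrite addrC addKr.
  apply: le_trans (ler_normB _ _) _; apply: lerD => //; apply: le_trans tt0.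
  by rewrite normrM; case: (_ && _); rewrite ?normr1 ?mulr1// normr0 mulr0.
by rewrite /dq f0 f1 subrr mulr0.
Qed.

Let dq_cvg (t : R) x : t != 0 -> dq (t / k.+1%:R) x @[k --> \oo] --> g x.
Proof.
move=> t0; case: (fg x) => h1 h2.
have hc : (fun h : R => h^-1 *: ((f \o shift x) (h *: v) - f x)) @ 0^' --> g x.
  by rewrite -h2; exact: h1.
have hu : (t / k.+1%:R : R) @[k --> \oo] --> (0 : R)^'.
  have hu0 : (t / k.+1%:R : R) @[k --> \oo] --> (0 : R).
    rewrite -(mulr0 t); apply: cvgM; first exact: cvg_cst.
    exact: cvg_harmonic.
  move=> U [e /= e0 he]; suff : \forall k \near \oo, U (t / k.+1%:R) by [].
  near=> k; apply: he => /=.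
    by near: k; exact: (hu0 _ (nbhsx_ballx (0 : R) e e0)).
  by rewrite mulf_neq0// invr_neq0// pnatr_eq0.
exact: (cvg_comp _ _ hu hc).
Unshelve. all: by end_near. Qed.

(** Dominated convergence: for steps at most |t| the quotients are bounded by [M] and vanish outside
    a fixed box. The exponent is a parameter because both the integral of the derivative and its
    squared norm are needed. *)
Lemma dq_integral_cvg (t : R) (p : nat) : t != 0 ->
  [/\ integrableR mu (fun x => g x ^+ p.+1), forall k, integrableR mu (fun x => dq (t / k.+1%:R) x ^+ p.+1) &
  \int[mu]_x (dq (t / k.+1%:R) x ^+ p.+1) @[k --> \oo] --> \int[mu]_x (g x ^+ p.+1)].
Proof.
move=> t0.
pose B : set 'rV[R]_n := box (fun=> `[- (L + `|t|), L + `|t|]%classic : set R).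
have mB : measurable B by apply: measurable_box.
have fB : (mu B < +oo)%E.
  apply: bounded_lebesgue_row_fin => //; apply/bounded_rowP.
  by exists (L + `|t|) => x Bx j; have := Bx j; rewrite /= in_itv /= -ler_norml.
have tk k : t / k.+1%:R != 0 by rewrite mulf_neq0// invr_neq0// pnatr_eq0.
have tkle k : `|t / k.+1%:R| <= `|t|.
  rewrite normrM normfV ler_pdivrMr ?normr_gt0 ?pnatr_eq0//.
  by rewrite ler_peMr// ger0_norm// ler1n.
have mdq k : measurable_fun setT (dq (t / k.+1%:R)).
  apply: measurable_funM => //; apply: measurable_funB; last exact: continuous_measurable_row.
  under eq_fun do rewrite -aff1E.
  by apply: measurable_comp_aff; exact: continuous_measurable_row.
have mg : measurable_fun setT g by exact: continuous_measurable_row.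
have M0 : 0 <= M by apply: le_trans (gM 0).
have bnd k x : `|dq (t / k.+1%:R) x ^+ p.+1| <= M ^+ p.+1 * \1_B x.
  rewrite indicE; have [xB|xB] := boolP (x \in B).
    by rewrite mulr1 normrX lerXn2r ?nnegrE ?normr_ge0// dq_le.
  rewrite (dq_out (tkle k)) ?expr0n ?normr0 ?mulr0// => Bx.
  by move/negP: xB; apply; rewrite inE.
have iB : integrableR mu (fun x => M ^+ p.+1 * \1_B x) by apply: integrableRZ; exact: integrableR_indic.
have idq k : integrableR mu (fun x => dq (t / k.+1%:R) x ^+ p.+1).
  by apply: integrableR_le (iB) (bnd k); exact: measurable_funX.
have [] := @dominated_convergence _ _ R mu setT measurableT
  (fun k x => (dq (t / k.+1%:R) x ^+ p.+1)%:E) (fun x => (g x ^+ p.+1)%:E)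
  (fun x => (M ^+ p.+1 * \1_B x)%:E).
- by move=> k; apply/measurable_EFinP; exact: measurable_funX.
- by apply/measurable_EFinP; exact: measurable_funX.
- apply: nearW => x _; apply: cvg_EFin; first by apply: nearW.
  have hx : dq (t / k.+1%:R) x ^+ p.+1 @[k --> \oo] --> g x ^+ p.+1.
    elim: p.+1 => [|q IH].
      by under eq_fun do rewrite expr0; rewrite expr0; exact: cvg_cst.
    by under eq_fun do rewrite exprS; rewrite exprS; apply: cvgM => //; exact: dq_cvg.
  exact: hx.
- exact: iB.
- by apply: nearW => x k _; rewrite lee_fin bnd.
move=> ig _ hc; split => //.
apply: fine_cvg; rewrite fineK; last exact: integrable_fin_num.
by [].
Qed.

Hypothesis L2f : L2 mu f.

(* By translation invariance the difference quotients have integral [0]. *)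
Lemma integral_derive_eq0 : integrableR mu g /\ \int[mu]_x g x = 0.
Proof.
have [ig _] := @dq_integral_cvg 1 0 (oner_neq0 _).
have E (h : 'rV[R]_n -> R) : (fun x => h x ^+ 1) = h by apply/funext.
rewrite E in ig; rewrite E => hc; split => //.
have if_ : integrableR mu f.
  have [L' [ML' bL]] : exists L', 0 <= L' /\ forall x, f x != 0 -> forall j, `|x ord0 j| <= L'.
    exists (Num.max 0 L); split; first by rewrite le_max lexx.
    by move=> x fx j; rewrite le_max fL ?orbT.
  case: L2f => mf if2.
  pose B : set 'rV[R]_n := box (fun=> `[- L', L']%classic : set R).
  have mB : measurable B by apply: measurable_box.
  have fB : (mu B < +oo)%E.
    apply: bounded_lebesgue_row_fin => //; apply/bounded_rowP.
    by exists L' => x Bx j; have := Bx j; rewrite /= in_itv /= -ler_norml.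
  (* A square integrable function with bounded support is integrable, since |f| <= 1 + f^2. *)
  apply: (@integrableR_le _ _ _ _ f (fun x => \1_B x + f x ^+ 2)) => //.
    by apply: integrableRD => //; exact: integrableR_indic.
  move=> x; rewrite indicE; have [->|fx] := eqVneq (f x) 0.
    by rewrite normr0 expr0n addr0 ler0n.
  have -> : x \in B by rewrite inE => j /=; rewrite in_itv /= -ler_norml; exact: bL.
  rewrite -(real_normK (num_real (f x))); have := sqr_ge0 (`|f x| - 1).
  by have := normr_ge0 (f x); rewrite /=; nra.
have E0 : (fun k : nat => \int[mu]_x (dq (1 / k.+1%:R) x ^+ 1)) = (fun=> 0 : R).
  apply/funext => k; rewrite E /dq.
  have [is1 is2] := integrableR_shift ((1 / k.+1%:R) *: v) if_.
  rewrite RintegralZl//; last exact: integrableRB.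
  by rewrite RintegralB// is2 subrr mulr0.
by rewrite E0 in hc; apply/esym; exact: (cvg_unique _ (cvg_cst (0 : R)) hc).
Qed.

(* Splitting the translation into [N] equal steps bounds the left-hand side by
   [t ^+ 2] times the norm of a difference quotient of step [t / N], for every
   [N]: this avoids the fundamental theorem of calculus. *)
Lemma sqnorm_shift_le (t : R) :
  sqnorm mu (fun x => f (t *: v + x) - f x) <= t ^+ 2 * sqnorm mu g.
Proof.
have [->|t0] := eqVneq t 0.
  rewrite expr0n mul0r /sqnorm; under eq_Rintegral do rewrite scale0r add0r subrr expr0n.
  by rewrite Rintegral_cst// mul0r.
have [_ idq hc] := @dq_integral_cvg t 1 t0.
have hc2 : (t ^+ 2 * \int[mu]_x (dq (t / k.+1%:R) x ^+ 2)) @[k --> \oo] --> t ^+ 2 * sqnorm mu g.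
  by apply: cvgM => //; exact: cvg_cst.
apply: (ler_cvg_to (cvg_cst _) hc2); apply: nearW => k.
set N := k.+1; pose tau := t / N%:R.
have N0 : N%:R != 0 :> R by rewrite pnatr_eq0.
have tau0 : tau != 0 by rewrite mulf_neq0// invr_neq0.
pose d x := f (tau *: v + x) - f x.
have L2d : L2 mu d by apply: L2B => //; exact: L2_shift.
have dE : (fun x => dq tau x ^+ 2) = (fun x => (tau ^+ 2)^-1 * d x ^+ 2).
  by apply/funext => x; rewrite /dq -/(d x) exprMn exprVn.
rewrite dE RintegralZl//; last by case: L2d.
(* One factor N comes from the N translated increments, which all have the norm of [d]; the other is
   the one in [sqr_sum_le]. *)
have -> : t ^+ 2 * ((tau ^+ 2)^-1 * \int[mu]_x (d x ^+ 2)) = N%:R * (N%:R * sqnorm mu d).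
  by rewrite /sqnorm /tau; field; rewrite t0 N0.
have -> : N%:R * sqnorm mu d = \int[mu]_x (\sum_(j < N) d ((j%:R * tau) *: v + x) ^+ 2).
  have hd (j : 'I_N) : integrableR mu (fun x => d ((j%:R * tau) *: v + x) ^+ 2).
    by have [] := L2_shift ((j%:R * tau) *: v) L2d.
  rewrite Rintegral_sum// (eq_bigr (fun=> sqnorm mu d)).
    by rewrite sumr_const card_ord mulr_natl.
  by move=> j _; exact: (sqnorm_shift ((j%:R * tau) *: v) L2d).
rewrite -RintegralZl//; last first.
  by apply: integrableR_sum => j; have [] := L2_shift ((j%:R * tau) *: v) L2d.
apply: le_Rintegral_setT.
- by have [] := L2B (L2_shift (t *: v) L2f) L2f.
- by apply: integrableRZ; apply: integrableR_sum => j; have [] := L2_shift ((j%:R * tau) *: v) L2d.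
move=> x; apply: le_trans (sqr_sum_le N (fun j => d ((j%:R * tau) *: v + x))).
rewrite le_eqVlt; apply/orP; left; apply/eqP; congr (_ ^+ 2).
pose u (j : nat) := f ((j%:R * tau) *: v + x).
rewrite (eq_bigr (fun j : 'I_N => u j.+1 - u j)) => [|j _]; last first.
  by rewrite /d /u addrA -scalerDl -natr1 mulrDl mul1r [tau + _]addrC.
rewrite -(big_mkord xpredT (fun j => u j.+1 - u j)) telescope_sumr// /u mul0r scale0r add0r.
by congr (f (_ *: _ + _) - _); rewrite /tau mulrC divfK.
Qed.

End difference_quotient.

(** The translation by [h] is split into [n] translations along the axes; the factor [n] is the
    price of squaring their sum. *)
Lemma sqnorm_shift_vec_le (R : realType) (n : nat) (f : 'rV[R]_n -> R) (L M : R) (h : 'rV[R]_n) :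
  smooth f -> (forall i, L2 (lebesgue_row n) (partial i f)) ->
  (forall i x, `|partial i f x| <= M) ->
  (forall x, f x != 0 -> forall j, `|x ord0 j| <= L) -> L2 (lebesgue_row n) f ->
  sqnorm (lebesgue_row n) (fun x => f (h + x) - f x) <=
  n%:R * \sum_(i < n) h ord0 i ^+ 2 * sqnorm (lebesgue_row n) (partial i f).
Proof.
move=> sf L2g gM fL L2f.
case: n f h sf L2g gM fL L2f => [|n] f h sf L2g gM fL L2f.
  rewrite big_ord0 mulr0 /sqnorm.
  have -> : (fun x : 'rV[R]_0 => (f (h + x) - f x) ^+ 2) = cst 0.
    by apply/funext => x; rewrite (thinmx0 (h + x)) (thinmx0 x) subrr expr0n.
  by rewrite Rintegral_cst// mul0r.
(* [w k] keeps the coordinates of [h] of index less than k, so that w(k+1) - w(k) is parallel to an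
   axis. Indexing by [nat], through [inord], lets the sum telescope. *)
pose w (k : nat) : 'rV[R]_n.+1 := \sum_(i < n.+1 | (i < k)%N) h ord0 i *: delta_mx ord0 i.
pose d (i : nat) x := f (h ord0 (inord i) *: delta_mx ord0 (inord i) + x) - f x.
have L2d i : L2 (lebesgue_row n.+1) (d i) by apply: L2B => //; exact: L2_shift.
have wS (k : 'I_n.+1) : w k.+1 = h ord0 k *: delta_mx ord0 k + w k.
  rewrite /w (bigD1 k) ?ltnSn//=; congr (_ + _); apply: eq_bigl => i.
  by rewrite ltnS leq_eqVlt -val_eqE /=; case: ltngtP.
have w0 : w 0 = 0 by rewrite /w big_pred0.
have wn : w n.+1 = h.
  by rewrite [RHS](row_sum_delta h) /w; apply: eq_bigl => i; rewrite ltn_ord.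
have i1 (i : nat) : integrableR (lebesgue_row n.+1) (fun x => d i (w i + x) ^+ 2).
  by have [] := L2_shift (w i) (L2d i).
apply: (@le_trans _ _ (\int[lebesgue_row n.+1]_x (n.+1%:R * \sum_(i < n.+1) d i (w i + x) ^+ 2))).
  apply: le_Rintegral_setT.
  - by have [] := L2B (L2_shift h L2f) L2f.
  - by apply: integrableRZ; apply: integrableR_sum => i.
  move=> x; apply: le_trans (sqr_sum_le n.+1 (fun i => d i (w i + x))).
  rewrite le_eqVlt; apply/orP; left; apply/eqP; congr (_ ^+ 2).
  rewrite (eq_bigr (fun i : 'I_n.+1 => f (w i.+1 + x) - f (w i + x))) => [|i _].
    by rewrite -(big_mkord xpredT (fun i => f (w i.+1 + x) - f (w i + x))) telescope_sumr// w0 wn add0r.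
  by rewrite /d wS inord_val addrA.
rewrite RintegralZl//; last by apply: integrableR_sum => i.
apply: ler_wpM2l => //; rewrite Rintegral_sum//; apply: ler_sum => i _.
have -> : \int[lebesgue_row n.+1]_x (d i (w i + x) ^+ 2) = sqnorm (lebesgue_row n.+1) (d i).
  exact: sqnorm_shift.
rewrite /d inord_val.
apply: (@sqnorm_shift_le R n.+1 i f (partial i f) L M) => //.
- by move=> x; exact: smooth_derive.
- exact: smooth_continuous.
- exact/smooth_continuous/smooth_partial.
Qed.

(** * Admissible families *)

Section test_function_integral.
Context {R : realType} (n : nat).
Local Notation mu := (@lebesgue_row R n).
Implicit Types (A B : set 'rV[R]_n) (phi psi u : 'rV[R]_n -> R).

Lemma test_function_continuous A phi : test_function A phi -> continuous phi.
Proof. by move=> [/smooth_continuous]. Qed.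

Lemma integrableR_compact_support phi (L M : R) : measurable_fun setT phi ->
  (forall x, `|phi x| <= M) ->
  (forall x, phi x != 0 -> forall i, `|x ord0 i| <= L) -> integrableR mu phi.
Proof.
move=> mphi hM hL.
pose B : set 'rV[R]_n := box (fun=> `[- L, L]%classic : set R).
apply: (@integrableR_bounded _ _ B _ M) => //.
- by apply: measurable_box.
- apply: bounded_lebesgue_row_fin; first by apply: measurable_box.
  apply/bounded_rowP; exists L => x Bx j; have := Bx j.
  by rewrite /= in_itv /= -ler_norml.
- move=> x nBx; apply/eqP/negPn/negP => /hL h; apply: nBx => j /=.
  by rewrite in_itv /= -ler_norml.
Qed.

Lemma test_function_L2 A phi : test_function A phi -> L2 mu phi.
Proof.
move=> tphi; have cphi := test_function_continuous tphi.
have [L [M [L0 M0 hM hL]]] := test_function_bounded tphi.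
split; first exact: continuous_measurable_row.
apply: (@integrableR_compact_support _ L (M ^+ 2)).
- by apply: measurable_funX; exact: continuous_measurable_row.
- by move=> x; rewrite normrX lerXn2r ?nnegrE.
- by move=> x; rewrite expf_eq0 /= => /hL.
Qed.

(** The derivative of the product phi * psi has integral 0. *)
Lemma test_function_ibp A phi psi i : test_function A phi -> test_function A psi ->
  dot mu phi (partial i psi) = - dot mu (partial i phi) psi.
Proof.
move=> tphi tpsi; have [sphi _ _] := tphi; have [spsi _ _] := tpsi.
have tdphi := test_function_partial i tphi; have tdpsi := test_function_partial i tpsi.
have [L [M [L0 M0 hM hL]]] := test_function_bounded tphi.
have [L' [M' [L'0 M'0 hM' hL']]] := test_function_bounded tpsi.
have [L1 [M1 [L10 M10 hM1 hL1]]] := test_function_bounded tdphi.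
have [L2' [M2 [L20 M20 hM2 hL2]]] := test_function_bounded tdpsi.
have cphi := test_function_continuous tphi; have cpsi := test_function_continuous tpsi.
have cdphi := test_function_continuous tdphi; have cdpsi := test_function_continuous tdpsi.
have dp x : is_derive x (delta_mx ord0 i) (fun x => phi x * psi x)
    (phi x * partial i psi x + psi x * partial i phi x).
  have h1 := smooth_derive i x sphi; have h2 := smooth_derive i x spsi.
  exact: is_deriveM.
have cp : continuous (fun x => phi x * psi x).
  by move=> x; apply: continuousM; [exact: cphi|exact: cpsi].
have cdp : continuous (fun x => phi x * partial i psi x + psi x * partial i phi x).
  by move=> x; exact: (cvgD (cvgM (cphi x) (cdpsi x)) (cvgM (cpsi x) (cdphi x))).
have hMp x : `|phi x * partial i psi x + psi x * partial i phi x| <= M * M2 + M' * M1.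
  apply: le_trans (ler_normD _ _) _; rewrite !normrM.
  by apply: lerD; apply: ler_pM.
have hLp x : phi x * psi x != 0 -> forall j, `|x ord0 j| <= L.
  by rewrite mulf_eq0 negb_or => /andP[/hL].
have L2p : L2 mu (fun x => phi x * psi x).
  split; first exact: continuous_measurable_row.
  apply: (@integrableR_compact_support _ L ((M * M') ^+ 2)).
  + by apply: measurable_funX; exact: continuous_measurable_row.
  + move=> x; rewrite normrX lerXn2r ?nnegrE ?mulr_ge0// normrM.
    exact: ler_pM.
  + by move=> x; rewrite expf_eq0 /= => /hLp.
have [_] := integral_derive_eq0 dp cp cdp hMp hLp L2p.
rewrite RintegralD//.
- move/eqP; rewrite addr_eq0 => /eqP; rewrite -/(dot mu phi (partial i psi)) => ->.
  by congr (- _); exact: dotC.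
- by apply: L2_mul; [exact: test_function_L2 tphi|exact: test_function_L2 tdpsi].
- by apply: L2_mul; [exact: test_function_L2 tpsi|exact: test_function_L2 tdphi].
Qed.

End test_function_integral.

Section admissible.
Context {R : realType} (n : nat).
Local Notation mu := (@lebesgue_row R n).
Implicit Types (A B : set 'rV[R]_n) (u : 'rV[R]_n -> R) (G : 'I_n -> 'rV[R]_n -> R).

Definition h1dist u G (phi : 'rV[R]_n -> R) : R :=
  sqnorm mu (fun x => u x - phi x) + \sum_(i < n) sqnorm mu (fun x => G i x - partial i phi x).

(* [u] in [H^1_0(A)] with gradient [G], both extended by [0] to the whole
   space. *)
Definition h10 A u G : Prop :=
  [/\ L2 mu u, forall i, L2 mu (G i),
      forall x, ~ A x -> u x = 0 /\ forall i, G i x = 0 &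
      forall e, 0 < e -> exists2 phi, test_function A phi & h1dist u G phi <= e].

(** The index is any finite type, so that unions and grids of families are indexed by sums and
    products. The number [e] only bounds the energy: infima are then handled without minimizers. *)
Definition admissible A (I : finType) (e : R) : Prop :=
  exists (u : I -> 'rV[R]_n -> R) (G : I -> 'I_n -> 'rV[R]_n -> R),
    [/\ forall j, h10 A (u j) (G j),
        forall j l, j != l -> {ae mu, forall x, u j x * u l x = 0},
        forall j, sqnorm mu (u j) = 1 &
        \sum_j \sum_(i < n) sqnorm mu (G j i) <= e].

Lemma h1dist_ge0 u G phi : 0 <= h1dist u G phi.
Proof. by apply: addr_ge0; [exact: sqnorm_ge0|apply: sumr_ge0 => i _; exact: sqnorm_ge0]. Qed.

Lemma sqnorm_h1dist u G phi : sqnorm mu (fun x => u x - phi x) <= h1dist u G phi.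
Proof. by rewrite lerDl; apply: sumr_ge0 => i _; exact: sqnorm_ge0. Qed.

Lemma sqnorm_partial_h1dist u G phi i :
  sqnorm mu (fun x => G i x - partial i phi x) <= h1dist u G phi.
Proof.
rewrite /h1dist (bigD1 i)//= addrCA lerDl addr_ge0 ?sqnorm_ge0//.
by apply: sumr_ge0 => j _; exact: sqnorm_ge0.
Qed.

Lemma h10_sub A B u G : A `<=` B -> h10 A u G -> h10 B u G.
Proof.
move=> AB [h1 h2 h3 h4]; split => //.
  by move=> x nB; apply: h3 => /AB.
by move=> e /h4[phi tphi ?]; exists phi => //; exact: test_function_sub tphi.
Qed.

Lemma h10_aff A u G (s c : R) a : 0 < s -> h10 A u G ->
  h10 (aff s a @^-1` A) (fun x => c * u (aff s a x))
    (fun i x => c * s * G i (aff s a x)).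
Proof.
move=> s0 [h1 h2 h3 h4]; split.
- by apply: L2Z; exact: L2_aff.
- by move=> i; apply: L2Z; exact: L2_aff.
- by move=> x /h3[-> h]; rewrite mulr0; split => // i; rewrite h mulr0.
move=> e e0.
(* Under the change of variables the function part of the squared distance is multiplied by s^-n c^2
   and the gradient part by s^-n (cs)^2; [K] exceeds both, and the added 1 makes it positive. *)
pose K := (s ^+ n)^-1 * (c ^+ 2 + (c * s) ^+ 2) + 1.
have sn0 : 0 <= (s ^+ n)^-1 by rewrite invr_ge0 exprn_ge0// ltW.
have K0 : 0 < K by rewrite ltr_wpDl// mulr_ge0// addr_ge0 ?sqr_ge0.
have [phi tphi hphi] := h4 (e / K) (divr_gt0 e0 K0).
have L2phi := test_function_L2 tphi.
have [sphi _ _] := tphi.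
exists (fun x => c * phi (aff s a x)); first by apply: test_function_aff => //; rewrite gt_eqF.
rewrite /h1dist.
have -> : (fun x => c * u (aff s a x) - c * phi (aff s a x)) =
  (fun x => c * (fun y => u y - phi y) (aff s a x)).
  by apply/funext => x; rewrite mulrBr.
have E i : (fun x => c * s * G i (aff s a x) - partial i (fun x => c * phi (aff s a x)) x) =
  (fun x => (c * s) * (fun y => G i y - partial i phi y) (aff s a x)).
  by apply/funext => x; rewrite partial_aff// mulrBr.
under eq_bigr do rewrite E.
have L2p i : L2 mu (partial i phi) by apply: test_function_L2 (test_function_partial i tphi).
rewrite sqnormZ; last by apply: (L2_aff (f := fun y => u y - phi y)) => //; exact: L2B.
rewrite (sqnorm_aff (f := fun y => u y - phi y))//; last exact: L2B.
under eq_bigr => i _.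
  rewrite sqnormZ; last by apply: (L2_aff (f := fun y => G i y - partial i phi y)) => //; exact: L2B.
  rewrite (sqnorm_aff (f := fun y => G i y - partial i phi y))//; last exact: L2B.
  over.
rewrite -!mulr_sumr.
move: hphi; rewrite ler_pdivlMr// => hphi; apply: le_trans hphi.
rewrite /h1dist; set a0 := sqnorm _ _; set b0 := \sum_(i < n) _.
have a00 : 0 <= a0 by exact: sqnorm_ge0.
have b00 : 0 <= b0 by apply: sumr_ge0 => i _; exact: sqnorm_ge0.
rewrite /K; move: sn0; set t := (s ^+ n)^-1 => t0.
have c20 := sqr_ge0 c; have cs20 := sqr_ge0 (c * s).
move: c20 cs20; set c2 := c ^+ 2; set cs2 := (c * s) ^+ 2 => c20 cs20.
have -> : (a0 + b0) * (t * (c2 + cs2) + 1) = c2 * (t * a0) + cs2 * (t * b0) + (cs2 * (t * a0) + c2 * (t * b0) + (a0 + b0)) by ring.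
rewrite lerDl; apply: addr_ge0; last exact: addr_ge0.
by apply: addr_ge0; apply: mulr_ge0 => //; exact: mulr_ge0.
Qed.

Lemma admissible_le A (I : finType) e e' : e <= e' ->
  admissible A I e -> admissible A I e'.
Proof. by move=> ee' [u [G [h1 h2 h3 h4]]]; exists u, G; split => //; exact: le_trans ee'. Qed.

Lemma admissible_inj A (I J : finType) (f : J -> I) e : injective f ->
  admissible A I e -> admissible A J e.
Proof.
move=> fi [u [G [h1 h2 h3 h4]]]; exists (u \o f), (G \o f); split => //.
- by move=> j; exact: h1.
- by move=> j l jl; apply: h2; rewrite (inj_eq fi).
- by move=> j; exact: h3.
apply: le_trans h4.
rewrite [leRHS](bigID (mem (f @: J))) /=.
rewrite big_imset/=; last by move=> j l _ _; exact: fi.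
rewrite -[leLHS]addr0; apply: lerD; last first.
  by apply: sumr_ge0 => j _; apply: sumr_ge0 => i _; exact: sqnorm_ge0.
by [].
Qed.

Lemma admissible_union A1 A2 B (I1 I2 : finType) e1 e2 :
  A1 `<=` B -> A2 `<=` B -> A1 `&` A2 = set0 ->
  admissible A1 I1 e1 -> admissible A2 I2 e2 ->
  admissible B (I1 + I2)%type (e1 + e2).
Proof.
move=> A1B A2B A12 [u1 [G1 [h1 h2 h3 h4]]] [u2 [G2 [k1 k2 k3 k4]]].
exists (fun j => match j with inl j => u1 j | inr j => u2 j end),
  (fun j => match j with inl j => G1 j | inr j => G2 j end).
have dis (j : I1) (l : I2) x : u1 j x * u2 l x = 0.
  have [x1|x1] := pselect (A1 x).
    have [_ _ /(_ x)[|-> _]] := k1 l; last by rewrite mulr0.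
    by move=> x2; have : (A1 `&` A2) x by []; rewrite A12.
  by have [_ _ /(_ x x1)[-> _] _] := h1 j; rewrite mul0r.
split.
- by move=> [j|j]; [exact: h10_sub (h1 j)|exact: h10_sub (k1 j)].
- move=> [j|j] [l|l] jl.
  + exact: h2.
  + by apply: nearW => x; exact: dis.
  + by apply: nearW => x; rewrite mulrC; exact: dis.
  + exact: k2.
- by move=> [j|j]; [exact: h3|exact: k3].
- by rewrite big_sumType /=; exact: lerD.
Qed.

(** Each preimage of [A] is a copy of it of size 1/s, so Dirichlet energies of normalized functions
    are multiplied by s^2. The copies are disjoint, hence so are the families that they carry. *)
Lemma admissible_grid A B (I Z : finType) (s : R) (a : Z -> 'rV[R]_n) e :
  0 < s -> (forall z, aff s (a z) @^-1` A `<=` B) ->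
  (forall z z' x, z != z' -> A (aff s (a z) x) -> A (aff s (a z') x) -> False) ->
  admissible A I e -> admissible B (Z * I)%type (#|Z|%:R * s ^+ 2 * e).
Proof.
move=> s0 AB Adis [u [G [h1 h2 h3 h4]]].
(* This factor compensates the Jacobian s^-n and keeps the functions normalized. *)
pose c := Num.sqrt (s ^+ n).
have sn0 : 0 < s ^+ n by rewrite exprn_gt0.
have c2 : c ^+ 2 = s ^+ n by rewrite sqr_sqrtr// ltW.
exists (fun p x => c * u p.2 (aff s (a p.1) x)),
  (fun p i x => c * s * G p.2 i (aff s (a p.1) x)).
split.
- move=> [z j] /=; apply: h10_sub (AB z) _; exact: h10_aff.
- move=> [z j] [z' l] /= jl.
  have [zz|zz] := eqVneq z z'.
    subst z'; have {}jl : j != l by apply: contraNneq jl => ->.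
    (* Within one copy disjointness holds only almost everywhere: the exceptional null set is pulled
       back, and remains null by the scaling of the measure. *)
    have [N [mN N0 hN]] := h2 _ _ jl.
    exists (aff s (a z) @^-1` N); split.
    + by rewrite -[X in measurable X]setTI; exact: measurable_aff.
    + have := lebesgue_row_aff (a z) s0 mN; rewrite N0 => /esym/eqP.
      by rewrite mule_eq0 eqe gt_eqF//= => /eqP.
    + move=> x /= hx; apply: hN => /= h; apply: hx.
      by rewrite mulrACA h mulr0.
  apply: nearW => x.
  have [xA|xA] := pselect (A (aff s (a z) x)).
    have [_ _ /(_ (aff s (a z') x))[|-> _]] := h1 l; last by rewrite !mulr0.
    by move=> xA'; exact: (Adis z z' x).
  by have [_ _ /(_ _ xA)[-> _] _] := h1 j; rewrite mulr0 mul0r.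
- move=> [z j] /=; have [L2u _ _ _] := h1 j.
  rewrite sqnormZ; last exact: L2_aff.
  by rewrite sqnorm_aff// h3 mulr1 c2 mulfV// gt_eqF.
- rewrite -(pair_bigA _ (fun z j => \sum_(i < n) sqnorm mu (fun x => c * s * G j i (aff s (a z) x)))) /=.
  have E z j i : sqnorm mu (fun x => c * s * G j i (aff s (a z) x)) = s ^+ 2 * sqnorm mu (G j i).
    have [_ L2G _ _] := h1 j.
    rewrite sqnormZ; last exact: L2_aff.
    rewrite sqnorm_aff// exprMn c2 mulrA; congr (_ * _).
    by rewrite mulrAC mulfV ?mul1r// gt_eqF.
  under eq_bigr => z _.
    under eq_bigr => j _.
      under eq_bigr do rewrite E.
      rewrite -mulr_sumr; over.
    rewrite -mulr_sumr; over.
  rewrite sumr_const -[_ *+ _]mulr_natl -mulrA; apply: ler_wpM2l => //.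
  by apply: ler_wpM2l => //; exact: sqr_ge0.
Qed.

Lemma admissible_aff A B (I : finType) (s : R) (a : 'rV[R]_n) e :
  0 < s -> aff s a @^-1` A `<=` B ->
  admissible A I e -> admissible B I (s ^+ 2 * e).
Proof.
move=> s0 AB h.
have := @admissible_grid A B I unit s (fun=> a) e s0 (fun=> AB) _ h.
rewrite card_unit mul1r => H.
by apply: (@admissible_inj B _ _ (fun j => (tt, j))) (H _) => [j l []//|[] []].
Qed.

End admissible.

(** * Admissible families and energies *)

Section energies.
Context {R : realType} (n : nat).
Local Notation mu := (@lebesgue_row R n).
Variable A : set 'rV[R]_n.
Hypothesis mA : measurable A.
Implicit Types (u f : 'rV[R]_n -> R) (G : 'I_n -> 'rV[R]_n -> R).

Let patchE f x : (f \_ A) x = if x \in A then f x else 0.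
Proof. by rewrite /patch. Qed.

Let patch_in f x : A x -> (f \_ A) x = f x.
Proof. by move=> Ax; rewrite patchE mem_set. Qed.

Let patch_out f x : ~ A x -> (f \_ A) x = 0.
Proof. by move=> Ax; rewrite patchE memNset. Qed.

Let patch_id f : (forall x, ~ A x -> f x = 0) -> f \_ A = f.
Proof.
move=> h; apply/funext => x; have [Ax|Ax] := pselect (A x); first by rewrite patch_in.
by rewrite patch_out// h.
Qed.

Let integral_patch (F : R -> R) f : F 0 = 0 ->
  (\int[mu]_(x in A) (F (f x))%:E = \int[mu]_x (F ((f \_ A) x))%:E)%E.
Proof.
move=> F0; rewrite integral_mkcond; apply: eq_integral => x _.
rewrite /patch; case: ifP => //; by rewrite F0.
Qed.

Lemma square_integrableP f : square_integrable A f <-> L2 mu (f \_ A).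
Proof.
split=> -[h1 h2].
  have m1 : measurable_fun setT (f \_ A) by apply/(measurable_restrictT f mA).
  split => //; apply/integrableR_ge0P => [|x|]; [exact: measurable_funX|exact: sqr_ge0|].
  by rewrite -(integral_patch (F := fun y : R => y ^+ 2)) ?expr0n.
split; first by apply/(measurable_restrictT f mA).
rewrite (integral_patch (F := fun y : R => y ^+ 2)) ?expr0n//.
by rewrite -(EFin_Rintegral h2) ltry.
Qed.

Lemma integral_sqr_patch f : L2 mu (f \_ A) ->
  (\int[mu]_(x in A) ((f x) ^+ 2)%:E = (sqnorm mu (f \_ A))%:E)%E.
Proof.
by move=> [_ h]; rewrite (integral_patch (F := fun y : R => y ^+ 2)) ?expr0n// EFin_Rintegral.
Qed.

Let Rintegral_patch_mul f phi : \int[mu]_(x in A) (f x * phi x) = dot mu (f \_ A) phi.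
Proof.
rewrite Rintegral_mkcond; apply: eq_Rintegral => x _.
by rewrite /patch; case: ifP => //; rewrite mul0r.
Qed.

Lemma integral_sum_sqr_patch (I : finType) (f : I -> 'rV[R]_n -> R) :
  (forall i, L2 mu (f i \_ A)) ->
  (\int[mu]_(x in A) (\sum_i (f i x) ^+ 2)%:E = (\sum_i sqnorm mu (f i \_ A))%:E)%E.
Proof.
move=> L2f; rewrite integral_mkcond.
rewrite (eq_integral (fun x => (\sum_i ((f i \_ A) x) ^+ 2)%:E)); last first.
  move=> x _; rewrite /patch; case: ifP => // _.
  by rewrite big1// => i _; rewrite expr0n.
rewrite -EFin_Rintegral; last by apply: integrableR_sum => i; case: (L2f i).
by rewrite Rintegral_sum// => i; case: (L2f i).
Qed.

Lemma test_function_patch phi : test_function A phi -> phi \_ A = phi.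
Proof. by move=> tphi; apply: patch_id => x; exact: test_function_out tphi. Qed.

Let patchB f g : (fun x => f x - g x) \_ A = (fun x => (f \_ A) x - (g \_ A) x).
Proof. by apply/funext => x; rewrite /patch; case: ifP => //; rewrite subrr. Qed.

Lemma h1dist_integral u G phi : L2 mu (u \_ A) -> (forall i, L2 mu (G i \_ A)) ->
  test_function A phi ->
  (\int[mu]_(x in A) ((u x - phi x) ^+ 2 +
          \sum_(i < n) (G i x - partial i phi x) ^+ 2)%:E =
   (h1dist (u \_ A) (fun i => G i \_ A) phi)%:E)%E.
Proof.
move=> L2u L2G tphi.
(* Gathering the function and its gradient in one family turns the squared H^1 distance into a
   single sum of squares. *)
pose f (o : 'I_1 + 'I_n) x := match o with
  | inl _ => u x - phi x | inr i => G i x - partial i phi x end.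
have f0 : f (inl ord0) \_ A = (fun x => (u \_ A) x - phi x).
  by rewrite /f patchB (test_function_patch tphi).
have fS i : f (inr i) \_ A = (fun x => (G i \_ A) x - partial i phi x).
  by rewrite /f patchB (test_function_patch (test_function_partial i tphi)).
have L2f o : L2 mu (f o \_ A).
  case: o => [i|i]; first by rewrite (ord1 i) f0; apply: L2B => //; exact: test_function_L2 tphi.
  by rewrite fS; apply: L2B => //; exact: test_function_L2 (test_function_partial i tphi).
have := integral_sum_sqr_patch L2f.
rewrite big_sumType /= big_ord1 f0.
under [in X in _ = X -> _]eq_bigr do rewrite fS.
by move=> <-; apply: eq_integral => x _; rewrite big_sumType /= big_ord1.
Qed.

Lemma weak_gradient_dot u G i phi : L2 mu (u \_ A) -> (forall i, L2 mu (G i \_ A)) ->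
  weak_gradient A u G -> test_function A phi ->
  dot mu (u \_ A) (partial i phi) = - dot mu (G i \_ A) phi.
Proof.
by move=> L2u L2G /(_ i)[_ /(_ phi)] + tphi => /(_ tphi); rewrite !Rintegral_patch_mul.
Qed.

Lemma weak_gradient_L2 u G i : weak_gradient A u G -> L2 mu (G i \_ A).
Proof. by move=> /(_ i)[/square_integrableP]. Qed.

(* The gradient obtained in the closure has the smallest norm: with [psi] a
   test function close to [G' i], orthogonality to the test functions gives
   [sqnorm (G - psi) - sqnorm (G' - psi) = sqnorm G - sqnorm G']. *)
Lemma H10_h10 u G : H10 A u -> weak_gradient A u G ->
  exists2 G', h10 A (u \_ A) G' & forall i, sqnorm mu (G' i) <= sqnorm mu (G i \_ A).
Proof.
move=> [/square_integrableP L2u [G' wG' [phi tphi hphi]]] wG.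
have L2G i := weak_gradient_L2 i wG.
have L2G' i := weak_gradient_L2 i wG'.
have near_phi e : 0 < e -> exists k, h1dist (u \_ A) (fun i => G' i \_ A) (phi k) <= e.
  move=> e0; have /fine_cvgP[_ /cvgrPdist_le/(_ _ e0)[k _ hk]] := hphi.
  exists k; have := hk k (leqnn k).
  rewrite /= h1dist_integral//= sub0r normrN ger0_norm//; exact: h1dist_ge0.
exists (fun i => G' i \_ A).
  split => //.
  - by move=> x nA; rewrite patch_out//; split => // i; rewrite patch_out.
  - by move=> e /near_phi[k hk]; exists (phi k).
move=> i; apply/ler_addgt0Pr => e e0.
have [k hk] := near_phi e e0.
have tdphi := test_function_partial i (tphi k).
have L2psi := test_function_L2 tdphi.
have h1 := weak_gradient_dot i L2u L2G wG tdphi.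
have h2 := weak_gradient_dot i L2u L2G' wG' tdphi.
have heq : dot mu (G i \_ A) (partial i (phi k)) = dot mu (G' i \_ A) (partial i (phi k)).
  by apply: oppr_inj; rewrite -h1 -h2.
apply: sqnorm_le_of_dot heq _ => //.
exact: le_trans (sqnorm_partial_h1dist (u \_ A) (fun i => G' i \_ A) (phi k) i) hk.
Qed.

Lemma h10_dot u G i phi : h10 A u G -> test_function A phi ->
  dot mu u (partial i phi) = - dot mu (G i) phi.
Proof.
move=> [L2u L2G _ happrox] tphi.
have tdphi := test_function_partial i tphi.
have L2phi := test_function_L2 tphi; have L2dphi := test_function_L2 tdphi.
apply/eqP; rewrite -subr_eq0 opprK -normr_le0; apply/ler_addgt0Pr => e e0; rewrite add0r.
pose K := sqnorm mu phi + sqnorm mu (partial i phi).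
have K0 : 0 <= K by rewrite addr_ge0 ?sqnorm_ge0.
(* With this weight the terms carrying t^-1 add up to at most e/2; an approximation within e/(4t)
   then makes each of the two terms carrying [t] at most e/4. *)
pose t := 2 * (K + 1) / e.
have t0 : 0 < t by rewrite divr_gt0// mulr_gt0// ltr_wpDl.
have [psi tpsi hpsi] := happrox (e / (4 * t)) (divr_gt0 e0 (mulr_gt0 (ltr0n _ 4) t0)).
have tdpsi := test_function_partial i tpsi.
have L2psi := test_function_L2 tpsi; have L2dpsi := test_function_L2 tdpsi.
have ibp := test_function_ibp i tpsi tphi.
have -> : dot mu u (partial i phi) + dot mu (G i) phi =
  dot mu (fun x => u x - psi x) (partial i phi) + dot mu (fun x => G i x - partial i psi x) phi.
  by rewrite !dotBl// ibp; ring.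
apply: le_trans (ler_normD _ _) _.
have b1 := dot_le t0 (L2B L2u L2psi) L2dphi.
have b2 := dot_le t0 (L2B (L2G i) L2dpsi) L2phi.
have c1 := sqnorm_h1dist u G psi; have c2 := sqnorm_partial_h1dist u G psi i.
have d1 : t * sqnorm mu (fun x => u x - psi x) <= e / 4.
  apply: (@le_trans _ _ (t * (e / (4 * t)))); last by rewrite le_eqVlt; apply/orP; left; apply/eqP; field; rewrite gt_eqF.
  by rewrite ler_pM2l//; exact: le_trans hpsi.
have d2 : t * sqnorm mu (fun x => G i x - partial i psi x) <= e / 4.
  apply: (@le_trans _ _ (t * (e / (4 * t)))); last by rewrite le_eqVlt; apply/orP; left; apply/eqP; field; rewrite gt_eqF.
  by rewrite ler_pM2l//; exact: le_trans hpsi.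
have d3 : t^-1 * sqnorm mu (partial i phi) + t^-1 * sqnorm mu phi <= e / 2.
  rewrite -mulrDr addrC -/K /t invfM invrK.
  rewrite (_ : _ * K = e / 2 * (K / (K + 1))); last by field; rewrite gt_eqF// ltr_wpDl.
  rewrite ler_piMr// ?divr_ge0 ?ltW//.
  by rewrite ltr_pdivrMr ?mul1r ?ltrDl// ltr_wpDl.
lra.
Qed.

Lemma h10_H10 u G : h10 A u G -> H10 A u /\ weak_gradient A u G.
Proof.
move=> hu; have [L2u L2G hout happrox] := hu.
have uA : u \_ A = u by apply: patch_id => x /hout[].
have GA i : G i \_ A = G i by apply: patch_id => x /hout[_].
have wG : weak_gradient A u G.
  move=> i; split; first by apply/square_integrableP; rewrite GA.
  move=> phi tphi.
  by rewrite !Rintegral_patch_mul uA GA; exact: h10_dot.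
split => //; split; first by apply/square_integrableP; rewrite uA.
exists G => //.
have hk (k : nat) : exists phi, test_function A phi /\ h1dist u G phi <= k.+1%:R^-1.
  by have [|phi] := happrox k.+1%:R^-1; [rewrite invr_gt0|exists phi].
pose phi k := projT1 (cid (hk k)).
have tphi k : test_function A (phi k) by rewrite /phi; case: cid => ? [].
have hphi k : h1dist u G (phi k) <= k.+1%:R^-1 by rewrite /phi; case: cid => ? [].
exists phi => //.
under eq_fun => k.
  rewrite h1dist_integral ?uA//; last by move=> i; rewrite GA.
  over.
apply: cvg_EFin; first by apply: nearW.
apply: (squeeze_cvgr _ (cvg_cst 0) cvg_harmonic).
apply: nearW => k /=; rewrite h1dist_ge0 /=.
have -> : (fun i => G i \_ A) = G by apply/funext => i; rewrite GA.
exact: hphi.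
Qed.

Lemma Sigma_mul0 m (y : 'I_m -> R) : Sigma y <-> forall j l, j != l -> y j * y l = 0.
Proof.
split => [/eqP|h].
  rewrite psumr_eq0 => [/allP h j l jl|k _]; last first.
    by apply: sumr_ge0 => l _; rewrite mulr_ge0 ?sqr_ge0.
  have := h j (mem_index_enum _); rewrite /= psumr_eq0 => [/allP/(_ l (mem_index_enum _))|k _].
    by rewrite jl /= -exprMn expf_eq0 /= => /eqP.
  by rewrite mulr_ge0 ?sqr_ge0.
rewrite /Sigma /=; apply: big1 => j _; apply: big1 => l jl.
by rewrite -exprMn h// expr0n.
Qed.

(** The gradients in [energies] are arbitrary weak gradients, not known to be limits of gradients of
    test functions. Those given by [H10_h10] are, and their norms are no larger. *)
Lemma energies_admissible m (E : \bar R) : energies A m E ->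
  exists2 e : R, E = e%:E & admissible A 'I_m e.
Proof.
move=> [u [G [[hu hS] wG nu ->]]].
have L2G j i := weak_gradient_L2 i (wG j).
have -> : (\int[mu]_(x in A) (\sum_(j < m) \sum_(i < n) G j i x ^+ 2)%:E =
    (\sum_(j < m) \sum_(i < n) sqnorm mu (G j i \_ A))%:E)%E.
  have := @integral_sum_sqr_patch ('I_m * 'I_n)%type (fun p => G p.1 p.2) (fun p => L2G p.1 p.2).
  rewrite -(pair_bigA _ (fun j i => sqnorm mu (G j i \_ A))) /= => <-.
  by apply: eq_integral => x _; rewrite (pair_bigA _ (fun j i => G j i x ^+ 2)).
eexists; first by [].
have hG' j := cid2 (H10_h10 (hu j) (wG j)).
exists (fun j => u j \_ A), (fun j => s2val (hG' j)); split.
- by move=> j; exact: (s2valP (hG' j)).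
- move=> j l jl; apply: filterS hS => x hx.
  have [Ax|Ax] := pselect (A x); last by rewrite patch_out// mul0r.
  by rewrite !patch_in//; exact: (Sigma_mul0 _).1 (hx Ax) j l jl.
- move=> j; have [/square_integrableP L2u _] := hu j.
  by have := integral_sqr_patch L2u; rewrite nu => -[].
- by apply: ler_sum => j _; apply: ler_sum => i _; exact: (s2valP' (hG' j)).
Qed.

Lemma admissible_energies m (e : R) : admissible A 'I_m e ->
  exists2 E, energies A m E & (E <= e%:E)%E.
Proof.
move=> [u [G [hu hS nu hE]]].
have uA j : u j \_ A = u j by apply: patch_id => x; have [_ _ h _] := hu j => /h[].
have GA j i : G j i \_ A = G j i by apply: patch_id => x; have [_ _ h _] := hu j => /h[].
exists ((\sum_j \sum_(i < n) sqnorm mu (G j i))%:E); last by rewrite lee_fin.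
exists u, G; split.
- split; first by move=> j; exact: (h10_H10 (hu j)).1.
  have : {ae mu, forall x, forall p : 'I_m * 'I_m, p.1 != p.2 -> u p.1 x * u p.2 x = 0}.
    apply: filter_forall => -[j l]; have [<-|jl] := eqVneq j l.
      by apply: nearW => x.
    by apply: filterS (hS j l jl) => x.
  apply: filterS => x h _; apply/Sigma_mul0 => j l.
  exact: (h (j, l)).
- by move=> j; exact: (h10_H10 (hu j)).2.
- move=> j; have [L2u _ _ _] := hu j.
  by rewrite integral_sqr_patch uA ?nu.
have := @integral_sum_sqr_patch ('I_m * 'I_n)%type (fun p => G p.1 p.2) _.
rewrite -(pair_bigA _ (fun j i => sqnorm mu (G j i \_ A))) /=.
under [in X in _ = X%:E]eq_bigr do under eq_bigr do rewrite GA.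
move=> H; rewrite -H.
  by apply: eq_integral => x _; rewrite (pair_bigA _ (fun j i => G j i x ^+ 2)).
by move=> [j i] /=; rewrite GA; have [_ h _ _] := hu j.
Qed.

End energies.

(** * Lower bound on the energy *)

Section lower_bound.
Context {R : realType} (n : nat).
Local Notation mu := (@lebesgue_row R n).
Implicit Types (A : set 'rV[R]_n) (u : 'rV[R]_n -> R) (G : 'I_n -> 'rV[R]_n -> R).

(** The constant 4 is 2 * 2: one factor for replacing [u] by a test function [phi], one for
    comparing the derivatives of [phi] with [G]. *)
Lemma sqnorm_shift_h10_le A u G (h : 'rV[R]_n) (s : R) : h10 A u G ->
  (forall i, `|h ord0 i| <= s) ->
  sqnorm mu (fun x => u (h + x) - u x) <= 4 * n%:R * s ^+ 2 * \sum_(i < n) sqnorm mu (G i).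
Proof.
move=> [L2u L2G _ happ] hs.
apply/ler_addgt0Pr => e e0.
(* Total coefficient of the approximation error: 8 from [u - phi] and its translate, the rest from
   the difference of the gradients in the [n] directions. *)
pose K := 8 + 4 * n%:R * s ^+ 2 * n%:R.
have K0 : 0 < K by rewrite ltr_pwDl// mulr_ge0// mulr_ge0 ?sqr_ge0// mulr_ge0.
have [phi tphi hphi] := happ (e / K) (divr_gt0 e0 K0).
have L2phi := test_function_L2 tphi.
have L2dphi i := test_function_L2 (test_function_partial i tphi).
have L2w : L2 mu (fun x => u x - phi x) by exact: L2B.
have [L [M [L0 M0 hM hL]]] := test_function_bounded tphi.
have [M' hM'] : exists M', forall i x, `|partial i phi x| <= M'.
  have hb i : exists M', forall x, `|partial i phi x| <= M'.
    by have [_ [M' [_ _ ? _]]] := test_function_bounded (test_function_partial i tphi); exists M'.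
  pose b i := projT1 (cid (hb i)).
  exists (\sum_i `|b i|) => i x; apply: (@le_trans _ _ (b i)).
    by rewrite /b; case: cid => ? /=; exact.
  rewrite (bigD1 i)//= (le_trans (ler_norm _))// lerDl.
  by apply: sumr_ge0 => j _; exact: normr_ge0.
have [sphi _ _] := tphi.
have b1 := sqnorm_shift_vec_le h sphi L2dphi hM' hL L2phi.
have b2 : sqnorm mu (fun x => u (h + x) - u x) <=
    2 * sqnorm mu (fun x => phi (h + x) - phi x) + 2 * (2 * sqnorm mu (fun x => u x - phi x) + 2 * sqnorm mu (fun x => u x - phi x)).
  have -> : (fun x => u (h + x) - u x) =
    (fun x => (phi (h + x) - phi x) + ((u (h + x) - phi (h + x)) - (u x - phi x))).
    by apply/funext => x; ring.
  have L2s : L2 mu (fun x => u (h + x) - phi (h + x)).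
    exact: (L2_shift h L2w).
  apply: le_trans (sqnormD_le _ _) _; first by apply: L2B => //; exact: L2_shift.
    exact: L2B.
  rewrite lerD2l; apply: ler_wpM2l => //.
  have -> : (fun x => (u (h + x) - phi (h + x)) - (u x - phi x)) =
     (fun x => (u (h + x) - phi (h + x)) + (-1) * (u x - phi x)).
    by apply/funext => x; ring.
  apply: le_trans (sqnormD_le _ _) _ => //; first exact: L2Z.
  rewrite sqnormZ// (sqnorm_shift h L2w); lra.
have b3 : \sum_(i < n) h ord0 i ^+ 2 * sqnorm mu (partial i phi) <=
    \sum_(i < n) s ^+ 2 * (2 * sqnorm mu (G i) + 2 * h1dist u G phi).
  apply: ler_sum => i _; apply: ler_pM; rewrite ?sqr_ge0 ?sqnorm_ge0//.
    rewrite -(real_normK (num_real (h ord0 i))) lerXn2r ?nnegrE//.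
    exact: le_trans (hs i).
  have -> : sqnorm mu (partial i phi) = sqnorm mu (fun x => G i x + (-1) * (G i x - partial i phi x)).
    by congr (sqnorm mu _); apply/funext => x; ring.
  apply: le_trans (sqnormD_le _ _) _ => //; first by apply: L2Z; exact: L2B.
  rewrite lerD2l; apply: ler_wpM2l => //; rewrite sqnormZ; last exact: L2B.
  by rewrite sqrrN expr1n mul1r; exact: sqnorm_partial_h1dist.
have b4 := sqnorm_h1dist u G phi.
have E : \sum_(i < n) s ^+ 2 * (2 * sqnorm mu (G i) + 2 * h1dist u G phi) =
   2 * (s ^+ 2 * \sum_(i < n) sqnorm mu (G i)) + 2 * (s ^+ 2 * n%:R * h1dist u G phi).
  rewrite -mulr_sumr big_split /= -mulr_sumr sumr_const card_ord -[_ *+ n]mulr_natl; ring.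
have n0 : 0 <= n%:R :> R by [].
have b5 : n%:R * \sum_(i < n) h ord0 i ^+ 2 * sqnorm mu (partial i phi) <=
   n%:R * (2 * (s ^+ 2 * \sum_(i < n) sqnorm mu (G i)) + 2 * (s ^+ 2 * n%:R * h1dist u G phi)).
  by rewrite -E; exact: ler_wpM2l.
move: hphi; rewrite ler_pdivlMr// /K => hphi.
move: b1 b2 b4 b5 hphi.
set N1 := sqnorm _ _; set N2 := sqnorm _ _; set N3 := sqnorm _ _; set S1 := \sum_(i < n) _; set S2 := \sum_(i < n) _.
set H := h1dist _ _ _ => b1 b2 b4 b5 hphi.
have -> : 4 * n%:R * s ^+ 2 * S2 = 2 * (n%:R * (2 * (s ^+ 2 * S2))) by ring.
have := b5; rewrite mulrDr => b6.
have e1 : n%:R * (2 * (s ^+ 2 * n%:R * H)) * 2 + 8 * H <= e.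
  by apply: le_trans hphi; rewrite le_eqVlt; apply/orP; left; apply/eqP; ring.
lra.
Qed.

(** By Tonelli, integrate in x first: for each h in the cube the translation bound applies, and the
    cube has measure s^n. *)
Lemma integral_shift_kernel A u G (s : R) : h10 A u G -> 0 < s ->
  (\int[mu]_x \int[mu]_h (\1_(box (fun=> `[0, s]%classic : set R)) h * (u (h + x) - u x) ^+ 2)%:E <=
   (s ^+ n * (4 * n%:R * s ^+ 2 * \sum_(i < n) sqnorm mu (G i)))%:E)%E.
Proof.
move=> hu s0; have [L2u L2G _ _] := hu; have [mmu _] := L2u.
set K : set 'rV[R]_n := box _.
have mK : measurable K by apply: measurable_box.
pose f (p : 'rV[R]_n * 'rV[R]_n) : \bar R := (\1_K p.2 * (u (p.2 + p.1) - u p.1) ^+ 2)%:E.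
have mf : measurable_fun setT f.
  apply/measurable_EFinP; apply: measurable_funM.
    by apply: (measurableT_comp (f := \1_K : _ -> R)) => //; exact: measurable_snd.
  apply: measurable_funX; apply: measurable_funB; last first.
    by apply: measurableT_comp mmu _; exact: measurable_fst.
  apply: (measurableT_comp mmu); apply: measurable_fun_rowP => i.
  under eq_fun do rewrite mxE.
  by apply: measurable_funD; apply: (measurableT_comp (measurable_coord i));
    [exact: measurable_snd|exact: measurable_fst].
have f0 p : (0 <= f p)%E by rewrite lee_fin mulr_ge0// sqr_ge0.
rewrite (fubini_tonelli f mf f0) /f /=.
set C := 4 * n%:R * s ^+ 2 * _.
have C0 : 0 <= C.
  apply: mulr_ge0; first by rewrite mulr_ge0 ?sqr_ge0// mulr_ge0.
  by apply: sumr_ge0 => i _; exact: sqnorm_ge0.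
apply: (@le_trans _ _ (\int[mu]_h (C%:E * (\1_K h)%:E))%E); last first.
  rewrite ge0_integralZl_EFin//; last first.
    by apply/measurable_EFinP.
  have := @lebesgue_row_cube R n (fun=> 0) s true false (ltW s0).
  rewrite /= add0r => KE; rewrite integral_indic// setIT.
  by rewrite [X in (_ * X)%E](_ : _ = (s ^+ n)%:E) -?EFinM ?[C * _]mulrC//; exact: KE.
apply: ge0_le_integral => //.
- by move=> h _; apply: integral_ge0 => x _; exact: (f0 (x, h)).
- exact: (measurable_fun_fubini_tonelli_G f mf f0).
- by apply: measurable_funeM; exact/measurable_EFinP.
move=> h _; rewrite indicE; have [hK|hK] := boolP (h \in K); last first.
  by under eq_integral do rewrite mul0r; rewrite integral0 mule0.
under eq_integral do rewrite mul1r.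
have L2d : L2 mu (fun x => u (h + x) - u x) by apply: L2B => //; exact: L2_shift.
rewrite mule1 -EFin_Rintegral; last by case: L2d.
rewrite lee_fin; apply: (sqnorm_shift_h10_le hu).
move: hK; rewrite inE => hK i; have := hK i.
by rewrite /= in_itv /= => /andP[h0 hs]; rewrite ger0_norm.
Qed.

(** If many normalized disjoint functions had small energy, each would be close to its averages at
    scale [s]; but by Bessel the squares of these averages have a sum bounded at each point
    independently of the number of functions. *)
Lemma admissible_lower A (I : finType) (e V s : R) : measurable A -> mu A = V%:E ->
  0 < s -> admissible A I e ->
  #|I|%:R <= 8 * n%:R * s ^+ 2 * e + 2 * V * (s ^+ n)^-1.
Proof.
move=> mA AV s0 [u [G [hu du nu hE]]].
pose K : set 'rV[R]_n := box (fun=> `[0, s]%classic : set R).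
have mK : measurable K by apply: measurable_box.
have sn0 : 0 < s ^+ n by rewrite exprn_gt0.
have L2u j : L2 mu (u j) by case: (hu j).
have KE' : mu K = (s ^+ n)%:E.
  by have := @lebesgue_row_cube R n (fun=> 0) s true false (ltW s0); rewrite /= add0r.
have fK : (mu K < +oo)%E by rewrite KE' ltry.
have iK : integrableR mu (\1_K : _ -> R) by exact: integrableR_indic mK fK.
have sqK h : (\1_K h : R) ^+ 2 = \1_K h by rewrite indicE; case: (h \in K); rewrite ?expr1n// expr0n.
have L2K : L2 mu (\1_K : _ -> R).
  by split => //; under eq_fun do rewrite sqK.
have nK : sqnorm mu (\1_K : _ -> R) = s ^+ n.
  rewrite /sqnorm; under eq_Rintegral do rewrite sqK.
  by apply: EFin_inj; rewrite EFin_Rintegral// integral_indic// setIT; exact: KE'.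
pose c j x := \int[mu]_h (\1_K h * u j (h + x)).
(* Bessel for the indicator of x + [0, s]^n, whose squared norm is s^n and whose product with [u j]
   is [c j x]. *)
have hc x : \sum_j c j x ^+ 2 <= s ^+ n.
  rewrite -nK -(sqnorm_shift (- x) L2K).
  have := bessel (L2_shift (- x) L2K) L2u nu du.
  rewrite (eq_bigr (fun j => c j x ^+ 2))// => j _; congr (_ ^+ 2).
  have hi := L2_mul (L2_shift (- x) L2K) (L2u j).
  rewrite /dot -(integrableR_shift x hi).2 /c; apply: eq_Rintegral => h _.
  by rewrite addrA addNr add0r addrC.
pose F j x : \bar R := (\int[mu]_h (\1_K h * (u j (h + x) - u j x) ^+ 2)%:E)%E.
(* The pointwise inequality to be integrated. Outside [A] its left-hand side vanishes, so the Bessel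
   term is only counted on [A] and contributes the volume V. *)
have pt x : (((s ^+ n) * \sum_j u j x ^+ 2)%:E <= 2%:E * \sum_j F j x + 2%:E * (\1_A x)%:E)%E.
  have [Ax|nAx] := pselect (A x); last first.
    rewrite [X in (X%:E <= _)%E](_ : _ = 0); last first.
      rewrite big1 ?mulr0// => j _; have [_ _ h _] := hu j.
      by rewrite (h x nAx).1 expr0n.
    rewrite adde_ge0// mule_ge0//.
    by apply: sume_ge0 => j _; apply: integral_ge0 => h _; rewrite lee_fin mulr_ge0// sqr_ge0.
  have L2s j : L2 mu (fun h => u j (h + x)).
    by under eq_fun do rewrite addrC; exact: L2_shift.
  have iKu j : integrableR mu (fun h => \1_K h * u j (h + x)) by exact: L2_mul.
  have iKuu j : integrableR mu (fun h => \1_K h * (u j (h + x) - u j x) ^+ 2).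
    apply: (@integrableR_le _ _ _ _ _ (fun h : 'rV[R]_n => 2 * u j (h + x) ^+ 2 + 2 * u j x ^+ 2 * \1_K h)).
    - apply: measurable_funM => //; apply: measurable_funX; apply: measurable_funB => //.
      by case: (L2s j).
    - apply: integrableRD; first by apply: integrableRZ; case: (L2s j).
      exact: integrableRZ.
    - move=> h; rewrite indicE; case: (h \in K) => /=.
        rewrite mul1r mulr1 ger0_norm ?sqr_ge0//.
        have := sqr_ge0 (u j (h + x) + u j x); nra.
      by rewrite mul0r mulr0 addr0 normr0 mulr_ge0// sqr_ge0.
  have FE j : F j x = (\int[mu]_h (\1_K h * (u j (h + x) - u j x) ^+ 2))%:E.
    by rewrite EFin_Rintegral.
  rewrite [X in (_ <= _ * X + _)%E](eq_bigr _ (fun j _ => FE j)).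
  rewrite sumEFin indicE mem_set// -!EFinM -EFinD lee_fin mulr1.
  have key j : s ^+ n * u j x ^+ 2 <=
      2 * \int[mu]_h (\1_K h * (u j (h + x) - u j x) ^+ 2) + 2 * ((s ^+ n)^-1 * c j x ^+ 2).
    set a := u j x; pose b := (s ^+ n)^-1 * c j x.
    have i1 : integrableR mu (fun h => a ^+ 2 * \1_K h) by exact: integrableRZ.
    have i2 : integrableR mu (fun h => 2 * (\1_K h * (u j (h + x) - a) ^+ 2) +
        (4 * (a - b) * (\1_K h * u j (h + x)) + (2 * b ^+ 2 - 4 * (a - b) * b) * \1_K h)).
      by apply: integrableRD; [exact: integrableRZ|apply: integrableRD; exact: integrableRZ].
    (* With b the mean of w = u(h + x) over the cube, the term 4(a - b)(w - b) has integral 0. What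
       is left is a^2 s^n <= 2 int (w - a)^2 + 2 b^2 s^n, and adding that term makes the inequality
       hold pointwise. *)
    have : \int[mu]_h (a ^+ 2 * \1_K h) <= \int[mu]_h (2 * (\1_K h * (u j (h + x) - a) ^+ 2) +
        (4 * (a - b) * (\1_K h * u j (h + x)) + (2 * b ^+ 2 - 4 * (a - b) * b) * \1_K h)).
      apply: le_Rintegral_setT => // h; rewrite indicE; case: (h \in K) => /=; last by lra.
      set w := u j (h + x).
      have -> : 2 * (1 * (w - a) ^+ 2) + (4 * (a - b) * (1 * w) + (2 * b ^+ 2 - 4 * (a - b) * b) * 1) =
         a ^+ 2 + ((a - 2 * b) ^+ 2 + 2 * (w - b) ^+ 2) by ring.
      by rewrite mulr1 lerDl addr_ge0 ?sqr_ge0// mulr_ge0 ?sqr_ge0.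
    have EK : \int[mu]_h (\1_K h : R) = s ^+ n by apply: EFin_inj; rewrite EFin_Rintegral// integral_indic// setIT; exact: KE'.
    have Z1 : \int[mu]_h (a ^+ 2 * \1_K h) = a ^+ 2 * s ^+ n by rewrite RintegralZl// EK.
    have Z2 : \int[mu]_h (2 * (\1_K h * (u j (h + x) - a) ^+ 2)) =
        2 * \int[mu]_h (\1_K h * (u j (h + x) - a) ^+ 2).
      by rewrite RintegralZl//; exact: iKuu.
    have Z3 : \int[mu]_h (4 * (a - b) * (\1_K h * u j (h + x))) = 4 * (a - b) * c j x.
      by rewrite RintegralZl//; exact: iKu.
    have Z4 : \int[mu]_h ((2 * b ^+ 2 - 4 * (a - b) * b) * \1_K h) =
        (2 * b ^+ 2 - 4 * (a - b) * b) * s ^+ n by rewrite RintegralZl// EK.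
    rewrite RintegralD//; [|exact: integrableRZ|by apply: integrableRD; exact: integrableRZ].
    rewrite RintegralD//; [|exact: integrableRZ|exact: integrableRZ].
    rewrite Z1 Z2 Z3 Z4.
    have cb : c j x = s ^+ n * b by rewrite /b mulrA mulfV ?mul1r// gt_eqF.
    have -> : (s ^+ n)^-1 * c j x ^+ 2 = s ^+ n * b ^+ 2.
      by rewrite cb; field; rewrite gt_eqF.
    rewrite cb; set P := \int[mu]_h _; set S := s ^+ n => hh.
    rewrite mulrC; apply: le_trans hh _.
    by rewrite le_eqVlt; apply/orP; left; apply/eqP; ring.
  rewrite mulr_sumr; apply: le_trans (ler_sum _ (fun j _ => key j)) _.
  rewrite big_split /= -!mulr_sumr lerD2l; apply: ler_piMr => //.
  by rewrite mulrC ler_pdivrMr// mul1r.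
have mF j : measurable_fun setT (F j).
  have [mu_j _] := L2u j.
  pose f (p : 'rV[R]_n * 'rV[R]_n) : \bar R := (\1_K p.2 * (u j (p.2 + p.1) - u j p.1) ^+ 2)%:E.
  have mf : measurable_fun setT f.
    apply/measurable_EFinP; apply: measurable_funM.
      by apply: (measurableT_comp (f := \1_K : _ -> R)) => //; exact: measurable_snd.
    apply: measurable_funX; apply: measurable_funB; last first.
      by apply: measurableT_comp mu_j _; exact: measurable_fst.
    apply: (measurableT_comp mu_j); apply: measurable_fun_rowP => i.
    under eq_fun do rewrite mxE.
    by apply: measurable_funD; apply: (measurableT_comp (measurable_coord i));
      [exact: measurable_snd|exact: measurable_fst].
  have f0 p : (0 <= f p)%E by rewrite lee_fin mulr_ge0// sqr_ge0.
  exact: (measurable_fun_fubini_tonelli_F f mf f0).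
have F0 j x : (0 <= F j x)%E.
  by apply: integral_ge0 => h _; rewrite lee_fin mulr_ge0// sqr_ge0.
have iu : integrableR mu (fun x => s ^+ n * \sum_j u j x ^+ 2).
  by apply: integrableRZ; apply: integrableR_sum => j; case: (L2u j).
have lhs : (\int[mu]_x ((s ^+ n) * \sum_j u j x ^+ 2)%:E = (s ^+ n * #|I|%:R)%:E)%E.
  rewrite -EFin_Rintegral//; congr EFin; rewrite RintegralZl//; last by apply: integrableR_sum => j; case: (L2u j).
  rewrite Rintegral_sum => [|j]; last by case: (L2u j).
  by rewrite (eq_bigr (fun=> 1)) ?sumr_const// => j _; exact: nu.
have mS : measurable_fun setT (fun x => \sum_j F j x)%E by exact: emeasurable_sum.
have S0 x : (0 <= \sum_j F j x)%E by apply: sume_ge0 => j _.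
have m1A : measurable_fun setT (fun x => (\1_A x : R)%:E) by apply/measurable_EFinP.
have : (\int[mu]_x ((s ^+ n) * \sum_j u j x ^+ 2)%:E <=
    \int[mu]_x (2%:E * \sum_j F j x + 2%:E * (\1_A x)%:E))%E.
  apply: ge0_le_integral => //.
  - move=> x _; rewrite lee_fin; apply: mulr_ge0; first exact: ltW.
    by apply: sumr_ge0 => j _; exact: sqr_ge0.
  - by case/integrableP: iu.
  - by apply: emeasurable_funD; apply: measurable_funeM.
have e1 : (\int[mu]_x (2%:E * \sum_j F j x + 2%:E * (\1_A x)%:E) =
    \int[mu]_x (2%:E * \sum_j F j x) + \int[mu]_x (2%:E * (\1_A x)%:E))%E.
  apply: ge0_integralD => //.
  - by move=> x _; exact: mule_ge0.
  - exact: measurable_funeM.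
  - exact: measurable_funeM.
have e2 : (\int[mu]_x (2%:E * \sum_j F j x) = 2%:E * \int[mu]_x \sum_j F j x)%E.
  by apply: ge0_integralZl_EFin.
have e3 : (\int[mu]_x (2%:E * (\1_A x)%:E) = 2%:E * V%:E)%E.
  rewrite ge0_integralZl_EFin//.
  by rewrite integral_indic// setIT; congr (_ * _)%E; exact: AV.
rewrite lhs e1 e2 e3.
rewrite ge0_integral_sum//.
move=> H.
have : ((s ^+ n * #|I|%:R)%:E <= 2%:E * (\sum_j (s ^+ n * (4 * n%:R * s ^+ 2 * \sum_(i < n) sqnorm mu (G j i)))%:E) + 2%:E * V%:E)%E.
  apply: le_trans H _; apply: leeD => //; apply: lee_wpmul2l => //.
  by apply: lee_sum => j _; exact: (integral_shift_kernel (hu j) s0).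
rewrite sumEFin -!EFinM -EFinD lee_fin -!mulr_sumr => H2.
have H3 : s ^+ n * #|I|%:R <= s ^+ n * (8 * n%:R * s ^+ 2 * e + 2 * V * (s ^+ n)^-1).
  apply: le_trans H2 _.
  have -> : s ^+ n * (8 * n%:R * s ^+ 2 * e + 2 * V * (s ^+ n)^-1) =
     2 * (s ^+ n * (4 * n%:R * s ^+ 2 * e)) + 2 * V.
    by field; rewrite gt_eqF.
  rewrite lerD2r; apply: ler_wpM2l => //; apply: ler_wpM2l; first exact: ltW.
  by apply: ler_wpM2l => //; rewrite mulr_ge0 ?sqr_ge0// mulr_ge0.
by rewrite ler_pM2l in H3.
Qed.

End lower_bound.

(** * A bump function *)

Section flat.
Context {R : realType}.
Implicit Types (t : R) (k : nat).

Definition flat k t : R := if 0 < t then t^-1 ^+ k * expR (- t^-1) else 0.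

(** This is y/(k+1) <= exp(y/(k+1)) raised to the power k+1. *)
Lemma pow_expRN_le k (y : R) : 0 < y -> y ^+ k.+1 * expR (- y) <= k.+1%:R ^+ k.+1.
Proof.
move=> y0; rewrite expRN ler_pdivrMr ?expR_gt0//.
have -> : expR y = expR (y / k.+1%:R) ^+ k.+1.
  by rewrite -expRM_natl mulrC divfK// pnatr_eq0.
rewrite -exprMn; apply: lerXn2r; [by rewrite nnegrE ltW|by rewrite nnegrE mulr_ge0// expR_ge0|].
rewrite -ler_pdivrMl ?ltr0n// mulrC.
by apply: le_trans (expR_ge1Dx _); rewrite lerDr.
Qed.

(* The family [flat] is stable under derivation, up to linear combinations. *)
Lemma is_derive_flat k t :
  is_derive t 1 (flat k) (- (k%:R) * flat k.+1 t + flat k.+2 t).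
Proof.
have [t0|t0|->] := ltgtP t 0.
- have -> : - (k%:R) * flat k.+1 t + flat k.+2 t = 0.
    by rewrite /flat ltNge ltW// mulr0 addr0.
  apply: (near_eq_is_derive _ (is_derive_cst (0 : R) t 1)).
  near=> z; rewrite /flat ltNge ltW//.
  by near: z; exact: lt_nbhsl.
- have tn0 : t != 0 by rewrite gt_eqF.
  apply: (@near_eq_is_derive _ _ _ (fun t => t^-1 ^+ k * expR (- t^-1))).
    near=> z; rewrite /flat ifT//.
    by near: z; exact: lt_nbhsr.
  have hV : is_derive t 1 (fun t : R => t^-1) (- t ^- 2).
    have := @is_deriveV R id t 1 1 tn0 (is_derive_id _ _).
    by rewrite /GRing.scale /= mulr1.
  have hX : is_derive t 1 (fun t : R => t^-1 ^+ k) (k%:R * t^-1 ^+ k.-1 * (- t ^- 2)).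
    have := @is_deriveX R R (fun t : R => t^-1) k t 1 _ hV.
    by rewrite exprfctE /GRing.scale /=.
  have hN : is_derive t 1 (fun t : R => - t^-1) (t ^- 2).
    by have := is_deriveN hV; rewrite opprK.
  have hE : is_derive t 1 (fun t : R => expR (- t^-1)) (expR (- t^-1) * t ^- 2).
    exact: (is_derive1_comp (is_derive_expR _) hN).
  have h := is_deriveM hX hE.
  apply: (is_derive_eq h); rewrite /GRing.scale /= /flat t0 -exprVn.
  case: k {hX h} => [|k] /=; first by rewrite !mul0r oppr0 mul0r mulr0 addr0 add0r !expr0; ring.
  by rewrite !exprS; ring.
- have -> : - (k%:R) * flat k.+1 0 + flat k.+2 0 = 0 :> R.
    by rewrite /flat ltxx mulr0 addr0.
  have hc : (fun h : R => h^-1 *: ((flat k \o shift 0) (h *: 1) - flat k 0)) @ 0^' --> (0 : R).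
    (* For h > 0 the quotient at 0 is h^-(k+1) exp(-1/h), that is h times h^-(k+2) exp(-1/h), and
       the latter is at most [C]. *)
    pose C : R := k.+2%:R ^+ k.+2.
    have b (h : R) : h != 0 -> `|h^-1 *: ((flat k \o shift 0) (h *: 1) - flat k 0)| <= C * `|h|.
      move=> hn0; rewrite /= addr0 /GRing.scale /= mulr1 /flat ltxx subr0.
      case: ifPn => h0; last by rewrite mulr0 normr0 mulr_ge0// exprn_ge0.
      rewrite !gtr0_norm ?mulr_gt0 ?invr_gt0 ?exprn_gt0 ?expR_gt0 ?invr_gt0//.
      have := @pow_expRN_le k.+1 h^-1; rewrite invr_gt0 => /(_ h0).
      rewrite -(ler_pM2r h0); apply: le_trans; rewrite le_eqVlt; apply/orP; left; apply/eqP.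
      by rewrite !exprS; field.
    apply/cvgr0Pnorm_le => e e0.
    have C0 : 0 < C by rewrite exprn_gt0// ltr0n.
    near=> h; apply: le_trans (b h _) _; first by near: h; exact: nbhs_dnbhs_neq.
    rewrite mulrC -ler_pdivlMr//; near: h; apply: dnbhs0_le.
    exact: divr_gt0.
  split; first by apply/cvg_ex; exists 0.
  exact: cvg_lim.
Unshelve. all: by end_near. Qed.

Lemma flat_gt0 k t : (0 < flat k t) = (0 < t).
Proof.
rewrite /flat; case: ifPn => [t0|]; last by rewrite ltxx => /negbTE.
by rewrite mulr_gt0 ?expR_gt0 ?exprn_gt0 ?invr_gt0.
Qed.

Lemma flat_eq0 k t : (flat k t == 0) = (t <= 0).
Proof.
rewrite leNgt -(flat_gt0 k) /flat; case: ifPn => t0; last by rewrite eqxx ltxx.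
by rewrite gt_eqF ?mulr_gt0 ?expR_gt0 ?exprn_gt0 ?invr_gt0.
Qed.

End flat.

Section bump.
Context {R : realType} (n : nat).
Local Notation mu := (@lebesgue_row R n).
Local Notation e_ i := (delta_mx ord0 i : 'rV[R]_n).

(** The class to which [smoothE] applies: the derivative of a generator is a combination of
    generators, and the product rule stays inside the algebra. *)
Inductive flat_alg : ('rV[R]_n -> R) -> Prop :=
| flat_alg_base k i (a b : R) : flat_alg (fun x => flat k (a + b * x ord0 i))
| flat_alg_cst (c : R) : flat_alg (fun=> c)
| flat_alg_add f g : flat_alg f -> flat_alg g -> flat_alg (fun x => f x + g x)
| flat_alg_mul f g : flat_alg f -> flat_alg g -> flat_alg (fun x => f x * g x).

Lemma is_derive_flat_coord k i j (a b : R) (x : 'rV[R]_n) :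
  is_derive x (e_ j) (fun x : 'rV[R]_n => flat k (a + b * x ord0 i))
    (b * (j == i)%:R * (- (k%:R) * flat k.+1 (a + b * x ord0 i) + flat k.+2 (a + b * x ord0 i))).
Proof.
have xE : x = 0 *: e_ j + x by rewrite scale0r add0r.
rewrite {1}xE; apply/is_derive_line.
have -> : (fun s : R => flat k (a + b * (s *: e_ j + x) ord0 i)) =
  flat k \o (fun s : R => (a + b * x ord0 i) + (b * (j == i)%:R) *: s).
  apply/funext => s /=; rewrite !mxE eqxx /= [i == j]eq_sym /GRing.scale /=; congr flat; ring.
have h1 : is_derive (0 : R) 1 (fun s : R => (a + b * x ord0 i) + (b * (j == i)%:R) *: s) (b * (j == i)%:R).
  have h2 : is_derive (0 : R) 1 (fun s : R => (b * (j == i)%:R) *: s) (b * (j == i)%:R).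
    have := @is_deriveZ R R R id (b * (j == i)%:R) 0 1 1 (is_derive_id _ _).
    by rewrite /GRing.scale /= mulr1.
  have h3 := @is_derive_cst R R R (a + b * x ord0 i) 0 1.
  have := is_deriveD h3 h2; by rewrite add0r.
have h0 : is_derive ((a + b * x ord0 i) + (b * (j == i)%:R) *: (0 : R)) 1 (flat k)
  (- (k%:R) * flat k.+1 (a + b * x ord0 i) + flat k.+2 (a + b * x ord0 i)).
  by rewrite scaler0 addr0; exact: is_derive_flat.
have := @is_derive1_comp R (flat k) (fun s : R => (a + b * x ord0 i) + (b * (j == i)%:R) *: s) 0 _ _ h0 h1.
by rewrite [X in is_derive _ _ _ X]mulrC.
Qed.

Lemma smooth_flat_alg f : flat_alg f -> smooth f.
Proof.
move=> hf; apply: smoothE; exists flat_alg => // g; elim => {f hf g}.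
- move=> k i a b; split.
    move=> x.
    have cflat : continuous (@flat R k).
      by move=> t; apply: differentiable_continuous; apply/derivable1_diffP; case: (is_derive_flat k t).
    apply: (@continuous_comp _ _ _ (fun x : 'rV[R]_n => a + b * x ord0 i) (flat k)); last exact: cflat.
    exact: (cvgD (cvg_cst a) (cvgM (cvg_cst b) (@coord_continuous R 1 n ord0 i x))).
  move=> j; exists (fun x => b * (j == i)%:R * (- (k%:R) * flat k.+1 (a + b * x ord0 i) + flat k.+2 (a + b * x ord0 i))).
    apply: flat_alg_mul; first exact: flat_alg_cst.
    apply: flat_alg_add; last exact: flat_alg_base.
    by apply: flat_alg_mul; [exact: flat_alg_cst|exact: flat_alg_base].
  by move=> x; exact: is_derive_flat_coord.
- move=> c; split; first by move=> x; exact: cst_continuous.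
  by move=> j; exists (fun=> 0); [exact: flat_alg_cst|move=> x; exact: is_derive_cst].
- move=> f g hf [cf df] hg [cg dg]; split; first by move=> x; exact: (cvgD (cf x) (cg x)).
  move=> i; have [f' hf' ff'] := df i; have [g' hg' gg'] := dg i.
  exists (fun x => f' x + g' x); first exact: flat_alg_add.
  by move=> x; exact: (is_deriveD (ff' x) (gg' x)).
- move=> f g hf [cf df] hg [cg dg]; split; first by move=> x; exact: (cvgM (cf x) (cg x)).
  move=> i; have [f' hf' ff'] := df i; have [g' hg' gg'] := dg i.
  exists (fun x => f x * g' x + g x * f' x).
    by apply: flat_alg_add; exact: flat_alg_mul.
  by move=> x; exact: (is_deriveM (ff' x) (gg' x)).
Qed.

(** Positive exactly on ]1/4, 3/4[^n, so that its closed support lies inside the open unit cube. The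
    arguments are written a + b x_i to be generators of [flat_alg]. *)
Definition bump (x : 'rV[R]_n) : R :=
  \prod_(i < n) (flat 0 (- 4^-1 + 1 * x ord0 i) * flat 0 (3 / 4 + (- 1) * x ord0 i)).

Lemma smooth_bump : smooth bump.
Proof.
apply: smooth_flat_alg; rewrite /bump.
elim: (index_enum _) => [|i s IH].
  by under eq_fun do rewrite big_nil; exact: flat_alg_cst.
under eq_fun do rewrite big_cons.
by apply: flat_alg_mul => //; apply: flat_alg_mul; exact: flat_alg_base.
Qed.

Lemma bump_neq0 x : bump x != 0 <-> box (fun=> `]4^-1, (3 / 4)[%classic : set R) x.
Proof.
split.
  move=> /prodf_neq0 h i; have := h i isT; rewrite mulf_eq0 negb_or !flat_eq0 -!ltNge /= in_itv /= => /andP[h1 h2].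
  by apply/andP; split; lra.
move=> h; apply/prodf_neq0 => i _; have := h i; rewrite mulf_eq0 negb_or !flat_eq0 -!ltNge /= in_itv /= => /andP[h1 h2].
by apply/andP; split; lra.
Qed.

Definition unit_cube : set 'rV[R]_n := box (fun=> `]0, 1[%classic : set R).

Lemma test_function_bump : test_function unit_cube bump.
Proof.
pose B : set 'rV[R]_n := box (fun=> `[4^-1, (3 / 4)]%classic : set R).
have cB : compact B by apply: (@rV_compact _ _ (fun=> `[(4^-1 : R), (3 / 4)]%classic)) => i; exact: segment_compact.
have clB : closed B by apply: compact_closed => //; exact: norm_hausdorff.
have sub : closure [set x | bump x != 0] `<=` B.
  apply: subset_trans clB; apply: closure_subset => x /bump_neq0 h i.
  by have := h i; rewrite /= !in_itv /= => /andP[/ltW -> /ltW ->].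
split; first exact: smooth_bump.
  by apply: subclosed_compact cB sub; exact: closed_closure.
apply: subset_trans sub _ => x h i; have := h i.
by rewrite /= !in_itv /= => /andP[h1 h2]; apply/andP; split; lra.
Qed.

(** Otherwise [bump] would vanish almost everywhere, although it is nonzero on a cube of measure
    2^-n. *)
Lemma sqnorm_bump_gt0 : 0 < sqnorm mu bump.
Proof.
rewrite lt_neqAle sqnorm_ge0 andbT; apply/eqP => h0.
have [mb ib] := test_function_L2 test_function_bump.
have : (\int[mu]_x `|(bump x ^+ 2)%:E| = 0)%E.
  under eq_integral do rewrite abse_EFin ger0_norm ?sqr_ge0//.
  by rewrite -EFin_Rintegral// -/(sqnorm mu bump) -h0.
move=> /(ae_eq_integral_abs mu measurableT) H.
have : ae_eq mu setT (fun x => (bump x ^+ 2)%:E) (cst 0%E).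
  by apply: H; apply/measurable_EFinP; exact: measurable_funX.
move=> [N [mN N0 hN]].
pose B : set 'rV[R]_n := box (fun=> `]4^-1, (3 / 4)[%classic : set R).
have mB : measurable B by apply: measurable_box.
have BN : B `<=` N.
  move=> x Bx; apply: hN => /= /(_ I) => -[]/eqP.
  by rewrite expf_eq0 /= => /eqP; apply/eqP/bump_neq0.
have : (mu B <= 0)%E by rewrite -N0; apply: le_measure; rewrite ?inE.
have := @lebesgue_row_cube R n (fun=> 4^-1) (1 / 2) false true.
have -> : 4^-1 + 1 / 2 = 3 / 4 :> R by lra.
move=> -> //; by rewrite lee_fin leNgt exprn_gt0//.
Qed.

(** Ensures that the infimum defining the limit constant is over a nonempty set; the family is the
    normalized [bump] alone. *)
Lemma admissible_unit_cube : exists e : R, admissible unit_cube 'I_1 e.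
Proof.
have tb := test_function_bump; have L2b := test_function_L2 tb.
have b0 := sqnorm_bump_gt0.
pose c := (Num.sqrt (sqnorm mu bump))^-1.
have tc : test_function unit_cube (fun x => c * bump x).
  have := @test_function_aff R n unit_cube bump 1 0 c (oner_neq0 _) tb.
  have -> : aff 1 (0 : 'rV[R]_n) = id by apply/funext => x; rewrite aff1E add0r.
  by [].
have L2c := test_function_L2 tc.
have L2dc i := test_function_L2 (test_function_partial i tc).
exists (\sum_(j < 1) \sum_(i < n) sqnorm mu (partial i (fun x => c * bump x))).
exists (fun=> (fun x => c * bump x)), (fun _ i => partial i (fun x => c * bump x)); split => //.
- move=> j; split => //.
    move=> x nx; split; first exact: test_function_out tc nx.
    by move=> i; exact: test_function_out (test_function_partial i tc) nx.
  move=> e e0; exists (fun x => c * bump x) => //.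
  have z (f : 'rV[R]_n -> R) : sqnorm mu (fun x => f x - f x) = 0.
    by rewrite /sqnorm; under eq_Rintegral do rewrite subrr expr0n; rewrite Rintegral_cst// mul0r.
  by rewrite /h1dist z add0r big1 ?ltW.
- by move=> j l; rewrite !ord1 eqxx.
- move=> j; rewrite sqnormZ// /c exprVn sqr_sqrtr ?ltW// mulVf// gt_eqF//.
Qed.

End bump.

(** * Packing by cubes and negligible boundaries *)

Lemma measure_bigsetU_le d (T : measurableType d) (R : realType)
    (mu : {measure set T -> \bar R}) (I : eqType) (s : seq I) (F : I -> set T) :
  (forall i, measurable (F i)) ->
  (mu (\big[setU/set0]_(i <- s) F i) <= \sum_(i <- s) mu (F i))%E.
Proof.
move=> mF; elim: s => [|i s IH]; first by rewrite !big_nil measure0.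
rewrite !big_cons; apply: le_trans (measureU2 _ _ _) _ => //.
  by apply: bigsetU_measurable.
exact: leeD2l.
Qed.

Section packing.
Context {R : realType} (n : nat).
Local Notation mu := (@lebesgue_row R n).
Local Notation cube := (@unit_cube R n).
Implicit Types (A : set 'rV[R]_n).

(** Half-open, so that its integer translates tile the space. The open cubes inside the cells then
    carry the functions. *)
Let hcube : set 'rV[R]_n := box (fun=> `[0, 1[%classic : set R).

Let cell_diam (r : R) (x y : 'rV[R]_n) (k : R) a : 0 < k -> k^-1 <= r ->
  hcube (aff k a x) -> hcube (aff k a y) -> forall i, `|x ord0 i - y ord0 i| < r.
Proof.
move=> k0 kr hx hy i; apply: lt_le_trans kr.
have := hx i; have := hy i; rewrite /aff /= !in_itv !mxE /= => /andP[h1 h2] /andP[h3 h4].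
rewrite -[ltRHS]mul1r ltr_pdivlMr// -[X in _ * X](gtr0_norm k0) -normrM ltr_norml.
by apply/andP; split; lra.
Qed.

(** The cell of [z] is defined by z_i < k x_i + L < z_i + 1; the offset [L] makes the indices
    natural numbers. *)
Definition grid_shift (L M : nat) (z : {ffun 'I_n -> 'I_M}) : 'rV[R]_n :=
  \row_i (L%:R - (z i)%:R).

Lemma grid_shift_disjoint (L M : nat) (z z' : {ffun 'I_n -> 'I_M}) (k : R) x :
  z != z' -> cube (aff k (grid_shift L z) x) -> cube (aff k (grid_shift L z') x) -> False.
Proof.
move=> zz' hx hx'; move/eqP: zz'; apply; apply/ffunP => i; apply/val_inj/eqP.
have := hx i; have := hx' i; rewrite /aff /= !in_itv !mxE /= => /andP[h1 h2] /andP[h3 h4].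
rewrite eqn_leq; apply/andP; split; rewrite -ltnS -(ltr_nat R) -natr1; lra.
Qed.

Lemma packing A (v : R) : open A -> bounded_set A -> (v%:E < mu A)%E ->
  exists (k : R) (Z : finType) (a : Z -> 'rV[R]_n),
    [/\ 0 < k, forall z, aff k (a z) @^-1` cube `<=` A,
       forall z z' x, z != z' -> cube (aff k (a z) x) -> cube (aff k (a z') x) -> False &
       v * k ^+ n < #|Z|%:R].
Proof.
move=> oA /bounded_rowP[L0 hL0] vA.
(* The sets [E j] of the points at sup-distance at least [1 / (j + 1)] from the
   complement of [A] increase to [A], and all the cells of side [1 / (j + 1)]
   meeting [E j] are included in [A]. *)
pose E (j : nat) : set 'rV[R]_n := [set x : 'rV[R]_n | forall y : 'rV[R]_n, (forall i, `|x ord0 i - y ord0 i| < j.+1%:R^-1) -> A y].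
have mE j : measurable (E j).
  apply: closed_measurable_row; rewrite -openC; apply/open_rowP => x /= hx.
  have [y [hy nAy]] : exists y : 'rV[R]_n, (forall i, `|x ord0 i - y ord0 i| < j.+1%:R^-1) /\ ~ A y.
    apply: contrapT => h; apply: hx => y hy; apply: contrapT => nAy; apply: h.
    by exists y.
  have [d d0 hd] : exists2 d : R, 0 < d & forall i, `|x ord0 i - y ord0 i| + d <= j.+1%:R^-1.
    exists (\big[Num.min/1]_i (j.+1%:R^-1 - `|x ord0 i - y ord0 i|)).
      apply: (big_ind (fun z : R => 0 < z)) => //; first by move=> a b a0 b0; rewrite lt_min a0 b0.
      by move=> i _; rewrite subr_gt0.
    by move=> i; rewrite addrC -lerBrDr; exact: (bigmin_le 1 i (fun i => j.+1%:R^-1 - `|x ord0 i - y ord0 i|)).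
  exists d => // x' hx' /(_ y) H; apply/nAy/H => i.
  apply: lt_le_trans (hd i); rewrite [ltRHS]addrC; apply: le_lt_trans (ler_distD (x ord0 i) _ _) _.
  by rewrite ltrD2r distrC.
have bE : \bigcup_j E j = A.
  apply/seteqP; split => [x [j _ Ejx]|x Ax].
    by apply: Ejx => i; rewrite subrr normr0 invr_gt0.
  have [e e0 he] := (open_rowP A).1 oA x Ax.
  exists (Num.truncn e^-1) => // y hy; apply: he => i; apply: lt_trans (hy i) _.
  rewrite invf_plt ?posrE//.
  by have /andP[] := truncn_itv (ltW (eqbRL (invr_gt0 _) e0)).
have [j hj] : exists j, (v%:E < mu (E j))%E.
  apply: contrapT => h; move: vA; rewrite ltNge => /negP; apply.
  have hc : (mu \o E) x @[x --> \oo] --> mu (\bigcup_j E j).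
    apply: nondecreasing_cvg_mu => //; first by rewrite bE; exact: open_measurable_row.
    move=> p q pq; apply/subsetPset => x hx y hy; apply: hx => i.
    by apply: lt_le_trans (hy i) _; rewrite lef_pV2 ?posrE ?ltr0n// ler_nat.
  rewrite -bE; apply: (cvge_to_le hc); apply: nearW => p /=; rewrite leNgt.
  by apply/negP => hp; apply: h; exists p.
pose k : R := j.+1%:R.
have k0 : 0 < k by rewrite ltr0n.
have [l hl] : exists l : nat, forall x, A x -> forall i, `|k * x ord0 i| <= l%:R.
  exists (Num.truncn (Num.max 0 (k * L0))).+1 => x Ax i.
  have m0 : 0 <= Num.max 0 (k * L0) by rewrite le_max lexx.
  have /andP[_ /ltW] := truncn_itv m0; apply: le_trans.
  by rewrite le_max normrM (gtr0_norm k0) ler_pM2l// hL0// orbT.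
(* On [A] the numbers k x_i + l lie in [0, 2l], so their integer parts take at most 2l + 1
   values. *)
pose M := (l + l).+1.
pose P (z : {ffun 'I_n -> 'I_M}) := `[< aff k (grid_shift l z) @^-1` hcube `<=` A >].
pose Z : finType := {z | P z}.
have cube_sub : cube `<=` hcube.
  by move=> x hx i; have := hx i; rewrite /= !in_itv /= => /andP[/ltW -> ->].
exists k, Z, (fun z => grid_shift l (val z)); split => //.
- move=> z; have /asboolP := valP z; apply: subset_trans => x /=; exact: cube_sub.
- by move=> z z' x zz'; apply: grid_shift_disjoint; rewrite (inj_eq val_inj).
pose cell (z : Z) := aff k (grid_shift l (val z)) @^-1` hcube.
have mh : measurable hcube by apply: measurable_box.
have mcell z : measurable (cell z).
  by rewrite -[X in measurable X]setTI; exact: measurable_aff.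
have kn0 : 0 < k ^+ n by rewrite exprn_gt0.
have cellE z : mu (cell z) = ((k ^+ n)^-1)%:E.
  have h := lebesgue_row_aff (grid_shift l (val z)) k0 mh.
  have := @lebesgue_row_cube R n (fun=> 0) 1 true true ler01.
  rewrite /= add0r -/hcube h expr1n -/(cell z) => hh.
  have /fineK fE : mu (cell z) \is a fin_num.
    rewrite ge0_fin_numE//; case: (mu (cell z)) hh => [r0 _|+|_].
    - exact: ltry.
    - by rewrite gt0_muley ?lte_fin.
    - by [].
  rewrite -fE -EFinM in hh *; case: hh => hh; congr EFin.
  by apply: (mulfI (lt0r_neq0 kn0)); rewrite hh mulfV// gt_eqF.
have cover : E j `<=` \big[setU/set0]_(z : Z) cell z.
  move=> x Ex.
  have Ax : A x by apply: Ex => i; rewrite subrr normr0 invr_gt0.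
  have t0 i : 0 <= k * x ord0 i + l%:R.
    by have := hl x Ax i; rewrite ler_norml => /andP[h _]; lra.
  have tl i : (Num.truncn (k * x ord0 i + l%:R)%R < M)%N.
    have /andP[h1 _] := truncn_itv (t0 i).
    rewrite ltnS -(ler_nat R); apply: le_trans h1 _; rewrite natrD lerD2r.
    by have := hl x Ax i; rewrite ler_norml => /andP[].
  pose z : {ffun 'I_n -> 'I_M} := [ffun i => Ordinal (tl i)].
  have zx : hcube (aff k (grid_shift l z) x).
    move=> i; rewrite /aff /= in_itv !mxE ffunE /=.
    by have /andP[h1 h2] := truncn_itv (t0 i); rewrite -natr1 in h2; apply/andP; split; lra.
  have Pz : P z.
    apply/asboolP => y hy; apply: Ex; apply: (cell_diam k0 _ zx hy).
    by rewrite /k.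
  rewrite -bigcup_seq; exists (exist _ z Pz : Z) => //=.
  by rewrite mem_index_enum.
have : (mu (E j) <= \sum_(z : Z) mu (cell z))%E.
  apply: le_trans (measure_bigsetU_le mu (index_enum Z) mcell).
  by apply: le_measure; rewrite ?inE//; apply: bigsetU_measurable.
rewrite (eq_bigr _ (fun z _ => cellE z)) sumEFin sumr_const => hle.
have := lt_le_trans hj hle; rewrite lte_fin -[_ *+ _]mulr_natl ltr_pdivlMr//.
Qed.

End packing.

Section boundary.
Context {R : realType} (n : nat).
Local Notation mu := (@lebesgue_row R n).
Implicit Types (A S : set 'rV[R]_n).

(* The translates of [S] along the i-th axis by the distinct numbers
   [1 / (j + 1)] are disjoint, have the same measure, and stay in a bounded
   set. *)
Lemma graph_null S (i : 'I_n) (b : bool) (g : 'rV[R]_n.-1 -> R) :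
  measurable S -> bounded_set S ->
  (forall x, S x -> g (col' i x) = (-1) ^+ b * x ord0 i) -> mu S = 0%E.
Proof.
move=> mS /bounded_rowP[L hL] hS.
pose a (j : nat) : 'rV[R]_n := - (j.+1%:R^-1 *: delta_mx ord0 i).
pose F (j : nat) : set 'rV[R]_n := aff 1 (a j) @^-1` S.
have mF j : measurable (F j) by rewrite -[X in measurable X]setTI; exact: measurable_aff.
have FE j : mu (F j) = mu S.
  by have := lebesgue_row_aff (a j) ltr01 mS; rewrite expr1n mul1e.
have colE j x : col' i (aff 1 (a j) x) = col' i x.
  apply/rowP => p; rewrite !mxE eqxx /=.
  by rewrite [_ == i]eq_sym (negbTE (neq_lift _ _)) mulr0 oppr0 addr0 mul1r.
have Fi j x : F j x -> g (col' i x) = (-1) ^+ b * (x ord0 i - j.+1%:R^-1).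
  by move=> /hS; rewrite colE /aff !mxE !eqxx /= mulr1 mul1r.
have tF N : trivIset [set: 'I_N] (fun j : 'I_N => F j).
  move=> j l _ _ [x [/Fi h1 /Fi h2]]; apply/val_inj.
  move: h2; rewrite h1 => /(mulfI _); rewrite signr_eq0 => /(_ isT)/addrI/oppr_inj/invr_inj/eqP.
  by rewrite eqr_nat eqSS => /eqP.
pose W : set 'rV[R]_n := box (fun=> `[- (L + 1), L + 1]%classic : set R).
have mW : measurable W by apply: measurable_box.
have FW j : F j `<=` W.
  move=> x /hL h p; rewrite /= in_itv /= -ler_norml.
  have -> : x ord0 p = (aff 1 (a j) x) ord0 p - a j ord0 p by rewrite /aff !mxE mul1r addrK.
  apply: le_trans (ler_normB _ _) _; apply: lerD; first exact: h.
  rewrite !mxE normrN normrM ger0_norm ?invr_ge0//.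
  apply: (@le_trans _ _ (j.+1%:R^-1 * 1)); last by rewrite mulr1 invf_le1 ?ltr0n// ler1n.
  by rewrite ler_wpM2l ?invr_ge0//; case: (_ && _); rewrite ?normr1 ?normr0.
have fW : (mu W < +oo)%E.
  apply: bounded_lebesgue_row_fin => //; apply/bounded_rowP; exists (L + 1) => x Wx p.
  by have := Wx p; rewrite /= in_itv /= -ler_norml.
have key N : (N%:R%:E * mu S <= mu W)%E.
  have := measure_bigsetU_ord mu predT (fun j : 'I_N => mF j) (tF N).
  rewrite (eq_bigr (fun=> mu S)) => [|j _]; last exact: FE.
  have -> : (\sum_(j < N) mu S = N%:R%:E * mu S)%E.
    rewrite big_const card_ord iter_addr addr0.
    by rewrite mule_natl.
  move=> <-; apply: le_measure; rewrite ?inE//; first by apply: bigsetU_measurable.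
  by rewrite -bigcup_seq => x [j _] /FW.
have fS : (mu S < +oo)%E by have := key 1; rewrite mul1e => h; exact: le_lt_trans fW.
have /fineK sE : mu S \is a fin_num by rewrite ge0_fin_numE.
have /fineK wE : mu W \is a fin_num by rewrite ge0_fin_numE.
rewrite -sE; congr EFin; apply/eqP; rewrite eq_le fine_ge0// andbT leNgt; apply/negP => s0.
have := key (Num.truncn (fine (mu W) / fine (mu S))).+1.
rewrite -sE -wE -EFinM lee_fin leNgt => /negP; apply.
have w0 : 0 <= fine (mu W) / fine (mu S) by rewrite divr_ge0// fine_ge0.
by have /andP[_] := truncn_itv w0; rewrite ltr_pdivrMr.
Qed.

Lemma measurable_boundary A : measurable (boundary A).
Proof.
apply: measurableD; first by apply: closed_measurable_row; exact: closed_closure.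
by apply: open_measurable_row; exact: open_interior.
Qed.

(** Locally the boundary lies on the graph: a boundary point strictly above it would belong to [A],
    which is open, and one strictly below would have a neighbourhood missing [A]. By compactness
    finitely many of these pieces cover the boundary. *)
Lemma smooth_boundary_null A : open A -> bounded_set A -> smooth_boundary A ->
  mu (boundary A) = 0%E.
Proof.
move=> oA bA sA.
have iA : A^° = A.
  by apply/seteqP; split; [exact: interior_subset|move: oA; rewrite openE].
have [L hL] := (bounded_rowP A).1 bA.
have bcl : bounded_set (closure A).
  apply/bounded_rowP; exists (L + 1) => x clx p.
  have [y [Ay]] := clx _ (nbhsx_ballx x 1 ltr01).
  move=> /(ball_rowP x y ltr01)/(_ p) xy.
  have -> : x ord0 p = y ord0 p + (x ord0 p - y ord0 p) by rewrite addrCA subrr addr0.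
  by apply: le_trans (ler_normD _ _) _; apply: lerD; [exact: hL|exact: ltW].
have bB : bounded_set (boundary A).
  have [L' hL'] := (bounded_rowP _).1 bcl.
  by apply/bounded_rowP; exists L' => x [/hL'].
have cB : compact (boundary A).
  apply: bounded_closed_compact => //; rewrite /boundary setDE; apply: closedI.
    exact: closed_closure.
  by rewrite closedC; exact: open_interior.
have loc x0 : boundary A x0 -> exists r, 0 < r /\ mu (boundary A `&` ball x0 r) = 0%E.
  move=> /sA[r [i [b [g [r0 sg eqA]]]]]; exists r; split => //.
  have mb : measurable (boundary A `&` ball x0 r).
    by apply: measurableI; [exact: measurable_boundary|apply: open_measurable_row; exact: ball_open].
  apply: (@graph_null _ i b g) => //.
    have [L' hL'] := (bounded_rowP _).1 bB.
    by apply/bounded_rowP; exists L' => x [/hL'].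
  move=> y [[cly niy] by_].
  have nAy : ~ A y by rewrite -iA.
  apply/eqP; rewrite eq_le; apply/andP; split; last first.
    rewrite leNgt; apply/negP => lt; apply: nAy.
    by have [] : (A `&` ball x0 r) y by rewrite eqA; split.
  rewrite leNgt; apply/negP => lt.
  have ccol : continuous (fun z : 'rV[R]_n => col' i z : 'rV[R]_n.-1).
    move=> z U /nbhs_ballP[e /= e0 he]; apply/nbhs_ballP; exists e => //= w [_ zw].
    by apply: he; split => // p q; rewrite !mxE; exact: zw.
  have cgc : continuous (fun z : 'rV[R]_n => g (col' i z)).
    by move=> z; apply: (continuous_comp (ccol z)); exact: smooth_continuous.
  have cg : continuous (fun z : 'rV[R]_n => g (col' i z) - (-1) ^+ b * z ord0 i).
    move=> z.
    exact: (cvgB (cgc z) (cvgM (cvg_cst _) (@coord_continuous R 1 n ord0 i z))).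
  have : nbhs y [set z | 0 < g (col' i z) - (-1) ^+ b * z ord0 i].
    have hn : nbhs (g (col' i y) - (-1) ^+ b * y ord0 i) [set t : R | 0 < t].
      by apply: open_nbhs_nbhs; split; [exact: open_gt|rewrite /= subr_gt0].
    exact: (cg y _ hn).
  move=> hpos; have hb : nbhs y (ball x0 r) by apply: open_nbhs_nbhs; split => //; exact: ball_open.
  have [z [Az [/= hz bz]]] := cly _ (filterI hpos hb).
  have [/= hlt _] : ([set x | g (col' i x) < (-1) ^+ b * x ord0 i] `&` ball x0 r) z by rewrite -eqA; split.
  by move: hz; rewrite subr_gt0 => /(lt_trans hlt); rewrite ltxx.
(* The value 1 off the boundary is a default; [F] below is empty at such points. *)
pose r x0 : R := if pselect (boundary A x0) is left h then projT1 (cid (loc x0 h)) else 1.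
have rP x0 : boundary A x0 -> 0 < r x0 /\ mu (boundary A `&` ball x0 (r x0)) = 0%E.
  by move=> h; rewrite /r; case: pselect => // h'; case: cid.
rewrite compact_cover in cB.
have [|x hx|D' D'B cov] := cB _ (boundary A) (fun x => ball x (r x)).
- by move=> x _; exact: ball_open.
- by exists x => //; apply: ballxx; exact: (rP x hx).1.
pose F x := if x \in boundary A then boundary A `&` ball x (r x) else set0.
have mF x : measurable (F x).
  rewrite /F; case: ifP => // _; apply: measurableI; first exact: measurable_boundary.
  by apply: open_measurable_row; exact: ball_open.
apply/eqP; rewrite eq_le measure_ge0 andbT.
have sub : boundary A `<=` \big[setU/set0]_(x <- finmap.enum_fset D') F x.
  move=> x Bx; have [y yD yx] := cov x Bx; rewrite -bigcup_seq; exists y => //=.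
  by rewrite /F D'B.
apply: (@le_trans _ _ (mu (\big[setU/set0]_(x <- finmap.enum_fset D') F x))).
  apply: le_measure; rewrite ?inE//; first exact: measurable_boundary.
  by apply: bigsetU_measurable.
apply: le_trans (measure_bigsetU_le mu _ mF) _.
rewrite big1// => x _; rewrite /F; case: ifPn => [|_]; last exact: measure0.
by rewrite inE => /rP[].
Qed.

End boundary.

(** * Asymptotics *)

(** Since (1 + 1/Y)^N tends to 1, the gap between [a] and [b] absorbs the rounding of a large number
    to an integer. *)
Lemma ltr_pow_shift (R : realType) (N : nat) (a b : R) : 0 < a -> a < b ->
  exists2 Y : R, 0 < Y & forall y q, Y <= y -> 0 <= q -> q <= y + 1 ->
    a * q ^+ N <= b * y ^+ N.
Proof.
move=> a0 ab.
have h1 : (1 + j.+1%:R^-1 : R) @[j --> \oo] --> (1 : R).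
  by have := cvgD (cvg_cst (1 : R)) (@cvg_harmonic R); rewrite addr0; exact.
have hN : ((1 + j.+1%:R^-1) ^+ N : R) @[j --> \oo] --> (1 : R).
  elim: N => [|N IH]; first by under eq_fun do rewrite expr0; exact: cvg_cst.
  under eq_fun do rewrite exprS.
  by have := cvgM h1 IH; rewrite mulr1; exact.
have hc : (a * (1 + j.+1%:R^-1) ^+ N) @[j --> \oo] --> a.
  by have := cvgM (cvg_cst a) hN; rewrite mulr1; exact.
have ba0 : 0 < b - a by rewrite subr_gt0.
have [j _ hj] := (cvgrPdist_lt _ _).1 hc _ ba0.
have := hj j (leqnn j) => /= {}hj.
have {}hj : a * (1 + j.+1%:R^-1) ^+ N <= b.
  by move: hj; rewrite distrC => /ltW/(le_trans (ler_norm _)); lra.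
exists j.+1%:R; first by rewrite ltr0n.
move=> y q Yy q0 qy.
have y0 : 0 < y by apply: lt_le_trans Yy; rewrite ltr0n.
have hq : q <= (1 + j.+1%:R^-1) * y.
  apply: le_trans qy _; rewrite mulrDl mul1r lerD2l mulrC ler_pdivlMr ?ltr0n// mul1r//.
apply: (@le_trans _ _ (a * ((1 + j.+1%:R^-1) * y) ^+ N)).
  by rewrite ler_pM2l//; apply: lerXn2r; rewrite ?nnegrE ?(le_trans q0 hq).
by rewrite exprMn mulrA ler_pM2r// exprn_gt0.
Qed.

Section asymptotics.
Context {R : realType} (n : nat) (n_gt0 : (0 < n)%N).
Local Notation mu := (@lebesgue_row R n).
Local Notation cube := (@unit_cube R n).
Implicit Types (A : set 'rV[R]_n) (x y : R).

Definition nroot x : R := x `^ (n%:R^-1).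

Let nR0 : n%:R != 0 :> R.
Proof. by rewrite pnatr_eq0 -lt0n. Qed.

Lemma nrootK x : 0 <= x -> nroot x ^+ n = x.
Proof. by move=> x0; rewrite -powR_mulrn ?powR_ge0// -powRrM mulVf// powRr1. Qed.

Lemma nroot_gt0 x : 0 < x -> 0 < nroot x.
Proof. exact: powR_gt0. Qed.

Lemma nroot_ge0 x : 0 <= nroot x.
Proof. exact: powR_ge0. Qed.

Lemma nrootM x y : 0 <= x -> 0 <= y -> nroot (x * y) = nroot x * nroot y.
Proof. exact: powRM. Qed.

Lemma nrootXn x : 0 <= x -> nroot (x ^+ n) = x.
Proof. by move=> x0; rewrite /nroot -powR_mulrn// -powRrM mulfV// powRr1. Qed.

Lemma ltr_nroot x y : 0 <= x -> x < y -> nroot x < nroot y.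
Proof.
move=> x0 xy; apply: gt0_ltr_powR; rewrite ?nnegrE ?invr_gt0 ?ltr0n//.
exact: le_trans (ltW xy).
Qed.

Lemma ler_nroot x y : 0 <= x -> x <= y -> nroot x <= nroot y.
Proof.
move=> x0; rewrite le_eqVlt => /predU1P[->//|xy]; apply: ltW; exact: ltr_nroot.
Qed.

(** The power m^(1 + 2/n), split so that it is visibly multiplicative and open to polynomial
    arithmetic. It is the growth given by Weyl's law for sums of eigenvalues. *)
Definition weyl_scale (m : nat) : R := m%:R * nroot m%:R ^+ 2.

Lemma weyl_scale_gt0 m : (0 < m)%N -> 0 < weyl_scale m.
Proof. by move=> m0; rewrite mulr_gt0 ?ltr0n// exprn_gt0// nroot_gt0// ltr0n. Qed.

Lemma weyl_scaleE m : (0 < m)%N -> m%:R `^ (1 + 2 / n%:R) = weyl_scale m.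
Proof.
move=> m0; have mn0 : (m%:R : R) != 0 by rewrite pnatr_eq0 -lt0n.
rewrite powRD ?mn0 ?implybT// powRr1// /weyl_scale; congr (_ * _).
by rewrite [2 / _]mulrC powRrM powR_mulrn// powR_ge0.
Qed.

Lemma admissible_card A (I J : finType) (e : R) : (#|J| <= #|I|)%N ->
  admissible A I e -> admissible A J e.
Proof.
move=> JI; apply: (@admissible_inj _ _ _ _ _ (fun j => enum_val (widen_ord JI (enum_rank j)))).
move=> j l /enum_val_inj /(congr1 val) /= h; apply: enum_rank_inj; exact: val_inj.
Qed.

Lemma lebesgue_row_unit_cube : mu cube = 1%E.
Proof.
have := @lebesgue_row_cube R n (fun=> 0) 1 false true ler01.
by rewrite /= add0r expr1n.
Qed.

Lemma open_box_itv (a b : R) : open (box (fun=> `]a, b[%classic : set R) : set 'rV[R]_n).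
Proof.
apply/open_rowP => x hx.
exists (\big[Num.min/1]_i Num.min (x ord0 i - a) (b - x ord0 i)).
  apply: (big_ind (fun z : R => 0 < z)) => //; first by move=> u v u0 v0; rewrite lt_min u0 v0.
  by move=> i _; have := hx i; rewrite /= in_itv /= lt_min !subr_gt0.
move=> y hy i; have := hy i; have := hx i; rewrite /= !in_itv /= => /andP[h1 h2] h3.
have := lt_le_trans h3 (bigmin_le 1 i (fun i => Num.min (x ord0 i - a) (b - x ord0 i))).
rewrite lt_min !ltr_norml => /andP[/andP[h4 h5] /andP[h6 h7]].
by apply/andP; split; lra.
Qed.

Definition ratio_min : R := (nroot 4^-1) ^+ 2 / (16 * n%:R).

Lemma ratio_min_gt0 : 0 < ratio_min.
Proof.
apply: divr_gt0; last by rewrite mulr_gt0 ?ltr0n.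
by apply: exprn_gt0; apply: nroot_gt0; rewrite invr_gt0.
Qed.

Lemma admissible_unit_cube_lower m (e : R) : (0 < m)%N -> admissible cube 'I_m e -> ratio_min * weyl_scale m <= e.
Proof.
move=> m0 h; have mR0 : 0 < (m%:R : R) by rewrite ltr0n.
have m40 : 0 < (m%:R : R) * 4^-1 by rewrite mulr_gt0.
(* The scale s = 1/y is chosen so that 2 s^-n = m/2, which is absorbed by the left-hand side [m] of
   [admissible_lower]; this produces the constants 16 and 1/4 of [ratio_min]. *)
pose y := nroot (m%:R * 4^-1).
have y0 : 0 < y by exact: nroot_gt0.
have mcube : measurable cube by apply: measurable_box.
have y1 : 0 < y^-1 by rewrite invr_gt0.
have := admissible_lower mcube lebesgue_row_unit_cube y1 h.
rewrite card_ord !exprVn invrK (nrootK (ltW m40)) => H.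
have yE : y ^+ 2 = nroot m%:R ^+ 2 * nroot 4^-1 ^+ 2 by rewrite /y nrootM// ?exprMn// ltW.
have H2 : m%:R <= 16 * n%:R * (y ^+ 2)^-1 * e by lra.
have y20 : 0 < y ^+ 2 by rewrite exprn_gt0.
have H3 : m%:R * y ^+ 2 <= 16 * n%:R * e.
  rewrite -(ler_pM2r y20) in H2; apply: le_trans H2 _.
  by rewrite le_eqVlt; apply/orP; left; apply/eqP; field; rewrite gt_eqF.
rewrite /ratio_min /weyl_scale mulrAC ler_pdivrMr ?mulr_gt0 ?ltr0n// [e * _]mulrC.
apply: le_trans H3; rewrite yE le_eqVlt; apply/orP; left; apply/eqP; ring.
Qed.

Definition ratios : set R :=
  [set r | exists m e, [/\ (0 < m)%N, admissible cube 'I_m e & r = e / weyl_scale m]].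

Definition c0 : R := inf ratios.

Lemma ratios_lbound : lbound ratios ratio_min.
Proof.
move=> _ [m [e [m0 h ->]]]; rewrite ler_pdivlMr ?weyl_scale_gt0//; exact: admissible_unit_cube_lower.
Qed.

Lemma ratios_neq0 : ratios !=set0.
Proof. by have [e he] := @admissible_unit_cube R n; exists (e / weyl_scale 1), 1%N, e. Qed.

Lemma ratio_inf_gt0 : 0 < c0.
Proof. by apply: lt_le_trans ratio_min_gt0 _; exact: lb_le_inf ratios_neq0 ratios_lbound. Qed.

Lemma ratio_inf_le m (e : R) : (0 < m)%N -> admissible cube 'I_m e -> c0 * weyl_scale m <= e.
Proof.
move=> m0 h; rewrite -ler_pdivlMr ?weyl_scale_gt0//; apply: ge_inf; last by exists m, e.
by exists ratio_min; exact: ratios_lbound.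
Qed.

Lemma ratio_inf_lt (c : R) : c0 < c ->
  exists m e, [/\ (0 < m)%N, admissible cube 'I_m e & e < c * weyl_scale m].
Proof.
rewrite -subr_gt0 => cc.
have [|_ [m [e [m0 h ->]]]] := inf_adherent cc (E := ratios).
  by split; [exact: ratios_neq0|exists ratio_min; exact: ratios_lbound].
by rewrite -/c0 addrC subrK ltr_pdivrMr ?weyl_scale_gt0// => H; exists m, e.
Qed.

(** The energy grows by q^(n+2) while the number of functions grows by q^n: the ratio to
    [weyl_scale] is unchanged. *)
Lemma admissible_subgrid (I : finType) (q : nat) (e : R) : (0 < q)%N ->
  admissible cube I e ->
  admissible cube ({ffun 'I_n -> 'I_q} * I)%type (q%:R ^+ n * q%:R ^+ 2 * e).
Proof.
move=> q0 h; have qR0 : 0 < (q%:R : R) by rewrite ltr0n.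
have := @admissible_grid R n cube cube I {ffun 'I_n -> 'I_q} q%:R (@grid_shift R n 0 q) e qR0.
rewrite card_ffun !card_ord natrX; apply => //.
- move=> z x hx i; have := hx i; rewrite /aff /= !in_itv !mxE /= sub0r => /andP[h1 h2].
  have zq : (z i)%:R + 1 <= (q%:R : R) by rewrite natr1 ler_nat.
  have z0 : 0 <= (z i)%:R :> R by [].
  apply/andP; split.
    by rewrite -(pmulr_rgt0 _ qR0); lra.
  by rewrite -(ltr_pM2l qR0); lra.
- by move=> z z' x; exact: grid_shift_disjoint.
Qed.

(** The strict inequality between [c0] and [c] v^(2/n) leaves room for three losses: a family in the
    cube that is only nearly optimal, volume missed by the packing, and rounding of the subdivision
    to an integer. *)
Lemma admissible_upper A (v c : R) : open A -> bounded_set A -> 0 < v -> mu A = v%:E ->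
  c0 < c * nroot v ^+ 2 ->
  exists M : nat, forall m, (M <= m)%N -> admissible A 'I_m (c * weyl_scale m).
Proof.
move=> oA bA v0 Av cv.
have rv0 : 0 < nroot v ^+ 2 by rewrite exprn_gt0// nroot_gt0.
have c_gt0 : 0 < c by rewrite -(pmulr_lgt0 _ rv0); exact: lt_trans ratio_inf_gt0 cv.
pose c1 := (c0 + c * nroot v ^+ 2) / 2.
have c01 : c0 < c1 by rewrite /c1; lra.
have c1v : c1 < c * nroot v ^+ 2 by rewrite /c1; lra.
have c1_gt0 : 0 < c1 := lt_trans ratio_inf_gt0 c01.
(* Chosen so that c t^2 = c1: packing a volume t^n < v still leaves enough cells for the constant
   [c1] per unit cube to give [c] on [A]. *)
pose t := Num.sqrt (c1 / c).
have cc0 : 0 < c1 / c by exact: divr_gt0.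
have t2 : t ^+ 2 = c1 / c by rewrite sqr_sqrtr// ltW.
have t_gt0 : 0 < t by rewrite sqrtr_gt0.
have tv : t < nroot v.
  rewrite -(@ltr_pXn2r _ 2)// ?nnegrE ?nroot_ge0 ?ltW// t2 ltr_pdivrMr//.
  by rewrite mulrC.
have v1v : t ^+ n < v.
  rewrite -[ltRHS](nrootK (ltW v0)) ltr_pXn2r// ?nnegrE ?nroot_ge0// ltW//.
have [|k [Z [a [k0 hsub hdis hN]]]] := @packing R n A (t ^+ n) oA bA.
  by rewrite Av lte_fin.
set N := #|Z| in hN.
have NR0 : 0 < (N%:R : R).
  by apply: lt_trans hN; rewrite mulr_gt0 ?exprn_gt0.
have [m0 [e0 [m0_gt0 hm0 he0]]] := ratio_inf_lt c01.
have m0R : 0 < (m0%:R : R) by rewrite ltr0n.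
have tkN : t * k < nroot N%:R.
  have tk0 : 0 < t * k by exact: mulr_gt0.
  rewrite -(nrootXn (ltW tk0)); apply: ltr_nroot; first by rewrite exprn_ge0// ltW.
  by rewrite exprMn.
have ab : k ^+ 2 * c1 < c * nroot N%:R ^+ 2.
  have -> : k ^+ 2 * c1 = c * (t * k) ^+ 2.
    by rewrite exprMn t2; field; rewrite gt_eqF.
  rewrite ltr_pM2l// ltr_pXn2r// nnegrE ?nroot_ge0// mulr_ge0// ltW//.
have [Y Y0 hY] := ltr_pow_shift (n.+2) (mulr_gt0 (exprn_gt0 2 k0) c1_gt0) ab.
(* The number of functions before subdivision; dividing each cube into q^n cells gives K q^n of
   them. *)
pose K : R := N%:R * m0%:R.
have K0 : 0 < K by exact: mulr_gt0.
have KY0 : 0 <= K * Y ^+ n by rewrite mulr_ge0 ?exprn_ge0 ?ltW.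
exists (Num.truncn (K * Y ^+ n)).+1 => m mM.
have m_gt0 : (0 < m)%N by exact: leq_trans mM.
have mR0 : 0 < (m%:R : R) by rewrite ltr0n.
have mK : K * Y ^+ n <= m%:R.
  have /andP[_ /ltW h] := truncn_itv KY0; apply: le_trans h _; by rewrite ler_nat.
pose y := nroot (m%:R / K).
have mK0 : 0 < m%:R / K by exact: divr_gt0.
have y_gt0 : 0 < y by exact: nroot_gt0.
have yn : y ^+ n = m%:R / K by rewrite nrootK// ltW.
have Yy : Y <= y.
  by rewrite -(nrootXn (ltW Y0)); apply: ler_nroot; [rewrite exprn_ge0// ltW|rewrite ler_pdivlMr// mulrC].
(* Rounding [y] upwards provides at least K y^n = m functions; the surplus is discarded by
   [admissible_card]. *)
pose q := (Num.truncn y).+1.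
have /andP[q1 q2] := truncn_itv (ltW y_gt0).
have qy : q%:R <= y + 1 by rewrite /q -natr1 lerD2r.
have qR0 : 0 < (q%:R : R) by rewrite ltr0n.
have h1 := admissible_subgrid (ltn0Sn (Num.truncn y)) hm0.
have h2 := admissible_grid k0 hsub hdis h1.
apply: (admissible_le _ (admissible_card _ h2)).
  have hq := hY y q%:R Yy (ltW qR0) qy.
  have mE : m%:R = K * y ^+ n by rewrite yn mulrC divfK// gt_eqF.
  have rmE : nroot m%:R = nroot N%:R * nroot m0%:R * y.
    have -> : m%:R = K * (m%:R / K) by rewrite mulrC divfK// gt_eqF.
    by rewrite nrootM ?(ltW K0) ?(ltW mK0)// /K nrootM// ltW.
  have r0 : 0 < nroot m0%:R ^+ 2 by rewrite exprn_gt0// nroot_gt0.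
  have E1 : c * weyl_scale m = K * nroot m0%:R ^+ 2 * (c * nroot N%:R ^+ 2 * y ^+ n.+2).
    by rewrite /weyl_scale rmE [in X in c * (X * _)]mE !exprS; ring.
  rewrite E1 -/q -/N.
  apply: (@le_trans _ _ (N%:R * k ^+ 2 * (q%:R ^+ n * q%:R ^+ 2 * (c1 * weyl_scale m0)))).
    apply: ler_wpM2l; first by rewrite mulr_ge0 ?sqr_ge0.
    apply: ler_wpM2l; last exact: ltW.
    by rewrite mulr_ge0 ?sqr_ge0// exprn_ge0.
  have -> : N%:R * k ^+ 2 * (q%:R ^+ n * q%:R ^+ 2 * (c1 * weyl_scale m0)) =
     K * nroot m0%:R ^+ 2 * (k ^+ 2 * c1 * q%:R ^+ n.+2).
    by rewrite /weyl_scale /K !exprS; ring.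
  by apply: ler_wpM2l hq; rewrite mulr_ge0 ?ltW.
rewrite !card_prod card_ffun !card_ord -(ler_nat R) !natrM natrX -/q -/N.
have -> : m%:R = K * y ^+ n by rewrite yn mulrC divfK// gt_eqF.
rewrite /K -mulrA; apply: ler_wpM2l; first exact: ltW.
rewrite mulrC; apply: ler_wpM2r; first exact: ltW.
by apply: lerXn2r; rewrite ?nnegrE ?ltW.
Qed.

Lemma admissible_asymptotic_lower (Omega : set 'rV[R]_n) (c : R) :
  open Omega -> bounded_set Omega -> smooth_boundary Omega -> mu Omega = 1%E ->
  c < c0 ->
  exists M : nat, forall m e, (M <= m)%N -> admissible Omega 'I_m e -> c * weyl_scale m <= e.
Proof.
move=> oO bO sO O1 cc0.
have bd0 := smooth_boundary_null oO bO sO.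
have [l [l_gt0 hl]] : exists l : nat, (0 < l)%N /\ forall x : 'rV[R]_n, Omega x -> forall i, `|x ord0 i| < l%:R.
  have [L hL] := (bounded_rowP _).1 bO.
  have m0 : 0 <= Num.max 0 L by rewrite le_max lexx.
  exists (Num.truncn (Num.max 0 L)).+1; split => // x Ox i.
  have /andP[_] := truncn_itv m0; apply: le_lt_trans.
  by rewrite le_max hL// orbT.
have lR : 0 < (l%:R : R) by rewrite ltr0n.
pose W : set 'rV[R]_n := box (fun=> `]- l%:R, l%:R[%classic : set R).
have oW : open W by exact: open_box_itv.
have mW : measurable W by exact: open_measurable_row.
(* An integer volume makes [V * m] a number of functions that splits as [m] on Omega and (V - 1) m
   on the complement, in proportion to the volumes. *)
pose V := ((2 * l) ^ n)%N.
have VR : (V%:R : R) = (2 * l%:R) ^+ n by rewrite natrX natrM.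
have WV : mu W = V%:R%:E.
  have l20 : 0 <= 2 * l%:R :> R by rewrite mulr_ge0.
  have := @lebesgue_row_cube R n (fun=> - l%:R) (2 * l%:R) false true l20.
  by rewrite /= (_ : - l%:R + 2 * l%:R = l%:R :> R) ?VR//; ring.
have OW : Omega `<=` W.
  by move=> x Ox i; have := hl x Ox i; rewrite /= in_itv /= ltr_norml.
have bW : bounded_set W.
  apply/bounded_rowP; exists l%:R => x Wx i.
  by have := Wx i; rewrite /= in_itv /= -ltr_norml => /ltW.
pose B := W `\` closure Omega.
have oB : open B.
  by rewrite /B setDE; apply: openI => //; rewrite openC; exact: closed_closure.
have bB : bounded_set B.
  by have [L' hL'] := (bounded_rowP _).1 bW; apply/bounded_rowP; exists L' => x [/hL'].
have mcl : measurable (closure Omega) by apply: closed_measurable_row; exact: closed_closure.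
have mO : measurable Omega by exact: open_measurable_row.
have iO : Omega^° = Omega.
  by apply/seteqP; split; [exact: interior_subset|move: oO; rewrite openE].
have WO1 : mu (W `&` closure Omega) = 1%E.
  apply/eqP; rewrite eq_le; apply/andP; split.
    apply: (@le_trans _ _ (mu (Omega `|` boundary Omega))).
      apply: le_measure; rewrite ?inE; [exact: measurableI|apply: measurableU => //; exact: measurable_boundary|].
      move=> x [_ clx]; have [Ox|nOx] := pselect (Omega x); [by left|right].
      by split => //; rewrite iO.
    apply: le_trans (measureU2 _ _ _) _ => //; first exact: measurable_boundary.
    rewrite [X in (X + _ <= _)%E](_ : _ = 1%E); last exact: O1.
    by rewrite [X in (_ + X <= _)%E](_ : _ = 0%E) ?adde0//; exact: bd0.
  rewrite -O1; apply: le_measure; rewrite ?inE//; first exact: measurableI.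
  by move=> x Ox; split; [exact: OW|exact: subset_closure].
have fW : (mu W < +oo)%E by rewrite WV ltry.
have BV : mu B = (V%:R - 1)%:E.
  have := measureD mW mcl fW.
  by rewrite [X in (_ = _ - X)%E -> _]WO1 [X in (_ = X - _)%E -> _]WV -EFinB.
have V2 : (1 < V)%N.
  apply: (@leq_trans (2 ^ n)%N); last by rewrite leq_exp2r// leq_pmulr.
  by apply: (@leq_trans (2 ^ 1)%N) => //; rewrite leq_exp2l.
have VE : V = V.-1.+1 by rewrite prednK// ltnW.
pose U := V.-1.
have U_gt0 : (0 < U)%N by rewrite /U -ltnS -VE.
have UR : (U%:R : R) = V%:R - 1 by rewrite VE -natr1 addrK.
have UR0 : 0 < (U%:R : R) by rewrite ltr0n.
(* The excess over [c0] is divided by [U] because it is paid once per unit of volume of [B]: the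
   total error is exactly c0 - c. *)
pose c1 := c0 + (c0 - c) / U%:R.
have c01 : c0 < c1 by rewrite ltrDl divr_gt0// subr_gt0.
have rU0 : 0 < nroot U%:R ^+ 2 by rewrite exprn_gt0// nroot_gt0.
have BU : mu B = U%:R%:E by rewrite BV UR.
have cU : c0 < c1 / nroot U%:R ^+ 2 * nroot U%:R ^+ 2 by rewrite divfK// gt_eqF.
have [M hM] := admissible_upper oB bB UR0 BU cU.
exists M.+1 => m e mM he.
have m_gt0 : (0 < m)%N by exact: leq_trans mM.
have hB := hM (U * m)%N (leq_trans (ltnW mM) (leq_pmull m U_gt0)).
have OB : Omega `&` B = set0.
  by apply/seteqP; split => // x [Ox [_]]; apply; exact: subset_closure.
have hW := admissible_union OW (@subDsetl _ _ _) OB he hB.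
have l2 : 0 < 2 * l%:R :> R by rewrite mulr_gt0.
(* Shrinking the box to the unit cube multiplies energies by (2l)^2 = V^(2/n), the same factor that
   [weyl_scale (V * m)] contains; it cancels below. *)
have hQ : admissible cube ('I_m + 'I_(U * m))%type ((2 * l%:R) ^+ 2 * (e + c1 / nroot U%:R ^+ 2 * weyl_scale (U * m))).
  apply: (admissible_aff (a := const_mx (- l%:R)) l2 _ hW) => x hx i.
  have := hx i; rewrite /aff /= !in_itv !mxE /= => /andP[h1 h2].
  apply/andP; split.
    by rewrite -(pmulr_rgt0 _ l2); lra.
  by rewrite -(ltr_pM2l l2); lra.
have hV : admissible cube 'I_(V * m) ((2 * l%:R) ^+ 2 * (e + c1 / nroot U%:R ^+ 2 * weyl_scale (U * m))).
  apply: admissible_card hQ; rewrite card_sum !card_ord.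
  by rewrite {1}VE mulSn.
have := ratio_inf_le (ltac:(by rewrite muln_gt0 m_gt0 andbT ltnW) : (0 < V * m)%N) hV.
have mpM a : weyl_scale (a * m) = a%:R * nroot a%:R ^+ 2 * weyl_scale m.
  by rewrite /weyl_scale natrM nrootM// exprMn; ring.
rewrite !mpM.
have -> : nroot V%:R = 2 * l%:R by rewrite VR nrootXn// ltW.
have l20 : 0 < (2 * l%:R) ^+ 2 :> R by rewrite exprn_gt0.
have -> : c0 * (V%:R * (2 * l%:R) ^+ 2 * weyl_scale m) = (2 * l%:R) ^+ 2 * (c0 * V%:R * weyl_scale m) by ring.
rewrite ler_pM2l// => H.
have E : c1 / nroot U%:R ^+ 2 * (U%:R * nroot U%:R ^+ 2 * weyl_scale m) = (c0 * U%:R + (c0 - c)) * weyl_scale m.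
  by rewrite /c1; field; rewrite !gt_eqF ?nroot_gt0.
rewrite E in H.
have VU : V%:R = U%:R + 1 :> R by rewrite UR subrK.
rewrite VU in H; lra.
Qed.

Lemma l1_energy_cvg (Omega : set 'rV[R]_n) : smooth_bounded_domain Omega ->
  mu Omega = 1%E -> l1_energy Omega m @[m --> \oo] --> c0%:E.
Proof.
move=> [oO _ _ bO sO] O1.
have mO : measurable Omega by exact: open_measurable_row.
have rt1 : nroot 1 = 1 by rewrite /nroot powR1.
have key d : 0 < d -> exists M : nat, forall m, (M <= m)%N ->
    ((c0 - d)%:E <= l1_energy Omega m <= (c0 + d)%:E)%E.
  move=> d0.
  have [|M1 h1] := @admissible_upper Omega 1 (c0 + d) oO bO ltr01 O1.
    by rewrite rt1 expr1n mulr1 ltrDl.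
  have [|M2 h2] := @admissible_asymptotic_lower Omega (c0 - d) oO bO sO O1.
    by rewrite ltrBlDr ltrDl.
  exists (maxn M1 M2).+1 => m mM.
  have m_gt0 : (0 < m)%N by exact: leq_trans mM.
  have M1m : (M1 <= m)%N by apply: leq_trans (ltnW mM); rewrite leq_maxl.
  have M2m : (M2 <= m)%N by apply: leq_trans (ltnW mM); rewrite leq_maxr.
  have mp0 := weyl_scale_gt0 m_gt0.
  have up : (ereal_inf (energies Omega m) <= ((c0 + d) * weyl_scale m)%:E)%E.
    have [E hE Ele] := admissible_energies mO (h1 m M1m).
    by apply: ge_ereal_inf; exists E.
  have lo : (((c0 - d) * weyl_scale m)%:E <= ereal_inf (energies Omega m))%E.
    apply: le_ereal_inf_tmp => _ /(energies_admissible mO)[e -> he].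
    by rewrite lee_fin; exact: h2 he.
  rewrite /l1_energy weyl_scaleE//.
  have i0 : (0 <= ((weyl_scale m)^-1)%:E)%E by rewrite lee_fin invr_ge0 ltW.
  apply/andP; split.
    have := lee_wpmul2r i0 lo; rewrite -EFinM mulfK// gt_eqF//.
  by have := lee_wpmul2r i0 up; rewrite -EFinM mulfK// gt_eqF.
(* Convergence in the extended reals: the two-sided bounds first give finiteness for large m, then
   the limit of the real values. *)
apply/fine_cvgP; split.
  have [M hM] := key 1 ltr01; exists M => // m /= /hM /andP[h1 h2].
  rewrite fin_numE; apply/andP; split.
    by rewrite gt_eqF// (lt_le_trans _ h1)// ltNyr.
  by rewrite lt_eqF// (le_lt_trans h2)// ltry.
apply/cvgrPdist_le => d d0; have [M hM] := key d d0; exists M => // m /= /hM /andP[].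
case: (l1_energy Omega m) => [r||] //=; rewrite !lee_fin => h1 h2.
by rewrite ler_norml; apply/andP; split; lra.
Qed.

End asymptotics.

Theorem theorem1p1 (R : realType) (n : nat) (n_gt0 : (0 < n)%N) :
  exists2 c0 : R, 0 < c0 &
    forall Omega : set 'rV[R]_n,
      smooth_bounded_domain Omega ->
      lebesgue_row n Omega = 1%E ->
      l1_energy Omega m @[m --> \oo] --> c0%:E.
Proof.
exists (c0 n); first exact: ratio_inf_gt0.
by move=> Omega sO O1; exact: l1_energy_cvg.
Qed.
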